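(* Let $d\in\mathbb N$, and let $(\mathbb X_n)_{n\ge1}$ and $\mathbb X_\infty$ be point processes on $\mathbb R^d$, defined on a common probability space with measure $\mathbb P$, whose first intensity measures are absolutely continuous with respect to Lebesgue measure, with $\mathbb X_n\to\mathbb X_\infty$ a.s. and $\mathbb X_\infty$ number-rigid. Let $\mathcal D\subset\mathbb R^d$ be a bounded open set whose boundary has zero Lebesgue measure, suppose that conditionally on $\mathbb X_{\infty}\cap\mathcal D^\complement=\Upsilon$ the points of $\mathbb X_\infty\cap\mathcal D$, considered as a vector, lie on a smooth symmetric submanifold $\Sigma(\Upsilon)$ of $(\mathbb R^d)^{\mathfrak N(\Upsilon)}$, and let $\Phi,\Psi:\mathbb R^d\to\mathbb R\cup\{\infty\}$ be potential functions. If $((\mathbb X_n)_{n\ge1},\mathbb X_\infty)$ satisfies the approximate Gibbs property with the potentials $(\Phi,\Psi)$ on $\mathcal D$, then $\mathbb X_\infty$ satisfies the generalized Gibbs property with the potentials $(\Phi,\Psi)$ on $\mathcal D$.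
   Context: For a Borel set $F\subset\mathbb R^d$, $\mathscr P(F)$ is the space of locally finite point configurations on $F$ (with its usual vague topology), and $\mathcal B(\mathscr P(F))$ its Borel $\sigma$-algebra. Put $\mathbb N=\{1,2,\dots\}$. For $n\in\mathbb N\cup\{\infty\}$ put $\mathbb X_{n,\mathrm{in}}=\mathbb X_n\cap\mathcal D$, $\mathbb X_{n,\mathrm{out}}=\mathbb X_n\cap\mathcal D^\complement$. Number-rigidity of $\mathbb X_\infty$: for every bounded open set $\mathcal D$ with Lebesgue-null boundary there is a measurable $\mathfrak N:\mathscr P(\mathcal D^\complement)\to\mathbb N\cup\{0\}$ with $|\mathbb X_\infty\cap\mathcal D|=\mathfrak N(\mathbb X_\infty\cap\mathcal D^\complement)$ a.s. ''Symmetric'' submanifold means invariant under permutations of the $\mathfrak N(\Upsilon)$ coordinates. Potentials: for a finite configuration $\sigma\subset\mathbb R^d$, $$\mathcal H^{\Phi,\Psi}[\sigma]=\sum_{x\in\sigma}\Phi(x)+\sum_{\{x,y\}\subset\sigma,\,x\ne y}\Psi(x-y).$$ $\mathfrak P_{\mathcal D}^{\mathfrak N(\Upsilon),\Sigma(\Upsilon)}$ is the standard Poisson point process on $\mathcal D$ conditioned to have $\mathfrak N(\Upsilon)$ points which, as a vector, lie on $\Sigma(\Upsilon)$; i.e. the law of the unordered configuration of a random vector distributed according to the normalized Lebesgue (surface) measure on $\Sigma(\Upsilon)\cap\mathcal D^{\mathfrak N(\Upsilon)}$. The associated probability kernel $\nu_{\Phi,\Psi,\mathcal D}:\mathcal B(\mathscr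 P(\mathcal D))\times\mathscr P(\mathcal D^\complement)\to[0,1]$ is $$\nu_{\Phi,\Psi,\mathcal D}(A;\Upsilon)=\frac1{Z(\Upsilon)}\int_A\exp(-\mathcal H^{\Phi,\Psi}[\sigma])\,\mathrm d\mathfrak P_{\mathcal D}^{\mathfrak N(\Upsilon),\Sigma(\Upsilon)}(\sigma),$$ with $Z(\Upsilon)$ the appropriate normalizing factor. Generalized Gibbs property of $\mathbb X_\infty$ with the potentials $(\Phi,\Psi)$ on $\mathcal D$: with $\mathbb P_{\mathcal D|\mathcal D^\complement}[\cdot|\cdot]$ the conditional distribution of $\mathbb X_{\infty,\mathrm{in}}$ given $\mathbb X_{\infty,\mathrm{out}}$, there exist measurable $\mathfrak m,\mathfrak M:\mathscr P(\mathcal D^\complement)\to(0,\infty)$ such that for a.e. $\Upsilon$ with respect to the law of $\mathbb X_{\infty,\mathrm{out}}$ and all $A\in\mathcal B(\mathscr P(\mathcal D))$, $$\mathfrak m(\Upsilon)\int_A e^{-\mathcal H^{\Phi,\Psi}[\sigma]}\mathrm d\mathfrak P_{\mathcal D}^{\mathfrak N(\Upsilon),\Sigma(\Upsilon)}(\sigma)\le\mathbb P_{\mathcal D|\mathcal D^\complement}[A|\Upsilon]\le\mathfrak M(\Upsilon)\int_A e^{-\mathcal H^{\Phi,\Psi}[\sigma]}\mathrm d\mathfrak P_{\mathcal D}^{\mathfrak N(\Upsilon),\Sigma(\Upsilon)}(\sigma).$$ Sets inside $\mathcal D$: for $m\in\mathbb N$, $\widehat{\mathfrak A}^m_{\mathrm{in}}$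 is the collection of all finite unions of sets $\{\Upsilon\in\mathscr P(\mathcal D):|\Upsilon|=m,\ |\Upsilon\cap B_i|=1,\ 1\le i\le m\}$, where $B_1,\dots,B_m$ are disjoint open balls in $\mathcal D$ with rational centers and rational radii. Sets outside $\mathcal D$: $\widehat{\mathfrak B}_{\mathrm{out}}$ is the collection of all finite unions of sets $\{\Upsilon\in\mathscr P(\mathcal D^\complement):|\Upsilon\cap B|=n,\ |\Upsilon\cap B_i|=1,\ 1\le i\le n\}$, where $n$ is a positive integer, $B\subset\mathcal D^\complement$ is a closed annulus centered at the origin with rational inradius and rational outradius, and $B_1,\dots,B_n$ are disjoint open balls with rational radii and with centers having rational coordinates, such that $B_i\cap\mathcal D^\complement\subset B$. Events: for $m\in\mathbb N$, $\Omega^m_\infty=\{|\mathbb X_{\infty,\mathrm{in}}|=m\}$, and $\Omega^m_n=\{|\mathbb X_{n,\mathrm{in}}|=m\}$ for $n\ge m$. A sequence of events $(\mathcal E_j)_{j\ge1}$ exhausts $\mathcal E$ if $\mathcal E_j\subset\mathcal E_{j+1}\subset\mathcal E$ for all $j$ and $\mathbb P(\mathcal E\setminus\mathcal E_j)\to0$. Approximate Gibbs property with the potentials $(\Phi,\Psi)$ on $\mathcal D$: writing $\nu=\nu_{\Phi,\Psi,\mathcal D}$, for every $m\in\mathbb N$ with $\mathbb P(\Omega^m_\infty)>0$, (a) there is a sequence of events $(\Omega(j))_{j\ge1}$, each measurable with respect to $\mathbb X_{\infty,\mathrm{out}}$, which exhausts $\Omega^m_\infty$; (b) for each $j\ge1$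 there are a sequence of positive integers $(n_k)_{k\ge1}$ with $n_k\to\infty$, events $(\Omega_{n_k}(j))_{k\ge1}$ and real numbers $(\vartheta(j,k))_{k\ge1}$ such that: $\lim_{k\to\infty}\vartheta(j,k)=0$; each $\Omega_{n_k}(j)$ is measurable with respect to $\mathbb X_{n_k,\mathrm{out}}$; $\Omega_{n_k}(j)\subset\Omega^m_{n_k}$ for all $k$; $\Omega(j)\subset\liminf_{k\to\infty}\Omega_{n_k}(j)$; and there are constants $0<c_j\le C_j<\infty$ depending only on $j$ (not on $A,B,k$) such that for all $A\in\widehat{\mathfrak A}^m_{\mathrm{in}}$, $B\in\widehat{\mathfrak B}_{\mathrm{out}}$, $k\ge1$, the probability $\mathbb P(\{\mathbb X_{n_k,\mathrm{in}}\in A\}\cap\{\mathbb X_{n_k,\mathrm{out}}\in B\}\cap\Omega_{n_k}(j))$ lies between $c_jG$ and $C_jG$, where $G=\mathbb E[\nu(A;\mathbb X_{\infty,\mathrm{out}})\,\mathbf 1[\mathbb X_{n_k,\mathrm{out}}\in B]\,\mathbf 1[\Omega_{n_k}(j)]]+\vartheta(j,k)$.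
   Formalization: Two corrections: in the outer test sets B is (closed annulus centered at the origin) ∩ D^c, rather than an annulus contained in D^c; and it is assumed that a.s., if X_∞ has a point in D, it also has a point in D^c. The literal claim fails without either. *)

(* Defs.v *)
From HB Require Import structures.
From mathcomp Require Import all_boot all_order all_algebra perm.
From mathcomp Require Import all_classical all_reals all_analysis.
From mathcomp Require Import measurable_realfun.
Export numFieldNormedType.Exports.

Set Implicit Arguments.
Unset Strict Implicit.
Unset Printing Implicit Defensive.

Import Order.TTheory GRing.Theory Num.Theory.

Local Open Scope classical_set_scope.
Local Open Scope card_scope.
Local Open Scope ring_scope.

(******************************************************************************)
(* R^d is 'rV[R]_d and (R^d)^n is 'M[R]_(n, d), the i-th point being the i-th *)
(* row. The library norm on matrices is the sup norm: it induces the right    *)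
(* topology and derivatives, but balls, annuli and diameters below have to be *)
(* taken for the Euclidean norm.                                              *)
(******************************************************************************)

Section Euclidean.
Context {R : realType}.

Definition enorm n d (x : 'M[R]_(n, d)) : R :=
  Num.sqrt (\sum_(i < n) \sum_(j < d) x i j ^+ 2).

Definition eball d (c : 'rV[R]_d) (r : R) : set 'rV[R]_d :=
  [set x | enorm (x - c) < r].

Definition annulus d (r1 r2 : R) : set 'rV[R]_d :=
  [set x | r1 <= enorm x <= r2].

(* Lebesgue outer measure on R^d (countable covers by half-open boxes); it    *)
(* agrees with Lebesgue measure on measurable sets.                           *)
Definition box d (a b : 'rV[R]_d) : set 'rV[R]_d :=
  [set x | forall i, a ord0 i <= x ord0 i < b ord0 i].

Definition lebesgue_outer d (A : set 'rV[R]_d) : \bar R :=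
  ereal_inf [set (\sum_(0 <= n <oo)
                   (\prod_(i < d) ((ab n).2 ord0 i - (ab n).1 ord0 i))%:E)%E
    | ab in [set ab : nat -> 'rV[R]_d * 'rV[R]_d |
        (forall n i, (ab n).1 ord0 i <= (ab n).2 ord0 i) /\
        A `<=` \bigcup_n box (ab n).1 (ab n).2]].

(* k-dimensional Hausdorff measure (without the usual constant), which on a   *)
(* k-dimensional submanifold is a multiple of the Lebesgue surface measure;   *)
(* only ratios of it are used.                                                *)
Definition diam n d (C : set 'M[R]_(n, d)) : \bar R :=
  ereal_sup [set (enorm (x - y))%:E | x in C & y in C].

(* The empty set has to be singled out: the 0-th power of its diameter is 0.  *)
Definition diam_pow n d (k : nat) (C : set 'M[R]_(n, d)) : \bar R :=
  if `[< C = set0 >] then 0%E else (diam C ^+ k)%E.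

Definition hausdorff n d (k : nat) (A : set 'M[R]_(n, d)) : \bar R :=
  ereal_sup [set
    ereal_inf [set (\sum_(0 <= i <oo) diam_pow k (C i))%E
      | C in [set C : nat -> set 'M[R]_(n, d) |
          (forall i, (diam (C i) <= delta%:E)%E) /\ A `<=` \bigcup_i C i]]
    | delta in [set delta : R | 0 < delta]].

(* C^k functions on an open set, and smooth submanifolds as regular level     *)
(* sets of codimension n * d - k.                                             *)
Fixpoint Ck (V W : normedModType R) (U : set V) (k : nat) (f : V -> W) : Prop :=
  match k with
  | 0 => forall x, U x -> {for x, continuous f}
  | k'.+1 => (forall x, U x -> differentiable f x) /\
             (forall v, Ck U k' (fun x => 'd f x v))
  end.

Definition smooth_on (V W : normedModType R) (U : set V) (f : V -> W) :=
  forall k, Ck U k f.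

Definition smooth_submanifold n d (k : nat) (S : set 'M[R]_(n, d)) : Prop :=
  (k <= n * d)%N /\
  forall p, S p -> exists (U : set 'M[R]_(n, d))
      (F : 'M[R]_(n, d) -> 'rV[R]_(n * d - k)),
    [/\ open U, U p, smooth_on U F,
        (forall x, U x -> forall w, exists v, 'd F x v = w) &
        U `&` S = U `&` F @^-1` [set 0]].

Definition symmetric_set n d (S : set 'M[R]_(n, d)) : Prop :=
  forall (s : 'S_n) v, S v -> S (row_perm s v).

End Euclidean.

Section Configurations.
Context {R : realType} {d : nat}.
Implicit Type F : set 'rV[R]_d.

Definition locally_finite (Y : set 'rV[R]_d) : Prop :=
  forall K, compact K -> finite_set (Y `&` K).

Record config F := Config {
  points :> set 'rV[R]_d ;
  points_sub : points `<=` F ;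
  points_lf : locally_finite points }.

Lemma set0_lf : locally_finite set0.
Proof. by move=> K _; rewrite set0I; exact: finite_set0. Qed.

Definition config0 F : config F := Config (@sub0set _ F) set0_lf.

HB.instance Definition _ F := gen_eqMixin (config F).
HB.instance Definition _ F := gen_choiceMixin (config F).
HB.instance Definition _ F := isPointed.Build (config F) (config0 F).

(* Test functions: continuous on F with compact support in F (the values      *)
(* outside F are irrelevant).                                                 *)
Definition test_fun F :=
  {f : 'rV[R]_d -> R | {within F, continuous f} /\
     exists K, [/\ compact K, K `<=` F & forall x, F x -> ~ K x -> f x = 0]}.

Definition linear_statistics F (Y : config F) : prod_topology (fun=> R) :=
  fun f : test_fun F => \sum_(x \in points Y) sval f x.

(* initial_topology: this is the vague topology. *)
HB.instance Definition _ F :=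
  Topological.copy (config F) (initial_topology (@linear_statistics F)).
HB.instance Definition _ F := @isMeasurable.Build
  (sigma_display (@open (config F))) (config F) <<s @open (config F) >>
  (@sigma_algebra0 _ _ _) (@sigma_algebraC _ _) (@sigma_algebra_bigcup _ _ _).

Lemma restr_sub F (Y : config [set: 'rV[R]_d]) : Y `&` F `<=` F.
Proof. exact: subIsetr. Qed.

Lemma restr_lf F (Y : config [set: 'rV[R]_d]) : locally_finite (Y `&` F).
Proof.
move=> K cK; apply: sub_finite_set (@points_lf _ Y K cK) => x [[Yx _] Kx].
by split.
Qed.

Definition restr F (Y : config [set: 'rV[R]_d]) : config F :=
  Config (@restr_sub F Y) (@restr_lf F Y).

Definition enumerates n F (Y : config F) (v : 'M[R]_(n, d)) : Prop :=
  injective (fun i => row i v) /\ range (fun i => row i v) = Y.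

Definition vectors n F (A : set (config F)) : set 'M[R]_(n, d) :=
  [set v | exists2 Y, A Y & enumerates Y v].

Definition lies_on n F (S : set 'M[R]_(n, d)) (Y : config F) : Prop :=
  exists2 v, S v & enumerates Y v.

End Configurations.

Section PointProcesses.
Context {R : realType} {d : nat} {dO : measure_display}.
Context {Omega : measurableType dO} (P : probability Omega R).
Local Notation Rd := [set: 'rV[R]_d].
Implicit Type Xoo : Omega -> config Rd.

Definition intensity Xoo (B : set 'rV[R]_d) : \bar R :=
  (\int[P]_w counting (Xoo w `&` B))%E.

Definition intensity_ac Xoo : Prop :=
  forall B : set 'rV[R]_d, <<s @open 'rV[R]_d >> B ->
    lebesgue_outer B = 0%E -> intensity Xoo B = 0%E.

Definition null_boundary (D : set 'rV[R]_d) : Prop :=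
  lebesgue_outer (closure D `\` interior D) = 0%E.

Definition rigidity_function Xoo (D : set 'rV[R]_d)
    (N : config (~` D) -> nat) : Prop :=
  measurable_fun [set: config (~` D)] N /\
  {ae P, forall w, Xoo w `&` D #= `I_(N (restr (~` D) (Xoo w)))}.

Definition number_rigid Xoo : Prop :=
  forall D : set 'rV[R]_d, bounded_set D -> open D -> null_boundary D ->
    exists N, rigidity_function Xoo (D := D) N.

Definition cond_distribution d1 d2 (T1 : measurableType d1)
    (T2 : measurableType d2) (X : Omega -> T1) (Y : Omega -> T2)
    (kappa : R.-pker T2 ~> T1) : Prop :=
  forall A B, measurable A -> measurable B ->
    P (X @^-1` A `&` Y @^-1` B) = (\int[P]_(w in Y @^-1` B) kappa (Y w) A)%E.

Definition ae_law d1 (T : measurableType d1) (Y : Omega -> T)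
    (Q : T -> Prop) : Prop :=
  (pushforward P Y).-negligible (~` [set y | Q y]).

Definition event_of d1 (T : measurableType d1) (Y : Omega -> T)
    (E : set Omega) : Prop :=
  exists2 U, measurable U & E = Y @^-1` U.

Definition exhausts (E : nat -> set Omega) (F : set Omega) : Prop :=
  [/\ forall j, measurable (E j), forall j, E j `<=` E j.+1,
      forall j, E j `<=` F & P (F `\` E j) @[j --> \oo] --> 0%E].

End PointProcesses.

Section Gibbs.
Context {R : realType} {d : nat}.
Implicit Types (Phi Psi : 'rV[R]_d -> \bar R) (D : set 'rV[R]_d).

Definition potential Phi : Prop :=
  (forall x, Phi x <> -oo%E) /\
  measurable_fun [set: g_sigma_algebraType (@open 'rV[R]_d)] Phi.

(* The sum over unordered pairs is half the sum over ordered pairs.           *)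
Definition energy Phi Psi F (Y : config F) : \bar R :=
  (\sum_(x \in points Y) Phi x +
   (2^-1)%:E * \sum_(p \in [set p : 'rV[R]_d * 'rV[R]_d |
                             [/\ points Y p.1, points Y p.2 & p.1 <> p.2]])
                 Psi (p.1 - p.2)%R)%E.

(* mu is the law of the configuration formed by the coordinates of a vector   *)
(* with normalized surface measure on the vectors of S that list n (distinct) *)
(* points of D.                                                               *)
Definition conditioned_poisson D n (k : nat) (S : set 'M[R]_(n, d))
    (mu : set (config D) -> \bar R) : Prop :=
  let area (A : set (config D)) := hausdorff k (S `&` vectors A) in
  (0 < area setT < +oo)%E /\
  forall A, measurable A -> mu A = (area A / area setT)%E.

Definition gibbs_weight Phi Psi D (mu : {measure set (config D) -> \bar R})
    (A : set (config D)) : \bar R :=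
  (\int[mu]_(Y in A) expeR (- energy Phi Psi Y))%E.

Definition gibbs_kernel Phi Psi D
    (Q : R.-pker (config (~` D)) ~> (config D))
    (A : set (config D)) (Y : config (~` D)) : \bar R :=
  (gibbs_weight Phi Psi (Q Y) A / gibbs_weight Phi Psi (Q Y) setT)%E.

Definition generalized_gibbs D dO (Omega : measurableType dO)
    (P : probability Omega R) (Xout : Omega -> config (~` D)) Phi Psi
    (Q kappa : R.-pker (config (~` D)) ~> (config D)) : Prop :=
  exists m M : config (~` D) -> R,
    [/\ measurable_fun setT m, measurable_fun setT M,
        forall Y, 0 < m Y, forall Y, 0 < M Y &
        ae_law P Xout (fun Y => forall A, measurable A ->
          ((m Y)%:E * gibbs_weight Phi Psi (Q Y) A <= kappa Y A /\
           kappa Y A <= (M Y)%:E * gibbs_weight Phi Psi (Q Y) A)%E)].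

End Gibbs.

Definition finite_unions T (G : set (set T)) : set (set T) :=
  [set A | exists (n : nat) (E : 'I_n.+1 -> set T),
     (forall i, G (E i)) /\ A = \bigcup_i E i].

Section ApproximateGibbs.
Context {R : realType} {d : nat} (D : set 'rV[R]_d).

Definition rat_ball (c : 'rV[rat]_d) (r : rat) : set 'rV[R]_d :=
  eball (map_mx ratr c) (ratr r).

Definition basic_in (m : nat) : set (set (config D)) :=
  [set A | exists (c : 'I_m -> 'rV[rat]_d) (r : 'I_m -> rat),
    [/\ forall i, 0 < r i,
        trivIset setT (fun i => rat_ball (c i) (r i)),
        forall i, rat_ball (c i) (r i) `<=` D &
        A = [set Y : config D | Y #= `I_m /\
                     forall i, Y `&` rat_ball (c i) (r i) #= `I_1]]].

Definition A_in (m : nat) := finite_unions (basic_in m).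

(* The annuli are taken relative to the complement of D: for a D that is not  *)
(* a centered ball, the annuli of R^d contained in that complement would miss *)
(* the points lying at the same distance from the origin as some point of D.  *)
Definition basic_out : set (set (config (~` D))) :=
  [set A | exists (n : nat) (r1 r2 : rat)
      (c : 'I_n -> 'rV[rat]_d) (r : 'I_n -> rat),
    let B := annulus (ratr r1) (ratr r2) `&` ~` D in
    [/\ (0 < n)%N /\ 0 < r1 < r2, forall i, 0 < r i,
        trivIset setT (fun i => rat_ball (c i) (r i)),
        forall i, rat_ball (c i) (r i) `&` ~` D `<=` B &
        A = [set Y : config (~` D) | Y `&` B #= `I_n /\
                     forall i, Y `&` rat_ball (c i) (r i) #= `I_1]]].

Definition B_out := finite_unions basic_out.

Definition approximate_gibbs dO (Omega : measurableType dO)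
    (P : probability Omega R)
    (X : nat -> Omega -> config [set: 'rV[R]_d])
    (Xoo : Omega -> config [set: 'rV[R]_d])
    (nu : set (config D) -> config (~` D) -> \bar R) : Prop :=
  let inside (Y : Omega -> config _) w := restr D (Y w) in
  let outside (Y : Omega -> config _) w := restr (~` D) (Y w) in
  let count_in Y m := [set w | inside Y w #= `I_m] in
  forall m, (0 < m)%N -> (0 < P (count_in Xoo m))%E ->
  exists O : nat -> set Omega,
    (forall j, event_of (outside Xoo) (O j)) /\
    exhausts P O (count_in Xoo m) /\
    forall j, exists (n_ : nat -> nat) (On : nat -> set Omega)
        (theta : nat -> R) (c C : R),
      (forall k, (0 < n_ k)%N) /\ n_ @ \oo --> \oo /\
      theta @ \oo --> (0 : R) /\
      (forall k, event_of (outside (X (n_ k))) (On k)) /\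
      (forall k, On k `<=` count_in (X (n_ k)) m) /\
      O j `<=` \bigcup_i \bigcap_(k in [set k | (i <= k)%N]) On k /\
      0 < c <= C /\
      forall A B k, A_in m A -> B_out B ->
        let G := (\int[P]_(w in outside (X (n_ k)) @^-1` B `&` On k)
                     nu A (outside Xoo w) + (theta k)%:E)%E in
        let p := P (inside (X (n_ k)) @^-1` A `&`
                    outside (X (n_ k)) @^-1` B `&` On k) in
        (c%:E * G <= p /\ p <= C%:E * G)%E.

End ApproximateGibbs.

(* Main.v *)
From HB Require Import structures.
Require Import Defs.
From mathcomp Require Import all_boot all_order all_algebra.
From mathcomp Require Import finmap.
From mathcomp Require Import all_classical all_reals all_analysis.
From mathcomp Require Import measurable_realfun.
From mathcomp Require Import lra ring zify.

Set Implicit Arguments.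
Unset Strict Implicit.
Unset Printing Implicit Defensive.

Import Order.TTheory GRing.Theory Num.Theory.

Local Open Scope classical_set_scope.
Local Open Scope card_scope.
Local Open Scope ring_scope.

(** The approximate Gibbs property bounds the probability that [X (n_ k)] lies
    in a test set [A] inside the domain and in a test set [B] outside it; the
    generalized Gibbs property bounds the conditional law [kappa] on all Borel
    sets, for almost every outer configuration. Three steps lead from the one to
    the other.

    Limit in [k]. Test sets count points in balls, in annuli and in [D]. As the
    limit process has an absolutely continuous intensity, almost surely it has no
    point on the boundary of [D] and none on a sphere with rational centre and
    radius, such spheres being Lebesgue null ([sphere_null], [ae_typical]). At
    such a configuration the counts are vaguely continuous ([cnt_cvg]), so
    membership of [X n] in a test set is eventually that of the limit ([near_in],
    [near_out]). Every outcome in [O j] eventually belongs to [On k], but [On k]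
    may be much larger. This is why the test sets outside have to be rich: in
    measure they approximate every Borel set [U] of outer configurations
    ([out_approx]). If the outer configurations in [U] belong to [O j], a test
    set close to [U] cuts down [On k] to the event that the outer configuration
    lies in [U], up to small probability, and the bounds pass to the limit in the
    form
      c E[nu(A); U] <= P(inside in A, outside in U) <= C E[nu(A); U]
    for the Gibbs kernel [nu] ([event_bounds]).

    Disintegration. The probability in the middle is the integral of [kappa] over
    [U]. As [U] is arbitrary, the bounds hold pointwise, outside one null set
    for the countably many test sets [A] ([ae_kernel_bounds]).

    All Borel sets inside. Fix an outer configuration with [m] points inside. The
    conditional law only charges configurations with [m] points by rigidity
    ([kappa_card]), and so does the Gibbs weight by the definition of the
    conditioned Poisson law ([conditioned_poisson_card]). On these, the test sets
    are stable under finite unions and contain a base of the topology. A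
    comparison of two measures on test sets therefore extends to open sets by
    continuity from below and to Borel sets by outer regularity
    ([le_measure_A_in]).

    The exhausting events, for all [m] and [j], form a countable cover of almost
    all outer configurations; the bounding functions take the constants of the
    first event that contains the configuration, divided by the normalization of
    the Gibbs kernel ([gibbs_of_approximate]). No point inside is a separate case,
    in which both laws are the point mass at the empty configuration.

    The Borel sets of configurations are accessible through numbers of points: a
    vaguely open set is a countable union of sets that prescribe finitely many
    such numbers ([config_countable_base]). This makes the restrictions to [D] and
    to its complement measurable, and through the counting measure of a
    configuration also the energy ([measurable_energy]). *)

(** * Euclidean geometry *)

Section Space.
Context {R : realType} {d : nat}.
Implicit Types (x y c : 'rV[R]_d) (S : set 'rV[R]_d).

Lemma coord_le_norm x i : `|x ord0 i| <= `|x|.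
Proof.
rewrite [leRHS]/Num.norm /= mx_normrE; apply/bigmax_geP; right => /=.
by exists (ord0, i).
Qed.

Lemma enormE x : enorm x = Num.sqrt (\sum_(j < d) x ord0 j ^+ 2).
Proof. by rewrite /enorm big_ord1. Qed.

Lemma enorm_le_norm x : enorm x <= (d.+1)%:R * `|x|.
Proof.
rewrite enormE -[leRHS]ger0_norm; last by rewrite mulr_ge0.
rewrite -sqrtr_sqr ler_sqrt ?sqr_ge0// exprMn.
apply: (@le_trans _ _ (\sum_(j < d) `|x| ^+ 2)).
  by apply: ler_sum => j _; rewrite -[leLHS]real_normK ?num_real// lerXn2r ?nnegrE ?coord_le_norm.
rewrite sumr_const card_ord -[leLHS]mulr_natl ler_wpM2r ?exprn_ge0//.
rewrite -natrX ler_nat; nia.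
Qed.

Lemma norm_le_enorm x : `|x| <= enorm x.
Proof.
rewrite enormE [leLHS]/Num.norm /= mx_normrE; apply/bigmax_leP; split.
  by rewrite sqrtr_ge0.
move=> [i j] _ /=; rewrite (ord1 i) -sqrtr_sqr ler_sqrt ?sumr_ge0// => [|k _]; last first.
  exact: sqr_ge0.
rewrite (bigD1 j)//= lerDl sumr_ge0// => k _; exact: sqr_ge0.
Qed.

Lemma continuous_enorm c : continuous (fun x => enorm (x - c)).
Proof.
move=> x.
rewrite (_ : (fun x => _) = fun x => Num.sqrt (\sum_(j < d) (x - c) ord0 j ^+ 2)); last first.
  by apply/funext => y; exact: enormE.
apply: (@continuous_comp _ _ _ (fun x : 'rV[R]_d => \sum_(j < d) (x - c) ord0 j ^+ 2) Num.sqrt);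
  last exact: sqrt_continuous.
apply: cvg_big; [exact: add_continuous|exact: (nbhs_filter x)|move=> j _].
rewrite /=; apply: (@continuous_comp _ _ _ (fun x : 'rV[R]_d => (x - c) ord0 j) (fun r => r ^+ 2));
  last exact: exprn_continuous.
rewrite (_ : (fun x => _) = fun x : 'rV[R]_d => x ord0 j - c ord0 j); last first.
  by apply/funext => y; rewrite !mxE.
have cj : continuous (fun y : 'rV[R]_d => y ord0 j) by exact: coord_continuous.
exact: (cvgB (cj x) (cvg_cst _)).
Qed.

Lemma enorm_continuous : continuous (fun x : 'rV[R]_d => enorm x).
Proof.
rewrite (_ : (fun x => _) = (fun x => enorm (x - 0))); first exact: continuous_enorm.
by apply/funext => y; rewrite subr0.
Qed.

Lemma open_eball c r : open (eball c r).
Proof.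
by apply: (@open_comp _ _ (fun x => enorm (x - c)) [set r' | r' < r]);
  [move=> x _; exact: continuous_enorm|exact: open_lt].
Qed.

(** A point off the topological boundary of [S]. *)
Definition decided S x := interior S x \/ interior (~` S) x.

Lemma decidedC S x : decided S x -> decided (~` S) x.
Proof. by case=> h; [right; rewrite setCK|left]. Qed.

Lemma decidedI S T x : decided S x -> decided T x -> decided (S `&` T) x.
Proof.
move=> [hS|hS] [hT|hT]; first by left; rewrite interiorI.
- by right; rewrite setCI; apply: filterS hT => y; right.
- by right; rewrite setCI; apply: filterS hS => y; left.
- by right; rewrite setCI; apply: filterS hS => y; left.
Qed.

Lemma decided_near S x : decided S x -> \forall y \near x, S y <-> S x.
Proof.
move=> [|] h; have hx := interior_subset h; apply: filterS h => y h; split=> //.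
Qed.

Lemma decided_lt (f : 'rV[R]_d -> R) r x : continuous f -> f x != r ->
  decided [set y | f y < r] x.
Proof.
move=> cf xr; have [lt|gt|eq] := ltgtP (f x) r; last by rewrite eq eqxx in xr.
- left; apply: open_nbhs_nbhs; split => //.
  by apply: (@open_comp _ _ f [set r' | r' < r]); [move=> y _; exact: cf|exact: open_lt].
- right; rewrite /interior /=.
  have : nbhs x [set y | r < f y].
    apply: open_nbhs_nbhs; split=> //.
    by apply: (@open_comp _ _ f [set r' | r < r']); [move=> y _; exact: cf|exact: open_gt].
  by apply: filterS => y /= /ltW; rewrite leNgt => /negP.
Qed.

Lemma decided_eball c r x : enorm (x - c) != r -> decided (eball c r) x.
Proof. by apply: (decided_lt (f := fun x => _)); exact: continuous_enorm. Qed.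

Lemma decided_annulus r1 r2 x : enorm x != r1 -> enorm x != r2 ->
  decided (annulus r1 r2) x.
Proof.
move=> x1 x2; have d1 := decidedC (decided_lt enorm_continuous x1).
have d2 : decided (~` [set y : 'rV[R]_d | - enorm y < - r2]) x.
  apply: decidedC; apply: (decided_lt (f := fun y => - enorm y)).
    by move=> y; exact: cvgN (enorm_continuous (x := y)).
  by rewrite eqr_opp.
have := decidedI d1 d2; congr decided; apply/seteqP; split => y /=.
  by rewrite ltrN2 => -[/negP + /negP +]; rewrite -!leNgt /annulus /= => -> ->.
by rewrite /annulus/= ltrN2 => /andP[a b]; split; apply/negP; rewrite -leNgt.
Qed.

Lemma bounded_norm_lt S : bounded_set S -> exists M, 0 < M /\ forall x, S x -> `|x| < M.
Proof.
move=> [M [_ h]]; exists (`|M| + 2); split; first by rewrite ltr_wpDl.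
move=> x Sx; apply: (@le_lt_trans _ _ (`|M| + 1)); last by rewrite ltrD2l ltr1n.
by apply: (h (`|M| + 1)) => //; rewrite (le_lt_trans (ler_norm _))// ltrDl.
Qed.

Lemma bounded_subset (A B : set 'rV[R]_d) : B `<=` A -> bounded_set A -> bounded_set B.
Proof. by move=> BA [M [Mr h]]; exists M; split => // K MK x /BA; exact: h. Qed.

Lemma compact_norm_lt (K : set 'rV[R]_d) : compact K ->
  exists M, 0 < M /\ forall x, K x -> `|x| < M.
Proof.
by move=> /compact_bounded; exact: bounded_norm_lt.
Qed.

Lemma open_norm_lt M : open [set x : 'rV[R]_d | `|x| < M].
Proof.
apply: (@open_comp _ _ (fun x : 'rV[R]_d => `|x|) [set r' | r' < M]); last exact: open_lt.
by move=> x _; exact: norm_continuous.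
Qed.

Lemma closed_norm_le M : closed [set x : 'rV[R]_d | `|x| <= M].
Proof.
apply: (@closed_comp _ _ (fun x : 'rV[R]_d => `|x|) [set r | r <= M]); last exact: closed_le.
by move=> x _; exact: norm_continuous.
Qed.

Lemma compact_closed_norm_le (C : set 'rV[R]_d) M : closed C ->
  (forall x, C x -> `|x| <= M) -> compact C.
Proof.
move=> cC h; apply: bounded_closed_compact => //.
exists M; split; first exact: num_real.
by move=> r Mr x /h /le_trans; apply; exact: ltW.
Qed.

Lemma compact_setI_closed (K C : set 'rV[R]_d) : compact K -> closed C -> compact (K `&` C).
Proof.
move=> cK cC; apply: (subclosed_compact _ cK); last exact: subIsetl.
by apply: closedI => //; apply: compact_closed cK; exact: norm_hausdorff.
Qed.

Lemma compact_closure S : bounded_set S -> compact (closure S).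
Proof.
move=> /bounded_norm_lt[M [_ SM]].
apply: (@compact_closed_norm_le _ M); first exact: closed_closure.
have /closure_id cl := @closed_norm_le M.
move=> x; rewrite -[is_true _]/([set x : 'rV[R]_d | `|x| <= M] x) cl.
by apply: closureS => z /SM /ltW.
Qed.

(** Urysohn functions with compact support, the test functions that compare the
    number of points in a set with vaguely continuous statistics. *)
Lemma bump (K U : set 'rV[R]_d) : compact K -> open U -> K `<=` U ->
  exists f : 'rV[R]_d -> R, [/\ continuous f, forall x, 0 <= f x <= 1,
    forall x, K x -> f x = 1 &
    exists L, [/\ compact L, L `<=` U & forall x, ~ L x -> f x = 0]].
Proof.
move=> cK oU KU; have [M [M0 KM]] := compact_norm_lt cK.
have clK : closed K by apply: compact_closed cK; exact: norm_hausdorff.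
pose U' := U `&` [set x | `|x| < M].
have oU' : open U' by apply: openI => //; exact: open_norm_lt.
have KU' : set_nbhs K U'.
  by move=> x Kx; apply: open_nbhs_nbhs; split=> //; split; [exact: KU|exact: KM].
have [B KB BU] := (@pseudometric_normal R 'rV[R]_d) _ clK _ KU'.
have BM x : closure B x -> `|x| <= M by move=> /BU [_ /ltW].
pose V := interior B.
have sep : uniform_separator (~` V) K.
  apply: (iffLR (@normal_separatorP R _)); first exact: (@pseudometric_normal R).
  + by apply: open_closedC; exact: open_interior.
  + exact: clK.
  + by apply/seteqP; split => x // [nV /KB].
exists (Urysohn (~` V) K); split.
- exact: Urysohn_continuous.
- move=> x; have /= := @Urysohn_range _ R (~` V) K (Urysohn (~` V) K x).
  by rewrite in_itv/=; apply; exists x.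
- by move=> x Kx; apply: (Urysohn_sub1 sep); exists x.
- exists (closure B); split.
  + by apply: (@compact_closed_norm_le _ M) => //; exact: closed_closure.
  + by move=> x /BU [].
  + move=> x nx; apply: (Urysohn_sub0 sep); exists x => // /interior_subset Bx.
    by apply: nx; exact: subset_closure.
Qed.

Lemma rat_ball_nbhs x S : nbhs x S -> exists (c : 'rV[rat]_d) (r : rat),
  [/\ 0 < r, rat_ball c r x & @rat_ball R d c r `<=` S].
Proof.
move=> /nbhs_ballP[e /= e0 eS].
have [r /andP[r0 re]] : exists r : rat, (0 < (ratr r : R) < e / 2).
  by have [r] := @rat_in_itvoo R 0 (e / 2) (divr_gt0 e0 (ltr0Sn _ _)); rewrite in_itv/= => h; exists r.
have eps0 : 0 < ratr r / (d.+1)%:R :> R by rewrite divr_gt0.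
have /choice[c0 hc] (i : 'I_d) : exists q : rat, `|x ord0 i - ratr q| < ratr r / (d.+1)%:R / 2.
  have [q] := @rat_in_itvoo R (x ord0 i) (x ord0 i + ratr r / (d.+1)%:R / 2)
    (ltr_pwDr (divr_gt0 eps0 (ltr0Sn _ _)) (lexx _)).
  rewrite in_itv/= => /andP[h1 h2]; exists q.
  rewrite distrC ger0_norm; first by rewrite ltrBlDl.
  by rewrite subr_ge0 ltW.
pose c : 'rV[rat]_d := \row_i c0 i; exists c, r; split.
- by rewrite -(ltr0q R).
- rewrite /rat_ball /eball/= (le_lt_trans (enorm_le_norm _))//.
  rewrite mulrC -ltr_pdivlMr// .
  apply: (@le_lt_trans _ _ (ratr r / (d.+1)%:R / 2)); last by rewrite ltr_pdivrMr// ltr_pMr// ltr1n.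
  rewrite [leLHS]/Num.norm /= mx_normrE; apply/bigmax_leP; split.
    by rewrite ltW// divr_gt0.
  by move=> [i j] _ /=; rewrite !mxE (ord1 i) ltW.
- move=> y yb; apply: eS; rewrite -ball_normE /=.
  have xc : `|x - map_mx ratr c| < ratr r.
    apply: (@le_lt_trans _ _ (ratr r / (d.+1)%:R / 2)).
      rewrite [leLHS]/Num.norm /= mx_normrE; apply/bigmax_leP; split.
        by rewrite ltW// divr_gt0.
      by move=> [i j] _ /=; rewrite !mxE (ord1 i) ltW.
    rewrite -mulrA -invfM ltr_pdivrMr ?mulr_gt0// ltr_pMr//.
    by rewrite -natrM ltr1n mulSn; lia.
  have yc : `|y - map_mx ratr c| < ratr r by apply: le_lt_trans yb; exact: norm_le_enorm.
  rewrite -(subrK (map_mx ratr c) x) -addrA (le_lt_trans (ler_normD _ _))//.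
  rewrite [X in _ + X]distrC; lra.
Qed.

End Space.

(** * Spheres are Lebesgue null *)

Section SphereNull.
Context {R : realType}.

Lemma lebesgue_outer_ge0 d (A : set 'rV[R]_d) : (0 <= lebesgue_outer A)%E.
Proof.
apply: le_ereal_inf_tmp => _ [ab [ab_le _] <-].
apply: nneseries_ge0 => n _ _; rewrite lee_fin prodr_ge0// => i _.
by rewrite subr_ge0.
Qed.

Lemma lebesgue_outer_finite_cover d (T : finType) (a b : T -> 'rV[R]_d)
    (A : set 'rV[R]_d) : (0 < d)%N ->
  (forall t i, a t ord0 i <= b t ord0 i) -> A `<=` \bigcup_t box (a t) (b t) ->
  (lebesgue_outer A <= (\sum_t \prod_(i < d) (b t ord0 i - a t ord0 i))%:E)%E.
Proof.
move=> d0 ab cov.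
pose s := [seq (a t, b t) | t <- enum T].
pose abn n := nth (0, 0) s n.
have abn_le n i : (abn n).1 ord0 i <= (abn n).2 ord0 i.
  rewrite /abn; have [ns|ns] := ltnP n (size s); last by rewrite nth_default.
  by have /mapP[t _ ->] := mem_nth (0, 0) ns; exact: ab.
pose f n := ((\prod_(i < d) ((abn n).2 ord0 i - (abn n).1 ord0 i))%:E : \bar R).
have f0 n : (0 <= f n)%E by rewrite lee_fin prodr_ge0// => i _; rewrite subr_ge0.
apply: (@le_trans _ _ (\sum_(0 <= n <oo) f n)%E).
  apply: ereal_inf_lbound; exists abn => //; split => // x /cov[t _ xt].
  exists (index t (enum T)) => //.
  by rewrite /abn (nth_map t) ?index_mem ?mem_enum// nth_index ?mem_enum.
rewrite (nneseries_split 0 (size s)); last by move=> *; exact: f0.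
rewrite [X in (_ + X)%E]eseries0 ?adde0 => [|k]; last first.
  rewrite add0n => ks _; rewrite /f /abn nth_default//=.
  by congr (_%:E); rewrite (bigD1 (Ordinal d0))//= !mxE subrr mul0r.
rewrite add0n sumEFin lee_fin le_eqVlt; apply/orP; left; apply/eqP.
rewrite -[RHS]big_enum -(big_map (fun t => (a t, b t)) xpredT
  (fun p : 'rV[R]_d * 'rV[R]_d => \prod_(i < d) (p.2 ord0 i - p.1 ord0 i))) /= -/s.
by rewrite (big_nth (0, 0)).
Qed.

(** A sphere is, up to a sign, the graph of a uniformly continuous function:
    over each cell of a fine grid in the directions other than the first one,
    two thin boxes cover it. *)
Lemma sphere_null d (c : 'rV[R]_d) (r : R) : (0 < d)%N ->
  lebesgue_outer [set x | enorm (x - c) = r] = 0%E.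
Proof.
case: d c => // d c _; apply/eqP; rewrite eq_le lebesgue_outer_ge0 andbT.
apply/lee_addgt0Pr => e e0; rewrite add0e.
(* All coordinates relative to the centre lie in [-K, K]; the grid has [M ^ d]
   cells of side [h], and the boxes have thickness [2 * w], so that their total
   volume is [2 * 2 * w * (2 * K) ^+ d = e]. *)
pose K : R := `|r| + 1; have K0 : 0 < K by rewrite ltr_wpDl.
have K20 : 0 < (2 * K) ^+ d by rewrite exprn_gt0// mulr_gt0.
pose w : R := e / (4 * (2 * K) ^+ d).
have w0 : 0 < w by rewrite divr_gt0// mulr_gt0.
pose M := (Num.truncn (d%:R * (2 * K) * (2 * K) / w ^+ 2)).+1.
pose h : R := 2 * K / M%:R.
have h0 : 0 < h by rewrite divr_gt0// mulr_gt0.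
have Mh : M%:R * h = 2 * K by rewrite mulrC divfK// pnatr_eq0.
(* The mesh is so fine that the square of the graph function varies by less than
   [w ^+ 2] over a cell, hence the function itself by less than [w]. *)
have hw : d%:R * (2 * K * h) < w ^+ 2.
  have t0 : 0 <= d%:R * (2 * K) * (2 * K) / w ^+ 2.
    by rewrite divr_ge0 ?sqr_ge0// !mulr_ge0// ltW.
  have /andP[_ tM] := truncn_itv t0; rewrite -/M in tM.
  have M0 : 0 < M%:R :> R by rewrite ltr0n.
  have -> : d%:R * (2 * K * h) = d%:R * (2 * K) * (2 * K) / M%:R.
    by rewrite /h !mulrA.
  by move: tM; rewrite ltr_pdivrMr ?exprn_gt0// ltr_pdivrMr// [M%:R * _]mulrC.
pose v (k : {ffun 'I_d -> 'I_M}) j : R := - K + (k j)%:R * h.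
pose g k := Num.sqrt (r ^+ 2 - \sum_j v k j ^+ 2).
pose sg (s : bool) : R := (-1) ^+ s.
pose a (t : {ffun 'I_d -> 'I_M} * bool) : 'rV[R]_d.+1 := \row_i
  (c ord0 i + if unlift ord0 i is Some j then v t.1 j else sg t.2 * g t.1 - w).
pose b (t : {ffun 'I_d -> 'I_M} * bool) : 'rV[R]_d.+1 := \row_i
  (c ord0 i + if unlift ord0 i is Some j then v t.1 j + h else sg t.2 * g t.1 + w).
apply: (@le_trans _ _ (\sum_t \prod_(i < d.+1) (b t ord0 i - a t ord0 i))%:E).
  apply: lebesgue_outer_finite_cover => //.
    move=> t i; rewrite !mxE lerD2l; case: unliftP => [j _|_]; first by rewrite lerDl ltW.
    by rewrite lerD2l; lra.
  move=> x /= xr; pose u i := x ord0 i - c ord0 i.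
  have ur : u ord0 ^+ 2 = r ^+ 2 - \sum_(j < d) u (lift ord0 j) ^+ 2.
    rewrite -xr enormE sqr_sqrtr ?sumr_ge0// => [|j _]; last exact: sqr_ge0.
    rewrite big_ord_recl (eq_bigr (fun j => u (lift ord0 j) ^+ 2)) => [|j _]; last by rewrite !mxE.
    by rewrite addrK !mxE.
  have uK i : `|u i| < K.
    have := coord_le_norm (x - c) i; rewrite !mxE => /le_lt_trans; apply.
    rewrite (le_lt_trans (norm_le_enorm _))// xr; by rewrite (le_lt_trans (ler_norm _))// ltrDl.
  have uKh j : 0 <= (u (lift ord0 j) + K) / h.
    rewrite divr_ge0 ?(ltW h0)//; have := uK (lift ord0 j); rewrite ltr_norml => /andP[]; lra.
  have kM j : (Num.truncn ((u (lift ord0 j) + K) / h) < M)%N.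
    have /andP[t1 _] := truncn_itv (uKh j).
    rewrite -(ltr_nat R) (le_lt_trans t1)// ltr_pdivrMr// Mh.
    have := uK (lift ord0 j); rewrite ltr_norml => /andP[]; lra.
  pose k : {ffun 'I_d -> 'I_M} := [ffun j => Ordinal (kM j)].
  have vu j : v k j <= u (lift ord0 j) < v k j + h.
    have := truncn_itv (uKh j); rewrite ler_pdivlMr// ltr_pdivrMr//.
    rewrite /v ffunE /=; set n := Num.truncn _; rewrite -[n.+1%:R]natr1 mulrDl => /andP[n1 n2].
    apply/andP; split; lra.
  have vk j : `|u (lift ord0 j) ^+ 2 - v k j ^+ 2| <= 2 * K * h.
    have /andP[v1 v2] := vu j; have := uK (lift ord0 j); rewrite ltr_norml => /andP[u1 u2].
    have v3 : - K <= v k j by rewrite lerDl mulr_ge0// ltW.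
    rewrite subr_sqr normrM mulrC ler_pM// ler_norml; apply/andP; split; lra.
  have pq : `|u ord0 ^+ 2 - (r ^+ 2 - \sum_j v k j ^+ 2)| < w ^+ 2.
    apply: le_lt_trans hw.
    have -> : u ord0 ^+ 2 - (r ^+ 2 - \sum_j v k j ^+ 2) =
        \sum_(j < d) (v k j ^+ 2 - u (lift ord0 j) ^+ 2) by rewrite ur sumrB; ring.
    apply: (le_trans (ler_norm_sum _ _ _)).
    rewrite mulr_natl -[d in leRHS]card_ord -sumr_const; apply: ler_sum => j _.
    by rewrite distrC.
  have ug : `| `|u ord0| - g k| < w.
    pose q := r ^+ 2 - \sum_j v k j ^+ 2.
    have gq : q <= g k ^+ 2.
      have [q0|q0] := leP 0 q; first by rewrite /g sqr_sqrtr.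
      by rewrite (le_trans (ltW q0))// sqr_ge0.
    have g0 : 0 <= g k by exact: sqrtr_ge0.
    have gq' : 0 < g k -> g k ^+ 2 = q by rewrite /g sqrtr_gt0 => /ltW; exact: sqr_sqrtr.
    move: pq; rewrite -/q -[u ord0 ^+ 2]real_normK ?num_real// ltr_norml => /andP[p1 p2].
    have n0 := normr_ge0 (u ord0).
    rewrite ltr_norml; apply/andP; split; rewrite ltNge; apply/negP => le.
      have := gq' ltac:(lra); nra.
    nra.
  exists (k, u ord0 < 0) => // i.
  have -> : x ord0 i = c ord0 i + u i by rewrite /u; ring.
  rewrite !mxE lerD2l ltrD2l.
  case: unliftP => [j ->|->] /=; first exact: vu.
  rewrite /sg; move: ug; have [u0|u0] := ltrP (u ord0) 0; rewrite ltr_norml => /andP[g1 g2].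
    by rewrite expr1; rewrite ltr0_norm// in g1 g2; apply/andP; split; lra.
  by rewrite expr0; rewrite ger0_norm// in g1 g2; apply/andP; split; lra.
rewrite lee_fin.
have -> : \sum_t \prod_(i < d.+1) (b t ord0 i - a t ord0 i) =
    \sum_(t : {ffun 'I_d -> 'I_M} * bool) (2 * w * h ^+ d).
  apply: eq_bigr => t _; rewrite big_ord_recl !mxE unlift_none; congr (_ * _); first lra.
  rewrite -[d in RHS]card_ord -prodr_const; apply: eq_bigr => j _.
  rewrite !mxE liftK; lra.
rewrite sumr_const card_prod card_ffun card_bool !card_ord.
rewrite -[leLHS]mulr_natl natrM natrX.
have aux (A B W : R) : A * 2%:R * (2 * W * B) = 4 * W * (A * B) by ring.
rewrite aux -exprMn.
rewrite Mh /w; move: ((2 * K) ^+ d) K20 => B B0.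
by have -> : 4 * (e / (4 * B)) * B = e by field; rewrite gt_eqF.
Qed.
End SphereNull.

(** * Numbers of points *)

Section Counting.
Context {T : choiceType}.
Implicit Types A B : set T.

(** The number of points as a natural number; it is [0] on infinite sets. *)
Definition cnt A : nat := #|` fset_set A|%fset.

Lemma cnt_eqP A n : finite_set A -> (A #= `I_n) <-> cnt A = n.
Proof.
move=> fA; split; first exact: card_fset_set.
by move=> <-; rewrite -[X in X #= _](fset_setK fA); apply/card_eq_fsetP.
Qed.

Lemma card_II_cnt A n : A #= `I_n -> finite_set A /\ cnt A = n.
Proof. by move=> An; split; [apply/finite_setP; exists n|exact: card_fset_set]. Qed.

Lemma cnt_le A B : finite_set B -> A `<=` B -> (cnt A <= cnt B)%N.
Proof.
move=> fB AB; apply: fsubset_leq_card; apply/fsubsetP => x.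
have fA := sub_finite_set AB fB.
by rewrite !in_fset_set// !inE; exact: AB.
Qed.

Lemma cnt1 (x : T) : cnt [set x] = 1%N.
Proof. by rewrite /cnt fset_set1 cardfs1. Qed.

Lemma cnt_gt0 A : finite_set A -> (0 < cnt A)%N <-> A !=set0.
Proof.
move=> fA; rewrite cardfs_gt0; split=> [/fset0Pn[x]|[x Ax]].
  by rewrite in_fset_set// inE => Ax; exists x.
by apply/fset0Pn; exists x; rewrite in_fset_set// inE.
Qed.

Lemma cnt_eq_sub A B : finite_set B -> A `<=` B -> cnt A = cnt B -> A = B.
Proof.
move=> fB AB cAB; have fA := sub_finite_set AB fB.
rewrite -(fset_setK fA) -(fset_setK fB); suff -> : fset_set A = fset_set B by [].
apply/eqP; rewrite eqEfcard -/(cnt B) -cAB leqnn andbT; apply/fsubsetP => x.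
by rewrite !in_fset_set// !inE; exact: AB.
Qed.

Lemma cntU A B : finite_set A -> finite_set B -> A `&` B = set0 ->
  cnt (A `|` B) = (cnt A + cnt B)%N.
Proof.
move=> fA fB AB0; rewrite /cnt fset_setU// -[RHS]subn0 -(cardfs0 T) -cardfsUI.
by rewrite -fset_setI// AB0 fset_set0 cardfs0 addn0 subn0.
Qed.

Lemma cntD A B : finite_set B -> A `<=` B -> cnt (B `\` A) = (cnt B - cnt A)%N.
Proof.
move=> fB AB; have fA := sub_finite_set AB fB.
rewrite -{2}(setDUK AB) cntU//; first by rewrite addKn.
  exact: finite_setD.
by rewrite setDIK.
Qed.

Lemma cnt_range n (v : 'I_n -> T) : injective v -> cnt (range v) = n.
Proof.
move=> vi; apply: card_fset_set.
rewrite (card_eqr card_II); apply: inj_card_eq => i j _ _; exact: vi.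
Qed.

Lemma finite_range n (v : 'I_n -> T) : finite_set (range v).
Proof. by apply: finite_image; exact: finite_finset. Qed.

Lemma cnt_enum A : finite_set A ->
  exists v : 'I_(cnt A) -> T, injective v /\ range v = A.
Proof.
move=> fA.
exists (tnth (in_tuple (fset_set A))); split.
  by apply/tuple_uniqP => /=; exact: fset_uniq.
apply/seteqP; split => x /=.
  move=> [i _ <-]; have := mem_tnth i (in_tuple (fset_set A)).
  by rewrite in_fset_set// inE.
rewrite -[A x]/([set x | A x] x) -{1}(fset_setK fA) => /(tnthP (in_tuple (fset_set A)))[i ->].
by exists i.
Qed.

(** A finite union is exhausted at a finite stage. *)
Lemma cnt_bigcup_le (A : nat -> set T) n : (forall i j, (i <= j)%N -> A i `<=` A j) ->
  finite_set (\bigcup_i A i) -> (forall i, cnt (A i) <= n)%N ->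
  (cnt (\bigcup_i A i) <= n)%N.
Proof.
move=> ndA fA le; have [v [vi vE]] := cnt_enum fA.
have /choice[u hu] i : exists k, A k (v i).
  have [k _ Ak] : (\bigcup_i A i) (v i) by rewrite -vE; exists i.
  by exists k.
apply: leq_trans (le (\max_i u i)); apply: cnt_le.
  by apply: sub_finite_set fA; exact: bigcup_sup.
apply: (@subset_trans _ (range v)); first by rewrite vE.
move=> _ [i _ <-]; apply: (ndA (u i)) => //.
exact: leq_bigmax.
Qed.

End Counting.

Section MeasurableCounts.
Context {dX : measure_display} {X : measurableType dX}.

Lemma measurable_fun_nat_le (f : X -> nat) :
  (forall n, measurable [set x | (f x <= n)%N]) -> measurable_fun setT f.
Proof.
move=> h _ B _; rewrite setTI.
have -> : f @^-1` B = \bigcup_(n in B) ([set x | (f x <= n)%N] `\` [set x | (f x < n)%N]).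
  apply/seteqP; split => x /=.
    by move=> Bfx; exists (f x) => //; split => /=; rewrite ?leqnn ?ltnn.
  move=> [n Bn [/= le /negP lt]]; suff -> : f x = n by [].
  by apply/eqP; rewrite eqn_leq le leqNgt.
apply: bigcup_measurable => n _; apply: measurableD; first exact: h.
case: n => [|n]; last exact: h.
by rewrite (_ : [set _ | _] = set0)//; apply/seteqP; split.
Qed.

(** Differences and increasing unions of sets give differences and limits of
    counts, so measurability spreads from a pi-system to the sigma-algebra. *)
Lemma measurable_cnt_sigma (T : choiceType) (l : X -> set T) (G : set (set T)) :
  setI_closed G -> (forall x, finite_set (l x)) ->
  measurable_fun setT (fun x => cnt (l x)) ->
  (forall C, G C -> measurable_fun setT (fun x => cnt (l x `&` C))) ->
  forall C, <<s G >> C -> measurable_fun setT (fun x => cnt (l x `&` C)).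
Proof.
move=> GI fin ml mG.
pose H := [set C | measurable_fun setT (fun x => cnt (l x `&` C))].
have finI x C : finite_set (l x `&` C) by apply: finite_setIl.
apply: (@lambda_system_subset _ G GI setT H) => //; split => //.
- by rewrite /H /=; under eq_fun do rewrite setIT.
- move=> A B BA HA HB; rewrite /H/=.
  rewrite (_ : (fun x => _) = fun x => (cnt (l x `&` A) - cnt (l x `&` B))%N).
    exact: measurable_fun_subn.
  apply/funext => x; rewrite -cntD//; last exact: setIS.
  congr cnt; apply/seteqP; split => y /=.
    by move=> [ly [Ay nB]]; split => // -[].
  by move=> [[ly Ay] nB]; split=> //; split=> // By; apply: nB.
- move=> A ndA HA; apply: measurable_fun_nat_le => n.
  have -> : [set x | (cnt (l x `&` \bigcup_i A i) <= n)%N] =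
      \bigcap_i [set x | (cnt (l x `&` A i) <= n)%N].
    apply/seteqP; split => x /=.
      move=> le i _ /=; apply: leq_trans le; apply: cnt_le => //.
      by apply: setIS; exact: bigcup_sup.
    move=> le; rewrite setI_bigcupr; apply: cnt_bigcup_le.
    - by move=> i j ij; apply: setIS; exact/subsetPset/ndA.
    - by rewrite -setI_bigcupr; exact: finI.
    - by move=> i; exact: le.
  apply: bigcapT_measurable => i.
  by have := HA i measurableT [set m | (m <= n)%N] I; rewrite setTI.
Qed.

Lemma measurable_fun_nat2 (h : nat -> nat -> nat) (f g : X -> nat) :
  measurable_fun setT f -> measurable_fun setT g ->
  measurable_fun setT (fun x => h (f x) (g x)).
Proof.
move=> mf mg _ B _; rewrite setTI.
have -> : (fun x => h (f x) (g x)) @^-1` B = \bigcup_n \bigcup_m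
    (if `[< B (h n m) >] then f @^-1` [set n] `&` g @^-1` [set m] else set0).
  apply/seteqP; split => x /=.
    by move=> Bx; exists (f x) => //; exists (g x) => //; case: asboolP.
  by move=> [n _ [m _]]; case: asboolP => // Bnm [/= -> ->].
apply: bigcupT_measurable => n; apply: bigcupT_measurable => m; case: ifP => // _.
apply: measurableI.
  by have := mf measurableT [set n] I; rewrite setTI.
by have := mg measurableT [set m] I; rewrite setTI.
Qed.

End MeasurableCounts.

Section Sums.
Context {T : choiceType} {R : realType}.
Implicit Types (A Y : set T) (f : T -> R).

Lemma sum_range n (v : 'I_n -> T) f : injective v ->
  \sum_(x \in range v) f x = \sum_i f (v i).
Proof.
move=> vi; rewrite fsbig_image; last by move=> i j _ _; exact: vi.
rewrite -[RHS]big_enum/= [RHS]fsbig_seq ?enum_uniq//.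
by apply: eq_fsbigl; apply/seteqP; split=> i //= _; rewrite mem_enum.
Qed.

Lemma sum_cnt A : finite_set A -> \sum_(x \in A) (1 : R) = (cnt A)%:R.
Proof. by move=> fA; have [v [vi <-]] := cnt_enum fA; rewrite sum_range// sumr_const card_ord cnt_range. Qed.

Lemma sum_ge_cnt Y A f : finite_set (Y `&` [set x | f x != 0]) -> finite_set A ->
  A `<=` Y -> (forall x, Y x -> 0 <= f x) -> (forall x, A x -> 1 <= f x) ->
  (cnt A)%:R <= \sum_(x \in Y) f x.
Proof.
move=> fY fA AY f0 f1.
pose B := Y `&` [set x | f x != 0].
have AB : A `<=` B.
  by move=> x Ax; split; [exact: AY|rewrite /= gt_eqF// (lt_le_trans ltr01)// f1].
rewrite -(@fsbig_widen _ _ _ _ B Y); last 2 first.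
- by move=> x [].
- by move=> x [Yx] /not_andP[//|/negP]; rewrite negbK => /eqP.
rewrite -(sum_cnt fA) (fsbigID A)//=.
rewrite (_ : B `&` A = A); last by apply/seteqP; split => x; [case|move=> Ax; split=> //; exact: AB].
rewrite -[leLHS]addr0 lerD//; last by apply: fsumr_ge0 => x [[/f0]].
by rewrite !fsbig_finite//= big_seq [leRHS]big_seq; apply: ler_sum => x; rewrite in_fset_set// inE => /f1.
Qed.

Lemma sum_le_cnt Y A f : finite_set A -> A `<=` Y ->
  (forall x, Y x -> ~ A x -> f x = 0) -> (forall x, A x -> f x <= 1) ->
  \sum_(x \in Y) f x <= (cnt A)%:R.
Proof.
move=> fA AY f0 f1; rewrite -(@fsbig_widen _ _ _ _ A Y)//; last first.
  by move=> x [Yx nA]; exact: f0.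
rewrite -(sum_cnt fA) !fsbig_finite//= big_seq [leRHS]big_seq.
by apply: ler_sum => x; rewrite in_fset_set// inE => /f1.
Qed.

End Sums.

(** * The vague topology *)

Section Vague.
Context {R : realType} {d : nat}.
Implicit Types (F K V : set 'rV[R]_d).

Definition locally_closed F := exists C U, [/\ closed C, open U & F = C `&` U].

Lemma open_locally_closed F : open F -> locally_closed F.
Proof. by move=> oF; exists setT, F; split=> //; rewrite setTI. Qed.

Lemma closed_locally_closed F : closed F -> locally_closed F.
Proof. by move=> cF; exists F, setT; split=> //; [exact: openT|rewrite setIT]. Qed.

Definition stat F (Y : config F) (f : test_fun F) : R :=
  \sum_(x \in points Y) sval f x.

Lemma stat_continuous F (f : test_fun F) : continuous (fun Y : config F => stat Y f).
Proof.
move=> Y; have h1 := @initial_continuous _ _ (@linear_statistics R d F) Y.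
suff h2 : {for linear_statistics Y, continuous (fun g : prod_topology (fun=> R) => g f)}.
  exact: (continuous_comp h1 h2).
have /cvg_sup h : nbhs (linear_statistics Y) --> linear_statistics Y by exact: cvg_id.
move=> U /= /(@initial_continuous _ _ (fun g : prod_topology (fun=> R) => g f)) hU.
exact: (h f).
Qed.

(** The vague topology is the coarsest one that makes all statistics
    continuous, so a filter converges as soon as all statistics do. *)
Lemma cvg_config F (Y : config F) (G : set_system (config F)) : Filter G ->
  (forall f e, 0 < e -> G [set Z | `|stat Z f - stat Y f| < e]) -> G --> Y.
Proof.
move=> FG h A /=; rewrite nbhsE => -[_ [[B oB <-] BY] sub].
apply: filterS sub _.
suff : (@linear_statistics R d F @ G) --> (linear_statistics Y).
  by apply; apply: open_nbhs_nbhs.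
apply/cvg_sup => f U; rewrite nbhsE => -[_ [[C oC <-] CY] subC].
apply: filterS subC _.
have /nbhs_ballP[e /= e0 eC] : nbhs (stat Y f) C by apply: open_nbhs_nbhs; split.
apply: (@filterS _ G _ [set Z | `|stat Z f - stat Y f| < e]); last exact: h.
move=> Z /= Ze; apply: eC; by rewrite /ball/= distrC.
Qed.

Lemma stat_fin F (Y : config F) (f : test_fun F) :
  finite_set (Y `&` [set x | sval f x != 0]).
Proof.
have [_ [K [cK KF h]]] := svalP f.
apply: (@sub_finite_set _ _ (Y `&` K)); last exact: points_lf.
move=> x [Yx /= fx]; split=> //; apply: contrapT => nK.
by rewrite h ?eqxx// in fx; exact: (points_sub Yx).
Qed.

Lemma test_bump F K V : locally_closed F -> compact K -> K `<=` F -> open V -> K `<=` V ->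
  exists f : test_fun F, [/\ forall x, 0 <= sval f x <= 1,
    forall x, K x -> sval f x = 1 & forall x, ~ V x -> sval f x = 0].
Proof.
move=> [C [U [cC oU FE]]] cK KF oO KO.
have KOU : K `<=` V `&` U.
  by move=> x Kx; split; [exact: KO|have := KF _ Kx; rewrite FE => -[]].
have [f [cf f01 f1 [L [cL LOU f0]]]] := bump cK (openI oO oU) KOU.
have tf : {within F, continuous f} /\
     exists K, [/\ compact K, K `<=` F & forall x, F x -> ~ K x -> f x = 0].
  split; first exact: continuous_subspaceT.
  exists (L `&` C); split; first exact: compact_setI_closed.
    by move=> x [/LOU[_ Ux] Cx]; rewrite FE.
  move=> x; rewrite FE => -[Cx Ux] nLC; apply: f0 => Lx; exact: nLC.
exists (exist _ f tf); split => //= x nO; apply: f0 => /LOU[Ox _]; exact: nO.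
Qed.

Lemma cnt_le_stat F (Y : config F) (f : test_fun F) K : compact K ->
  (forall x, F x -> 0 <= sval f x) -> (forall x, K x -> sval f x = 1) ->
  (cnt (Y `&` K))%:R <= stat Y f.
Proof.
move=> cK f0 f1; apply: sum_ge_cnt; first exact: stat_fin.
- exact: points_lf.
- exact: subIsetl.
- by move=> x /points_sub; exact: f0.
- by move=> x [_ /f1 ->].
Qed.

(** Only finitely many points of [Y] are near [K] without belonging to it. *)
Lemma isolating_nbhs F (Y : config F) K : compact K ->
  exists V, [/\ open V, K `<=` V & Y `&` V = Y `&` K].
Proof.
move=> cK; have [M [M0 KM]] := compact_norm_lt cK.
have cB : compact [set x : 'rV[R]_d | `|x| <= M].
  by apply: (@compact_closed_norm_le _ _ _ M) => //; exact: closed_norm_le.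
pose E := (Y `&` [set x : 'rV[R]_d | `|x| <= M]) `\` K.
have fE : finite_set E by apply: finite_setD; exact: points_lf.
have cE : closed E.
  apply: compact_closed; first exact: norm_hausdorff.
  exact: finite_compact.
exists ([set x | `|x| < M] `&` ~` E); split.
- by apply: openI; [exact: open_norm_lt|exact: closed_openC].
- by move=> x Kx; split; [exact: KM|move=> [_]].
- apply/seteqP; split => x [Yx].
    move=> [/= xM nE]; split => //; apply: contrapT => nK; apply: nE.
    by split=> //; split => //=; exact: ltW.
  by move=> Kx; split=> //; split; [exact: KM|move=> [_]].
Qed.

(** Counting in a compact set is upper semicontinuous: a bump function that
    isolates [K] from the other points of [Y] dominates the count on [K] and
    has a continuous statistic, which at [Y] equals the count. *)
Lemma open_cnt_le F K n : locally_closed F -> compact K -> K `<=` F ->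
  open [set Y : config F | (cnt (Y `&` K) <= n)%N].
Proof.
move=> lF cK KF; rewrite openE => Y /= Yn; rewrite /interior.
have [V [oO KO YO]] := isolating_nbhs Y cK.
have [f [f01 f1 f0]] := test_bump lF cK KF oO KO.
have hYf : nbhs (stat Y f) [set r | r < n.+1%:R].
  apply: open_nbhs_nbhs; split; first exact: open_lt.
  rewrite /= (@le_lt_trans _ _ (cnt (Y `&` K))%:R) ?ltr_nat//.
  apply: sum_le_cnt; [exact: points_lf|exact: subIsetl| |].
    by move=> x Yx nYK; apply: f0 => Ox; apply: nYK; rewrite -YO.
  by move=> x [_ /f1 ->].
have hZ : nbhs Y [set Z : config F | stat Z f < n.+1%:R] := @stat_continuous F f Y _ hYf.
apply: (@filterS _ (nbhs Y) (nbhs_filter Y) _ _ _ hZ) => Z /= Zf; rewrite -ltnS -(ltr_nat R).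
apply: le_lt_trans Zf; apply: cnt_le_stat => //.
by move=> x _; have /andP[] := f01 x.
Qed.

Lemma measurable_open_config F (A : set (config F)) : open A -> measurable A.
Proof. exact: sub_sigma_algebra. Qed.

Lemma measurable_cnt_compact F K : locally_closed F -> compact K -> K `<=` F ->
  measurable_fun setT (fun Y : config F => cnt (Y `&` K)).
Proof.
move=> lF cK KF; apply: measurable_fun_nat_le => n.
by apply: measurable_open_config; exact: open_cnt_le.
Qed.

(** A locally closed set is an increasing union of compact sets that absorbs all
    its compact subsets: points at distance at least [1 / i.+1] from the
    complement of the open set, in the closed set, of norm at most [i]. *)
Lemma exhaustion F : locally_closed F -> exists L : nat -> set 'rV[R]_d,
  [/\ forall i, compact (L i), forall i, L i `<=` F,
      forall i j, (i <= j)%N -> L i `<=` L j &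
      forall K, compact K -> K `<=` F -> exists i, K `<=` L i].
Proof.
move=> [C [U [cC oU ->]]].
pose B i := [set x : 'rV[R]_d | forall y, `|y - x| < i.+1%:R^-1 -> U y].
pose N (i : nat) := [set x : 'rV[R]_d | `|x| <= i%:R].
have cN i : closed (N i) by exact: closed_norm_le.
have cB i : closed (B i).
  have -> : B i = ~` \bigcup_(y in ~` U) ball y (i.+1%:R^-1).
    apply/seteqP; split => x /=.
      by move=> h [y nUy]; rewrite -ball_normE /= => /h.
    move=> h y yx; apply: contrapT => nUy; apply: h; exists y => //.
    by rewrite -ball_normE.
  by apply: open_closedC; apply: bigcup_open => y _; exact: ball_open.
exists (fun i => C `&` N i `&` B i); split.
- move=> i; apply: (@compact_closed_norm_le _ _ _ i%:R); last by move=> x [[]].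
  by apply: closedI => //; exact: closedI.
- move=> i x [[Cx _]] Bx; split => //; apply: Bx; by rewrite subrr normr0 invr_gt0.
- move=> i j ij x [[Cx Nx] Bx]; split; [split => //|].
    by rewrite /N/= (le_trans Nx)// ler_nat.
  move=> y yx; apply: Bx; apply: (lt_le_trans yx).
  by rewrite lef_pV2 ?posrE// ler_nat.
- move=> K cK KCU; have [M [M0 KM]] := compact_norm_lt cK.
  have /compact_near_coveringP/(_ nat \oo (fun i x => B i x) _) nc := cK.
  have : \forall i \near \oo, K `<=` B i.
    apply: nc => x Kx.
    have /nbhs_ballP[e /= e0 eU] : nbhs x U by apply: open_nbhs_nbhs; split=> //; exact: (KCU _ Kx).2.
    exists (ball x (e / 2), [set i | i.+1%:R^-1 < e / 2]) => /=.
      split; first by apply: nbhsx_ballx; rewrite divr_gt0.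
      exact: (near_infty_natSinv_lt (PosNum (divr_gt0 e0 (ltr0Sn _ 1)))).
    move=> [z i] [/= xz ie] y yz; apply: eU.
    move: xz; rewrite -!ball_normE /= => xz.
    rewrite -(subrK z x) -addrA (le_lt_trans (ler_normD _ _))//.
    have := lt_trans yz ie; rewrite distrC => zy; lra.
  move=> [i0 _ h]; pose i := maxn i0 (Num.truncn M).+1; exists i => x Kx.
  split; last by apply: h => //; rewrite /i /= leq_maxl.
  split; first exact: (KCU _ Kx).1.
  rewrite /N/= (le_trans (ltW (KM _ Kx)))//.
  have /andP[_ /ltW/le_trans] := truncn_itv (ltW M0); apply.
  by rewrite ler_nat /i leq_maxr.
Qed.

Local Notation borel := (<<s @open 'rV[R]_d >>).

Lemma borel_open V : open V -> borel V. Proof. exact: sub_sigma_algebra. Qed.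

Lemma borel_closed V : closed V -> borel V.
Proof.
move=> cO; rewrite -[V]setCK -setTD; apply: sigma_algebraCD.
by apply: borel_open; exact: closed_openC.
Qed.

Lemma measurable_cnt_setI_compact F K G : locally_closed F -> compact K -> K `<=` F ->
  borel G -> measurable_fun setT (fun Y : config F => cnt (Y `&` (K `&` G))).
Proof.
move=> lF cK KF bG; under eq_fun do rewrite setIA.
apply: (measurable_cnt_sigma (l := fun Y : config F => Y `&` K) (G := @open 'rV[R]_d)) => //.
- by move=> A B; exact: openI.
- by move=> Y; exact: points_lf.
- exact: measurable_cnt_compact.
- move=> A oA.
  rewrite (_ : (fun Y => _) = fun Y : config F => (cnt (Y `&` K) - cnt (Y `&` (K `&` ~` A)))%N).
    apply: measurable_fun_subn; first exact: measurable_cnt_compact.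
    apply: measurable_cnt_compact => //; last by move=> x [/KF].
    by apply: compact_setI_closed => //; exact: open_closedC.
  apply/funext => Y; rewrite -cntD.
  - congr cnt; apply/seteqP; split => x /=.
      by move=> [[Yx Kx] Ax]; split => // -[_ []].
    move=> [[Yx Kx] nA]; split=> //; apply: contrapT => nAx; exact: nA.
  - exact: points_lf.
  - by apply: setIS; exact: subIsetl.
Qed.

Lemma measurable_cnt F G : locally_closed F -> borel G ->
  (forall Y : config F, finite_set (Y `&` G)) ->
  measurable_fun setT (fun Y : config F => cnt (Y `&` G)).
Proof.
move=> lF bG fin; have [L [cL LF Lnd KL]] := exhaustion lF.
have YG (Y : config F) : Y `&` G = \bigcup_i (Y `&` (L i `&` G)).
  apply/seteqP; split=> x.
    move=> [Yx Gx]; have [| |i xL] := KL [set x]; first exact: compact_set1.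
      by move=> _ ->; exact: points_sub Yx.
    by exists i => //; split=> //; split => //; exact: xL.
  by move=> [i _ [Yx [_ Gx]]].
apply: measurable_fun_nat_le => n.
rewrite (_ : mkset _ = \bigcap_i [set Y : config F | (cnt (Y `&` (L i `&` G)) <= n)%N]).
  apply: bigcapT_measurable => i.
  have := @measurable_cnt_setI_compact F (L i) G lF (cL i) (LF i) bG.
  by move=> /(_ measurableT [set m | (m <= n)%N] I); rewrite setTI.
apply/seteqP; split => Y /=.
  move=> le i _; apply: leq_trans le; apply: cnt_le => //.
  by apply: setIS; exact: subIsetr.
move=> le; rewrite YG; apply: cnt_bigcup_le; last by move=> i; exact: le.
- by move=> i j ij; apply: setIS; apply: setSI; exact: Lnd.
- by rewrite -YG.
Qed.

Lemma measurable_card F G n : locally_closed F -> borel G ->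
  (forall Y : config F, finite_set (Y `&` G)) ->
  measurable [set Y : config F | Y `&` G #= `I_n].
Proof.
move=> lF bG fin.
have := measurable_cnt lF bG fin measurableT (Y := [set n]) I; rewrite setTI.
by congr measurable; apply/seteqP; split => Y /=; move/(cnt_eqP _ (fin Y)).
Qed.

(** Half the distance to the nearest other point keeps the balls disjoint. *)
Lemma ball_family (A : set 'rV[R]_d) (N : 'rV[R]_d -> set 'rV[R]_d) :
  finite_set A -> (forall y, A y -> nbhs y (N y)) ->
  exists (v : 'I_(cnt A) -> 'rV[R]_d) (c : 'I_(cnt A) -> 'rV[rat]_d)
     (r : 'I_(cnt A) -> rat),
    [/\ injective v, range v = A, forall i, 0 < r i,
        trivIset setT (fun i => @rat_ball R d (c i) (r i)) &
        forall i, rat_ball (c i) (r i) (v i) /\ @rat_ball R d (c i) (r i) `<=` N (v i)].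
Proof.
move=> fA hN; have [v [vi vE]] := cnt_enum fA; exists v.
pose W i := N (v i) `&` [set x | forall j, j != i -> `|v i - x| < `|v i - v j| / 2].
have hW i : nbhs (v i) (W i).
  apply: filterI; first by apply: hN; rewrite -vE; exists i.
  apply: (@filter_forall _ _ _ (nbhs (v i)) (nbhs_filter (v i))) => j.
  have [->|ji] := eqVneq j i; first exact: nearW.
  have : nbhs (v i) (ball (v i) (`|v i - v j| / 2)).
    by apply: nbhsx_ballx; rewrite divr_gt0// normr_gt0 subr_eq0 (inj_eq vi) eq_sym.
  by apply: filterS => x; rewrite -ball_normE.
have /choice[cr hcr] i : exists p : 'rV[rat]_d * rat,
    [/\ 0 < p.2, rat_ball p.1 p.2 (v i) & @rat_ball R d p.1 p.2 `<=` W i].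
  by have [c [r ?]] := rat_ball_nbhs (hW i); exists (c, r).
exists (fun i => (cr i).1), (fun i => (cr i).2); split=> //.
- by move=> i; have [] := hcr i.
- move=> i j _ _ [x [/= xi xj]]; apply: contrapT => /eqP ij.
  have [_ _ /(_ _ xi)[_ /(_ j)]] := hcr i; rewrite eq_sym => /(_ ij) h1.
  have [_ _ /(_ _ xj)[_ /(_ i ij)]] := hcr j; rewrite (distrC (v j) (v i)) => h2.
  have : `|v i - v j| <= `|v i - x| + `|v j - x|.
    rewrite (distrC (v j) x).
    have -> : v i - v j = (v i - x) + (x - v j) by rewrite addrA subrK.
    exact: ler_normD.
  lra.
- by move=> i; have [_ h1 h2] := hcr i; split => // x /h2[].
Qed.

(** A set of [n] points with one point in each of [n] disjoint sets is
    enumerated by these points: none is left over. *)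
Lemma ball_match (Z : set 'rV[R]_d) n (B : 'I_n -> set 'rV[R]_d) :
  finite_set Z -> cnt Z = n -> trivIset setT B -> (forall i, cnt (Z `&` B i) = 1%N) ->
  exists w : 'I_n -> 'rV[R]_d, [/\ injective w, range w = Z & forall i, B i (w i)].
Proof.
move=> fZ cZ tB cB.
have /choice[w hw] i : exists z, (Z `&` B i) z.
  by apply/cnt_gt0; [exact: finite_setIl|rewrite cB].
have wi : injective w.
  by move=> i j wij; apply: (tB i j) => //; exists (w i); split; [exact: (hw i).2|rewrite wij; exact: (hw j).2].
exists w; split => //; last by move=> i; exact: (hw i).2.
apply: cnt_eq_sub => //; last by rewrite cnt_range.
by move=> _ [i _ <-]; exact: (hw i).1.
Qed.

Lemma cnt_range_ball n (v : 'I_n -> 'rV[R]_d) (B : 'I_n -> set 'rV[R]_d) i :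
  trivIset setT B -> (forall i, B i (v i)) -> cnt (range v `&` B i) = 1%N.
Proof.
move=> tB Bv; rewrite (_ : _ `&` _ = [set v i]) ?cnt1//.
apply/seteqP; split => [_ [[j _ <-] Bj] | _ ->]; last by split=> //; exists i.
by rewrite (tB i j)//; exists (v j).
Qed.

End Vague.

(** * A countable base of the vague topology, and convergence of counts *)

Section ConfigBase.
Context {R : realType} {d : nat}.
Implicit Types (F S : set 'rV[R]_d).

Lemma finite_bounded F (Y : config F) A : bounded_set A -> finite_set (points Y `&` A).
Proof.
move=> /compact_closure /(@points_lf _ _ _ Y); apply: sub_finite_set.
by apply: setIS; exact: subset_closure.
Qed.

(** Moving each point of [Y] by little changes the statistic by little, provided
    that no point off the window [S] contributes. *)
Lemma stat_close F (f : test_fun F) (Y : config F) S (e : R) : finite_set (Y `&` S) ->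
  (forall x, points Y x -> ~ S x -> sval f x = 0) -> 0 < e ->
  exists N : 'rV[R]_d -> set 'rV[R]_d,
    (forall y, (Y `&` S) y -> nbhs y (N y)) /\
    forall (Z : config F) (v w : 'I_(cnt (Y `&` S)) -> 'rV[R]_d),
      injective v -> injective w -> range v = Y `&` S -> range w = Z `&` S ->
      (forall x, points Z x -> ~ S x -> sval f x = 0) -> (forall i, N (v i) (w i)) ->
      `|stat Z f - stat Y f| < e.
Proof.
move=> fin Y0 e0; set n := cnt _.
have en : 0 < e / n.+1%:R by rewrite divr_gt0.
exists (fun y => [set x | F x -> `|sval f x - sval f y| < e / n.+1%:R]); split.
  move=> y [Yy _]; have [cf _] := svalP f.
  have Fy := points_sub Yy.
  have : nbhs (y : subspace F) (sval f @^-1` ball (sval f y) (e / n.+1%:R)).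
    by apply: (cf y); exact: nbhsx_ballx.
  case: (@nbhs_subspaceP _ F y) => // _.
  by rewrite /within/=; apply: filterS => x xF /xF; rewrite /ball/= distrC.
move=> Z v w vi wi vE wE Z0 vw.
have sumS (T : config F) (u : 'I_n -> 'rV[R]_d) : injective u -> range u = T `&` S ->
    (forall x, points T x -> ~ S x -> sval f x = 0) -> stat T f = \sum_i sval f (u i).
  move=> ui uE T0; rewrite -sum_range// uE /stat; apply/esym/fsbig_widen.
    exact: subIsetl.
  by move=> x [Tx nTS]; apply: T0 => // Sx; apply: nTS.
rewrite (sumS Z w)// (sumS Y v)// -sumrB (le_lt_trans (ler_norm_sum _ _ _))//.
apply: (@le_lt_trans _ _ (\sum_(i < n) e / n.+1%:R)).
  apply: ler_sum => i _; apply: ltW; apply: vw.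
  by have [/points_sub] : (Z `&` S) (w i) by rewrite -wE; exists i.
rewrite sumr_const card_ord -[ltLHS]mulr_natl mulrCA gtr_pMr//.
by rewrite ltr_pdivrMr// mul1r ltr_nat.
Qed.

(** Prescribing the number of points in a window and in one small ball around
    each point of [Y] there pins down a statistic up to [e]. *)
Lemma local_approx F (f : test_fun F) (Y : config F) S (e : R) (N0 : 'rV[R]_d -> set 'rV[R]_d) :
  finite_set (Y `&` S) -> (forall x, points Y x -> ~ S x -> sval f x = 0) -> 0 < e ->
  (forall y, (Y `&` S) y -> nbhs y (N0 y)) ->
  let n := cnt (Y `&` S) in
  exists (c : 'I_n -> 'rV[rat]_d) (r : 'I_n -> rat),
    [/\ forall i, 0 < r i, trivIset setT (fun i => @rat_ball R d (c i) (r i)),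
      forall i, cnt (Y `&` S `&` rat_ball (c i) (r i)) = 1%N,
      forall i, exists2 y, (Y `&` S) y & @rat_ball R d (c i) (r i) `<=` N0 y &
      forall Z : config F, finite_set (Z `&` S) ->
       (forall x, points Z x -> ~ S x -> sval f x = 0) -> cnt (Z `&` S) = n ->
       (forall i, cnt (Z `&` S `&` rat_ball (c i) (r i)) = 1%N) ->
       `|stat Z f - stat Y f| < e].
Proof.
move=> fin Y0 e0 hN0 n.
have [N [hN close]] := stat_close fin Y0 e0.
have [] := @ball_family _ _ (Y `&` S) (fun y => N0 y `&` N y) fin.
  by move=> y yS; apply: filterI; [exact: hN0|exact: hN].
move=> v [c [r [vi vE r0 tB hB]]]; exists c, r; split => //.
- move=> i; rewrite -vE; apply: (cnt_range_ball (B := fun i => rat_ball (c i) (r i))) => // j; exact: (hB j).1.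
- move=> i; exists (v i); first by rewrite -vE; exists i.
  by move=> x /((hB i).2 x)[].
- move=> Z fZ Z0 cZ cB.
  have [w [wi wE wB]] := ball_match fZ cZ tB cB.
  apply: (close Z v w) => // i; exact: ((hB i).2 _ (wB i)).2.
Qed.

Let par := (nat * nat * seq ('rV[rat]_d * rat))%type.

(** The sets that prescribe finitely many numbers of points, in the windows of an
    exhaustion and in rational balls, generate a filter at [Y] along which all
    statistics converge, so they form a base. These numbers are measurable in
    the configuration on the whole space, whence the measurability of the
    restriction to [F]. *)
Lemma config_countable_base F : locally_closed F ->
  exists V : nat -> set (config F),
    (forall k, measurable (@restr R d F @^-1` V k)) /\
    forall A, open A -> forall Y, A Y -> exists k, V k Y /\ V k `<=` A.
Proof.
move=> lF; have [L [cL LF Lnd KL]] := exhaustion lF.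
have lT : locally_closed [set: 'rV[R]_d] by apply: open_locally_closed; exact: openT.
pose V1 (p : par) := [set Z : config F | cnt (Z `&` L p.1.1) = p.1.2 /\
  forall q, q \in p.2 -> cnt (Z `&` L p.1.1 `&` rat_ball q.1 q.2) = 1%N].
pose V (s : seq par) := [set Z : config F | forall p, p \in s -> V1 p Z].
exists (fun k => if (choice.unpickle k : option (seq par)) is Some s then V s else set0); split.
- move=> k; case: choice.unpickle => [s|]; last by rewrite preimage_set0.
  have -> : @restr R d F @^-1` V s = \bigcap_(p in [set` s]) (@restr R d F @^-1` V1 p) by [].
  apply: fin_bigcap_measurable => // -[[i n] t] _.
  have LFi A : A `&` F `&` L i = A `&` L i.
    by rewrite -setIA (setIidr (LF i)).
  have -> : @restr R d F @^-1` V1 (i, n, t) =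
     [set Y | cnt (Y `&` L i) = n] `&`
     \bigcap_(q in [set` t]) [set Y | cnt (Y `&` (L i `&` rat_ball q.1 q.2)) = 1%N].
    apply/seteqP; split => Y; rewrite /V1/= /= !LFi.
      by move=> [Yn h]; split => // q /h; rewrite /= setIA.
    by move=> [Yn h]; split => // q /h /=; rewrite setIA.
  apply: measurableI.
    have := @measurable_cnt_compact R d setT (L i) lT (cL i) (@subsetT _ _).
    by move=> /(_ measurableT [set n] I); rewrite setTI.
  apply: fin_bigcap_measurable => // q _.
  have := @measurable_cnt_setI_compact R d setT (L i) (rat_ball q.1 q.2) lT (cL i)
    (@subsetT _ _) (borel_open (@open_eball _ _ _ _)).
  by move=> /(_ measurableT [set 1%N] I); rewrite setTI.
- move=> A oA Y AY.
  pose G := filter_from [set s | V s Y] V.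
  have FG : Filter G.
    apply: filter_from_filter; first by exists [::].
    move=> s t Ys Yt; exists (s ++ t).
      by move=> p; rewrite mem_cat => /orP[/Ys|/Yt].
    by move=> Z Zst; split => p ps; apply: Zst; rewrite mem_cat ps ?orbT.
  suff GY : G --> Y.
    have [s Ys sA] : G A by apply: GY; exact: open_nbhs_nbhs.
    by exists (choice.pickle s); rewrite choice.pickleK.
  apply: cvg_config => f e e0.
  have [_ [K [cK KF f0]]] := svalP f.
  have [i KLi] := KL K cK KF.
  have f0' (Z : config F) x : points Z x -> ~ L i x -> sval f x = 0.
    by move=> /points_sub Fx nL; apply: f0 => // /KLi.
  have fZ (Z : config F) : finite_set (Z `&` L i) by exact: points_lf.
  have [c [r [r0 tB cY _ cZ]]] := local_approx (N0 := fun=> setT) (fZ Y) (@f0' Y) e0 (fun _ _ => filterT).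
  pose n := cnt (Y `&` L i).
  exists [:: (i, n, [seq (c j, r j) | j <- enum 'I_n])].
    by move=> p; rewrite inE => /eqP ->; split => //= q /mapP[j _ ->] /=.
  move=> Z; rewrite /V/= => /(_ _ (mem_head _ _))[/= h1 h2]; apply: cZ => //.
    exact: f0'.
  by move=> j; apply: (h2 (c j, r j)); apply/mapP; exists j => //; rewrite mem_enum.
Qed.

Lemma measurable_restr F : locally_closed F -> measurable_fun setT (@restr R d F).
Proof.
move=> lF; have [V [mV base]] := config_countable_base lF.
apply: (@measurability _ _ _ _ setT _ (@open (config F))) => //.
move=> _ [A oA <-]; rewrite setTI.
have -> : A = \bigcup_(k in [set k | V k `<=` A]) V k.
  apply/seteqP; split => [Y AY|Y [k kA /kA//]].
  by have [k [kY kA]] := base A oA Y AY; exists k.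
by rewrite preimage_bigcup; apply: bigcup_measurable => k _; exact: mV.
Qed.

(** One bump function below the indicator of [S] and one above have statistics
    that at [Y] both equal the number of points in [S]; the integers
    in between are squeezed. *)
Lemma cnt_cvg (Yn : nat -> config [set: 'rV[R]_d]) (Y : config [set: 'rV[R]_d]) S :
  Yn n @[n --> \oo] --> Y -> bounded_set S -> (forall y, points Y y -> decided S y) ->
  \forall n \near \oo, cnt (Yn n `&` S) = cnt (Y `&` S).
Proof.
move=> cvgY bS dS.
have ccS : compact (closure S) by exact: compact_closure.
have finS (Z : config [set: 'rV[R]_d]) : finite_set (Z `&` S) by exact: finite_bounded.
have YcS : Y `&` closure S = Y `&` S.
  apply/seteqP; split => y [Yy]; last by move=> Sy; split=> //; exact: subset_closure.
  move=> cSy; split=> //; have [/interior_subset//|] := dS y Yy.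
  by move=> /cSy [z []].
have YiS : Y `&` S `<=` interior S.
  by move=> y [Yy Sy]; have [//|/interior_subset] := dS y Yy.
have lT : locally_closed [set: 'rV[R]_d] by apply: open_locally_closed; exact: openT.
have statcvg (f : test_fun setT) : stat (Yn n) f @[n --> \oo] --> stat Y f.
  exact: (cvg_comp _ _ cvgY (@stat_continuous _ _ setT f Y)).
have cYS : compact (Y `&` S) by exact: finite_compact.
have [f [f01 f1 f0]] := test_bump lT cYS (@subsetT _ _) (open_interior S) YiS.
have [W [oW SW YW]] := isolating_nbhs Y ccS.
have [g [g01 g1 g0]] := test_bump lT ccS (@subsetT _ _) oW SW.
have Yf : (cnt (Y `&` S))%:R <= stat Y f.
  apply: sum_ge_cnt; [exact: stat_fin|exact: finS|exact: subIsetl| |].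
    by move=> x _; have /andP[] := f01 x.
  by move=> x /f1 ->.
have Yg : stat Y g <= (cnt (Y `&` S))%:R.
  apply: sum_le_cnt => //; last by move=> x _; have /andP[] := g01 x.
  move=> x Yx nYS; apply: g0 => Wx; apply: nYS.
  by rewrite -YcS -YW.
(* [f] vanishes off the interior of [S] and [g] is [1] on its closure. *)
have lo n : stat (Yn n) f <= (cnt (Yn n `&` S))%:R.
  apply: sum_le_cnt => //; last by move=> x _; have /andP[] := f01 x.
  move=> x Yx nYS; apply: f0 => /interior_subset Sx; exact: nYS.
have hi n : (cnt (Yn n `&` S))%:R <= stat (Yn n) g.
  apply: (@le_trans _ _ (cnt (Yn n `&` closure S))%:R).
    rewrite ler_nat cnt_le//; first exact: points_lf.
    by apply: setIS; exact: subset_closure.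
  by apply: cnt_le_stat => // x _; have /andP[] := g01 x.
have e0 : 0 < 2^-1 :> R by rewrite invr_gt0.
have := statcvg f => /cvgrPdist_lt /(_ _ e0) nf.
have := statcvg g => /cvgrPdist_lt /(_ _ e0) ng.
near=> n.
have h1 : `|stat Y f - stat (Yn n) f| < 2^-1 by near: n.
have h2 : `|stat Y g - stat (Yn n) g| < 2^-1 by near: n.
have l := lo n; have h := hi n.
move: h1 h2; rewrite !ltr_norml => /andP[_ h1] /andP[h2 _].
have a : (cnt (Yn n `&` S) <= cnt (Y `&` S))%N by rewrite -ltnS -(ltr_nat R) -natr1; lra.
have b : (cnt (Y `&` S) <= cnt (Yn n `&` S))%N by rewrite -ltnS -(ltr_nat R) -natr1; lra.
by apply/eqP; rewrite eqn_leq a b.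
Unshelve. all: by end_near. Qed.

End ConfigBase.

(** * Regularity of finite measures *)

Lemma cvge0_near (R : realType) (u : nat -> \bar R) (e : R) : u n @[n --> \oo] --> 0%E ->
  0 < e -> \forall n \near \oo, (u n <= e%:E)%E.
Proof.
move=> cu e0; have e1 : (0 < e%:E :> \bar R)%E by rewrite lte_fin.
apply: (cu [set x | (x <= e%:E)%E]).
by apply: filterS (open_ereal_lt' e1) => x /ltW.
Qed.

Section Regularity.
Context {dT : measure_display} {T : measurableType dT} {R : realType}.
Context (mu : {measure set T -> \bar R}) (G : set T) (opens : set (set T)).
Implicit Types U A : set T.

(** [opens] plays the role of the open sets, up to the null set [~` G]. It is
    kept abstract because two families are needed: the vaguely open sets inside
    the domain, and the unions of test sets outside it, which are not open. *)
Definition outer_regular U := forall e : R, 0 < e ->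
  exists A, [/\ opens A, U `&` G `<=` A & (mu (A `\` U) <= e%:E)%E].

Definition regular U := [/\ measurable U, outer_regular U & outer_regular (~` U)].

Context (mu_fin : (mu setT < +oo)%E) (mG : measurable G) (muG : mu (~` G) = 0%E).
Context (opens_measurable : forall A, opens A -> measurable A).
Context (opensT : opens setT) (opensI : forall A B, opens A -> opens B -> opens (A `&` B)).
Context (opens_bigcup : forall A_ : nat -> set T, (forall n, opens (A_ n)) -> opens (\bigcup_n A_ n)).
Context (opensC : forall A, opens A -> exists A_ : nat -> set T,
  (forall n, opens (A_ n)) /\ G `&` ~` A = G `&` \bigcap_n A_ n).

Lemma outer_regular_eq U V : measurable U -> measurable V -> G `&` U = G `&` V ->
  outer_regular U -> outer_regular V.
Proof.
move=> mU mV UV oU e e0; have [A [oA UA Ae]] := oU e e0; exists A; split => //.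
  by rewrite setIC -UV setIC.
apply: le_trans Ae; have mA := opens_measurable oA.
apply: (@le_trans _ _ (mu ((A `\` U) `|` ~` G))).
  apply: le_measure; rewrite ?inE; [exact: measurableD| |].
    by apply: measurableU; [exact: measurableD|exact: measurableC].
  move=> x [Ax nV]; have [Gx|] := pselect (G x); last by right.
  left; split => // Ux; apply: nV.
  have : (G `&` U) x by split.
  by rewrite UV => -[].
apply: (le_trans (measureU2 _ _ _)); [exact: measurableD|exact: measurableC|].
by rewrite [X in (_ + X)%E](_ : _ = 0%E) ?adde0.
Qed.

Lemma outer_regular_bigcup (U_ : nat -> set T) : (forall n, measurable (U_ n)) ->
  (forall n, outer_regular (U_ n)) -> outer_regular (\bigcup_n U_ n).
Proof.
move=> mU oU e e0.
have /choice[A hA] n : exists A, [/\ opens A, U_ n `&` G `<=` A &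
    (mu (A `\` U_ n) <= (e / (2 ^ n.+1)%:R)%:E)%E].
  by apply: oU; rewrite divr_gt0// ltr0n expn_gt0.
have mA n : measurable (A n) by have [/opens_measurable] := hA n.
exists (\bigcup_n A n); split.
- by apply: opens_bigcup => n; have [] := hA n.
- by rewrite setI_bigcupl; apply: subset_bigcup => n _; have [] := hA n.
- apply: (@le_trans _ _ (\sum_(0 <= n <oo) mu (A n `\` U_ n))%E).
    apply: measure_sigma_subadditive.
    + by move=> n; apply: measurableD.
    + by apply: measurableD; exact: bigcupT_measurable.
    + move=> x [[n _ Ax] nU]; exists n => //; split => // Ux; apply: nU.
      by exists n.
  apply: le_trans (epsilon_trick0 xpredT (ltW e0)).
  by apply: lee_nneseries => // n _; have [] := hA n.
Qed.

Lemma outer_regularI U V : measurable U -> measurable V ->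
  outer_regular U -> outer_regular V -> outer_regular (U `&` V).
Proof.
move=> mU mV oU oV e e0; have e20 : 0 < e / 2 by rewrite divr_gt0.
have [A [oA UA Ae]] := oU _ e20; have [B [oB VB Be]] := oV _ e20.
have mA := opens_measurable oA; have mB := opens_measurable oB.
exists (A `&` B); split; first exact: opensI.
  by move=> x [[Ux Vx] Gx]; split; [exact: UA|exact: VB].
apply: (@le_trans _ _ (mu ((A `\` U) `|` (B `\` V)))).
  apply: le_measure; rewrite ?inE.
  - by apply: measurableD; exact: measurableI.
  - by apply: measurableU; exact: measurableD.
  - move=> x [[Ax Bx] nUV]; have [Ux|] := pselect (U x); last by left.
    by right; split => // Vx; exact: nUV.
apply: (le_trans (measureU2 _ _ _)); [exact: measurableD|exact: measurableD|].
by rewrite (le_trans (leeD Ae Be))// -EFinD lee_fin -splitr.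
Qed.

Lemma outer_regular_bigcap (U_ : nat -> set T) : (forall n, measurable (U_ n)) ->
  (forall n, outer_regular (U_ n)) -> outer_regular (\bigcap_n U_ n).
Proof.
move=> mU oU.
pose V n := \bigcap_(i in `I_n.+1) U_ i.
have VS n : V n.+1 = U_ n.+1 `&` V n.
  by rewrite /V IIS bigcap_setU bigcap_set1 setIC.
have mV n : measurable (V n).
  by elim: n => [|n ih]; [rewrite /V IIS II0 set0U bigcap_set1|rewrite VS; exact: measurableI].
have oV n : outer_regular (V n).
  elim: n => [|n ih]; first by rewrite /V IIS II0 set0U bigcap_set1.
  by rewrite VS; apply: outer_regularI.
have UV : \bigcap_n U_ n = \bigcap_n V n.
  apply/seteqP; split => x h n _; first by move=> i _; exact: h.
  by apply: (h n I) => /=.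
have mI : measurable (\bigcap_n U_ n) by apply: bigcapT_measurable.
move=> e e0; have e20 : 0 < e / 2 by rewrite divr_gt0.
have cvgV : mu (V n `\` \bigcap_n U_ n) @[n --> \oo] --> 0%E.
  have -> : 0%E = mu (\bigcap_n (V n `\` \bigcap_n U_ n)) :> \bar R.
    rewrite (_ : \bigcap_n _ = set0) ?measure0//; apply/seteqP; split => // x h.
    have [_] := h 0%N I; apply; rewrite UV => n _; by have [] := h n I.
  apply: nonincreasing_cvg_mu.
  - apply: le_lt_trans mu_fin; apply: le_measure; rewrite ?inE//.
    exact: measurableD.
  - by move=> i; exact: measurableD.
  - by apply: bigcapT_measurable => i; exact: measurableD.
  - apply/nonincreasing_seqP => n; apply/subsetPset; apply: setSD.
    by rewrite VS; exact: subIsetr.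
have [n hn] : exists n, (mu (V n `\` \bigcap_n U_ n) <= (e / 2)%:E)%E.
  by have [n _ /(_ n (leqnn _))] := cvge0_near cvgV e20; exists n.
have [A [oA VA Ae]] := oV n _ e20; have mA := opens_measurable oA.
exists A; split => //.
  by apply: subset_trans VA; apply: setSI; rewrite UV; exact: bigcap_inf.
apply: (@le_trans _ _ (mu ((A `\` V n) `|` (V n `\` \bigcap_n U_ n)))).
  apply: le_measure; rewrite ?inE.
  - exact: measurableD.
  - by apply: measurableU; exact: measurableD.
  - move=> x [Ax nU]; have [Vx|] := pselect (V n x); last by left.
    by right.
apply: (le_trans (measureU2 _ _ _)); [exact: measurableD|exact: measurableD|].
by rewrite (le_trans (leeD Ae hn))// -EFinD lee_fin -splitr.
Qed.

Lemma regular_opens A : opens A -> regular A.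
Proof.
move=> oA.
have oo B : opens B -> outer_regular B.
  move=> oB e e0; exists B; split; [exact: oB|exact: subIsetl|].
  by rewrite setDv measure0 lee_fin ltW.
have mA := opens_measurable oA.
split => //; first exact: oo.
have [B [oB AB]] := opensC oA.
apply: (@outer_regular_eq (\bigcap_n B n)) => //.
- by apply: bigcapT_measurable => n; exact: opens_measurable.
- exact: measurableC.
- by apply: outer_regular_bigcap => n; [exact: opens_measurable|exact: oo].
Qed.

Lemma regularC U : regular U -> regular (~` U).
Proof. by move=> [mU oU oCU]; split; [exact: measurableC| |rewrite setCK]. Qed.

Lemma regular_bigcup (U_ : nat -> set T) : (forall n, regular (U_ n)) ->
  regular (\bigcup_n U_ n).
Proof.
move=> rU; have mU n : measurable (U_ n) by have [] := rU n.
split; first exact: bigcupT_measurable.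
  by apply: outer_regular_bigcup => // n; have [] := rU n.
rewrite setC_bigcup; apply: outer_regular_bigcap => n; last by have [] := rU n.
exact: measurableC.
Qed.

Lemma regular_bigcap (U_ : nat -> set T) : (forall n, regular (U_ n)) ->
  regular (\bigcap_n U_ n).
Proof.
move=> rU; rewrite -[\bigcap_n _]setCK setC_bigcap; apply: regularC.
by apply: regular_bigcup => n; exact: regularC.
Qed.

Lemma regularI U V : regular U -> regular V -> regular (U `&` V).
Proof.
move=> rU rV; rewrite -bigcap2E; apply: regular_bigcap => -[|[|n]] //=.
exact: regular_opens.
Qed.

Lemma regular_eq U V : measurable V -> G `&` U = G `&` V -> regular U -> regular V.
Proof.
move=> mV UV [mU oU oCU]; split => //; first exact: outer_regular_eq oU.
apply: outer_regular_eq oCU; [exact: measurableC|exact: measurableC|].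
apply/seteqP; split => x [Gx nU]; split => // Vx; apply: nU.
  by have : (G `&` V) x by []; rewrite -UV => -[].
by have : (G `&` U) x by []; rewrite UV => -[].
Qed.

(** As complements of [opens] are countable intersections of [opens], the regular
    sets form a sigma-algebra. *)
Lemma regular_sigma (C : set (set T)) : C `<=` regular -> <<s C >> `<=` regular.
Proof.
move=> Cr; apply: smallest_sub => //; split.
- by rewrite -setCT; apply: regularC; exact: regular_opens.
- by move=> A rA; rewrite setTD; exact: regularC.
- by move=> A rA; exact: regular_bigcup.
Qed.

(** Comparison on open sets yields comparison on all regular sets, because an open
    neighbourhood is only slightly larger for the dominating measure. *)
Lemma le_measure_regular (nu : {measure set T -> \bar R}) U :
  nu (~` G) = 0%E -> (forall A, opens A -> (nu A <= mu A)%E) ->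
  regular U -> (nu U <= mu U)%E.
Proof.
move=> nuG le_opens [mU oU _]; apply/lee_addgt0Pr => e e0.
have [A [oA UA Ae]] := oU e e0; have mA := opens_measurable oA.
apply: (@le_trans _ _ (nu (A `|` ~` G))).
  apply: le_measure; rewrite ?inE//.
    by apply: measurableU => //; exact: measurableC.
  by move=> x Ux; have [Gx|] := pselect (G x); [left; exact: UA|right].
apply: (le_trans (measureU2 _ _ _)) => //; first exact: measurableC.
rewrite [X in (_ + X)%E](_ : _ = 0%E) ?adde0// (le_trans (le_opens _ oA))//.
apply: (@le_trans _ _ (mu (U `|` (A `\` U)))).
  apply: le_measure; rewrite ?inE//.
    by apply: measurableU => //; exact: measurableD.
  by move=> x Ax; have [|] := pselect (U x); [left|right].
apply: (le_trans (measureU2 _ _ _)) => //; first exact: measurableD.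
by rewrite leeD2l.
Qed.

End Regularity.

(** * Measurability of the energy *)

Section DiracSum.
Context {dT : measure_display} {T : measurableType dT} {R : realType}.

(** The counting measure of a finite set, written as a sum of Dirac masses so
    that integrals against it are finite sums. *)
Definition dirac_sum (x0 : T) (A : set T) : {measure set T -> \bar R} :=
  msum (fun i => dirac (nth x0 (fset_set A) i)) (cnt A).

Lemma dirac_sumE x0 A U : finite_set A -> dirac_sum x0 A U = (cnt (A `&` U))%:R%:E.
Proof.
move=> fA; rewrite /dirac_sum /msum/=.
transitivity (\sum_(x <- fset_set A) ((x \in U)%:R : R)%:E)%E.
  rewrite (big_nth x0) big_mkord; apply: eq_bigr => i _; exact: diracE.
rewrite sumEFin -(@sum_cnt _ R); last exact: finite_setIl.
congr (_%:E); rewrite -fsbig_finite// [LHS]fsbig_mkcond [RHS]fsbig_mkcond.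
apply: eq_fsbigr => x _; rewrite /patch in_setI; case: (x \in A) => //=.
by case: (x \in U).
Qed.

Lemma integral_dirac_sum x0 A (f : T -> \bar R) : finite_set A ->
  (forall x, 0 <= f x)%E -> measurable_fun setT f ->
  (\int[dirac_sum x0 A]_x f x = \sum_(x \in A) f x)%E.
Proof.
move=> fA f0 mf; rewrite ge0_integral_measure_sum// fsbig_finite//= [RHS](big_nth x0).
rewrite big_mkord; apply: eq_bigr => i _.
by rewrite integral_dirac// diracT mul1e.
Qed.

(** The counting measure of the random finite set is a kernel, and the sum is
    its integral. *)
Lemma measurable_fsum dX (X : measurableType dX) (x0 : T) (l : X -> set T) (f : T -> \bar R) :
  (forall x, finite_set (l x)) ->
  (forall U, measurable U -> measurable_fun setT (fun x => cnt (l x `&` U))) ->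
  measurable_fun setT f -> measurable_fun setT (fun x => \sum_(y \in l x) f y)%E.
Proof.
move=> fin ml mf.
have pos (g : T -> \bar R) : (forall y, 0 <= g y)%E -> measurable_fun setT g ->
    measurable_fun setT (fun x => \sum_(y \in l x) g y)%E.
  move=> g0 mg; under eq_fun do rewrite -(integral_dirac_sum x0)//.
  apply: (@measurable_fun_integral_kernel _ _ _ _ _ (fun x => dirac_sum x0 (l x))) => // U mU.
  under eq_fun do rewrite dirac_sumE//.
  by apply: (measurableT_comp (f := fun n : nat => n%:R%:E : \bar R)) => //; exact: ml.
rewrite (_ : (fun x => _) = fun x => (\sum_(y \in l x) f^\+ y - \sum_(y \in l x) f^\- y)%E).
  apply: emeasurable_funB; apply: pos => //.
    exact: measurable_funepos.
  exact: measurable_funeneg.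
apply/funext => x; rewrite !fsbig_finite//= -sumeN; last first.
  by move=> i j _ _; rewrite ge0_adde_def// inE.
rewrite -big_split/=; apply: eq_bigr => y _.
by rewrite {1}(funeposneg f).
Qed.

End DiracSum.

Section ErealMeasurable.
Context {R : realType}.

Lemma measurable_ereal_fun (g : \bar R -> \bar R) :
  measurable_fun setT (fun r : R => g r%:E) -> measurable_fun setT g.
Proof.
move=> mg _ B mB; rewrite setTI.
have -> : g @^-1` B = EFin @` ((fun r : R => g r%:E) @^-1` B) `|`
    ([set +oo%E] `&` g @^-1` B) `|` ([set -oo%E] `&` g @^-1` B).
  apply/seteqP; split => [[r| |] h|x /=].
  - by left; left; exists r.
  - by left; right.
  - by right.
  - by move=> [[[r h <-]|[_ ]]|[_]].
have sub1 (x : \bar R) : measurable ([set x] `&` g @^-1` B).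
  have [h|h] := pselect (B (g x)).
    by rewrite setIidl// => _ ->.
  rewrite (_ : _ `&` _ = set0)//; apply/seteqP; split => // y [-> //].
apply: measurableU => //; apply: measurableU => //.
by apply: measurable_image_EFin; have := mg measurableT _ mB; rewrite setTI.
Qed.

Lemma measurable_expeR : measurable_fun setT (@expeR R).
Proof. by apply: measurable_ereal_fun => /=; exact/measurable_EFinP. Qed.

Lemma measurable_inve_ge0 d (T : measurableType d) (f : T -> \bar R) :
  (forall x, 0 <= f x)%E -> measurable_fun setT f -> measurable_fun setT (fun x => (f x)^-1%E).
Proof.
move=> f0 mf.
pose g (x : \bar R) : \bar R := match x with
  | r%:E => if r == 0 then +oo%E else if 0 < r then (expR (- ln r))%:E else 0%E
  | _ => 0%E end.
rewrite (_ : (fun x => _) = g \o f).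
  apply: measurableT_comp => //; apply: measurable_ereal_fun => /=.
  apply: measurable_fun_ifT => //; first exact: measurable_fun_eqr.
  apply: measurable_fun_ifT => //; first exact: measurable_fun_ltr.
  apply/measurable_EFinP; apply: measurableT_comp => //.
  by apply: measurableT_comp => //; exact: measurable_ln.
apply/funext => x /=; have := f0 x; case: (f x) => [r| |]//=.
  rewrite lee_fin => r0; rewrite /inve; case: eqP => // /eqP rn0.
  by rewrite lt_neqAle eq_sym rn0 r0/= expRN lnK// posrE lt_neqAle eq_sym rn0.
Qed.

End ErealMeasurable.

Section Energy.
Context {R : realType} {d : nat}.
Local Notation Rb := (g_sigma_algebraType (@open 'rV[R]_d)).

Lemma cntX (T1 T2 : choiceType) (A : set T1) (B : set T2) : finite_set A -> finite_set B ->
  cnt (A `*` B) = (cnt A * cnt B)%N.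
Proof.
move=> fA fB; apply/eqP; rewrite -(eqr_nat R) natrM -!(@sum_cnt _ R)//; last exact: finite_setX.
rewrite -(pair_fsbig _ (fun _ _ => 1))//= mulrC mulr_fsumr; apply/eqP; apply: eq_fsbigr => x _.
by rewrite mulr1.
Qed.

(** The product sigma-algebra is generated by products of balls; it contains the
    preimages of open sets because countably many such products cover them. *)
Lemma measurable_sub_borel : measurable_fun setT (fun p : Rb * Rb => (p.1 - p.2 : Rb)).
Proof.
apply: (@measurability _ _ (Rb * Rb)%type Rb setT _ (@open 'rV[R]_d)) => //.
move=> _ [A oA <-]; rewrite setTI.
pose par := (('rV[rat]_d * rat) * ('rV[rat]_d * rat))%type.
pose W (q : par) : set (Rb * Rb) := @rat_ball R d q.1.1 q.1.2 `*` @rat_ball R d q.2.1 q.2.2.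
pose V n := if (choice.unpickle n : option par) is Some q then W q else set0.
have -> : (fun p : Rb * Rb => p.1 - p.2 : Rb) @^-1` A =
    \bigcup_(n in [set n | V n `<=` (fun p : Rb * Rb => p.1 - p.2 : Rb) @^-1` A]) V n.
  apply/seteqP; split => [[x y] /= xyA|p [n nA /nA//]].
  have /nbhs_ballP[e /= e0 eA] : nbhs (x - y : 'rV[R]_d) A by apply: open_nbhs_nbhs.
  have e20 : 0 < e / 2 by rewrite divr_gt0.
  have [c [r [r0 xc cx]]] := rat_ball_nbhs (nbhsx_ballx (x : 'rV[R]_d) _ e20).
  have [c' [r' [r'0 yc cy]]] := rat_ball_nbhs (nbhsx_ballx (y : 'rV[R]_d) _ e20).
  exists (choice.pickle (((c, r), (c', r')) : par)); rewrite /V /= choice.pickleK//.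
  move=> [u v] [/= /cx + /cy +]; rewrite -!ball_normE /= => h1 h2; apply: eA.
  rewrite -ball_normE /=.
  have -> : x - y - (u - v) = (x - u) - (y - v).
    by rewrite !opprB addrACA [RHS]addrACA; congr (_ + _); rewrite addrC.
  by rewrite (le_lt_trans (ler_normB _ _))// [ltRHS]splitr ltrD.
apply: bigcup_measurable => n _; rewrite /V; case: choice.unpickle => [q|]; last exact: measurable0.
by apply: measurableX; apply: sub_sigma_algebra; exact: open_eball.
Qed.

Context (D : set 'rV[R]_d) (D_bounded : bounded_set D) (D_lc : locally_closed D).

Lemma config_finite (Y : config D) : finite_set (points Y).
Proof. by rewrite -(setIidl (@points_sub _ _ _ Y)); exact: finite_bounded. Qed.

Lemma measurable_cnt_borel (U : set Rb) : measurable U ->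
  measurable_fun setT (fun Y : config D => cnt (points Y `&` U)).
Proof.
move=> mU; apply: measurable_cnt => // Y; apply: finite_setIl; exact: config_finite.
Qed.

Lemma measurable_cnt_pairs (U : set (Rb * Rb)) : measurable U ->
  measurable_fun setT (fun Y : config D => cnt ((points Y `*` points Y) `&` U)).
Proof.
rewrite measurable_prod_measurableType => mU.
apply: measurable_cnt_sigma mU.
- move=> _ _ [A mA [B mB <-]] [A' mA' [B' mB' <-]]; exists (A `&` A'); first exact: measurableI.
  by exists (B `&` B'); [exact: measurableI|rewrite setXI].
- by move=> Y; apply: finite_setX; exact: config_finite.
- rewrite (_ : (fun Y => _) = fun Y : config D => (cnt (points Y) * cnt (points Y))%N); last first.
    by apply/funext => Y; apply: cntX; exact: config_finite.
  have := measurable_cnt_borel measurableT; under eq_fun do rewrite setIT.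
  by move=> h; exact: measurable_fun_nat2.
- move=> _ [A mA [B mB <-]].
  rewrite (_ : (fun Y => _) = fun Y : config D => (cnt (points Y `&` A) * cnt (points Y `&` B))%N); last first.
    by apply/funext => Y; rewrite -setXI cntX//; apply: finite_setIl; exact: config_finite.
  by apply: measurable_fun_nat2; exact: measurable_cnt_borel.
Qed.

(** The second sum runs over the product of the configuration with itself once
    the interaction is set to [0] on the diagonal. *)
Lemma measurable_energy (Phi Psi : 'rV[R]_d -> \bar R) : potential Phi -> potential Psi ->
  measurable_fun setT (fun Y : config D => energy Phi Psi Y).
Proof.
move=> [_ mPhi] [_ mPsi].
pose Psi2 (p : Rb * Rb) : \bar R := if p.1 == p.2 then 0%E else Psi (p.1 - p.2).
have mPsi2 : measurable_fun setT Psi2.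
  apply: measurable_fun_ifT => //; last first.
    by apply: (measurableT_comp (f := Psi : Rb -> \bar R)) => //; exact: measurable_sub_borel.
  apply: (@measurable_fun_bool _ _ _ _ true); rewrite setTI.
  have := measurable_sub_borel measurableT (Y := [set 0]); rewrite setTI.
  have m0 : measurable ([set 0] : set Rb).
    by apply: borel_closed; apply: compact_closed; [exact: norm_hausdorff|exact: compact_set1].
  move=> /(_ m0); congr measurable; apply/seteqP; split => p /=.
    by move/eqP; rewrite subr_eq0.
  by move/eqP => ->; rewrite subrr.
rewrite /energy; apply: emeasurable_funD.
  apply: (@measurable_fsum _ Rb _ _ _ 0) => //; first exact: config_finite.
  by move=> U; exact: measurable_cnt_borel.
apply: measurable_funeM.
rewrite (_ : (fun Y => _) = fun Y : config D => (\sum_(p \in points Y `*` points Y) Psi2 p)%E).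
  apply: (@measurable_fsum _ (Rb * Rb)%type _ _ _ (0, 0)) => //.
    by move=> Y; apply: finite_setX; exact: config_finite.
  by move=> U; exact: measurable_cnt_pairs.
apply/funext => Y; rewrite -[RHS](fsbig_widen [set p | [/\ points Y p.1, points Y p.2 & p.1 <> p.2]]).
- apply: eq_fsbigr => p; rewrite inE => -[_ _ /eqP/negbTE p12].
  by rewrite /Psi2 p12.
- by move=> p [].
- move=> p [[Y1 Y2] h] /=; rewrite /Psi2; case: eqP => // p12.
  by exfalso; apply: h.
Qed.

Context (Phi Psi : 'rV[R]_d -> \bar R) (Phi_pot : potential Phi) (Psi_pot : potential Psi).

Local Notation weight Z := (expeR (- energy Phi Psi (Z : config D))).

Lemma measurable_weight : measurable_fun setT (fun Z : config D => weight Z).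
Proof.
apply: (measurableT_comp measurable_expeR).
by apply: measurableT_comp => //; exact: measurable_energy.
Qed.

Lemma measurable_gibbs_weight dY (Y : measurableType dY)
    (Q : R.-pker Y ~> config D) A : measurable A ->
  measurable_fun setT (fun y => gibbs_weight Phi Psi (Q y) A).
Proof.
move=> mA; rewrite /gibbs_weight.
under eq_fun do rewrite integral_mkcond.
apply: (@measurable_fun_integral_kernel _ _ _ _ _ (fun y => Q y)).
- by move=> U mU; exact: measurable_kernel.
- by move=> Z; rewrite erestrict_ge0// => *; exact: expeR_ge0.
- apply/(measurable_restrictT _ _).1 => //.
  by apply: measurable_funTS; exact: measurable_weight.
Qed.

Context (mu : {measure set (config D) -> \bar R}).

Let gw := gibbs_weight Phi Psi mu.
Let gw0 : gw set0 = 0%E. Proof. by rewrite /gw /gibbs_weight integral_set0. Qed.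
Let gw_ge0 A : (0 <= gw A)%E.
Proof. by apply: integral_ge0 => *; exact: expeR_ge0. Qed.
Let gw_sigma : semi_sigma_additive gw.
Proof.
move=> F mF tF mUF; rewrite /gw /gibbs_weight ge0_integral_bigcup//.
- by apply: is_cvg_ereal_nneg_natsum => n _; exact: gw_ge0.
- by apply: measurable_funTS; exact: measurable_weight.
- by move=> *; exact: expeR_ge0.
Qed.

Lemma gibbs_weight_measure : exists nu : {measure set (config D) -> \bar R},
  forall A, nu A = gibbs_weight Phi Psi mu A.
Proof.
pose m := isMeasure.Build _ _ _ gw gw0 gw_ge0 gw_sigma.
pose nu : {measure set (config D) -> \bar R} := HB.pack gw m.
by exists nu.
Qed.

Lemma gibbs_weight_null A : measurable A -> mu A = 0%E -> gibbs_weight Phi Psi mu A = 0%E.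
Proof.
move=> mA mu0; apply: null_set_integral => //.
by apply: measurable_funTS; exact: measurable_weight.
Qed.

End Energy.

(** * Test sets inside the domain *)

Section Inside.
Context {R : realType} {d : nat} (D : set 'rV[R]_d).
Hypotheses (D_bounded : bounded_set D) (D_open : open D).

Let D_lc : locally_closed D := open_locally_closed D_open.

Definition basic_in_set m (q : {ffun 'I_m -> 'rV[rat]_d * rat}) : set (config D) :=
  [set Z | points Z #= `I_m /\ forall i, points Z `&` rat_ball (q i).1 (q i).2 #= `I_1].

Definition basic_in_valid m (q : {ffun 'I_m -> 'rV[rat]_d * rat}) : Prop :=
  [/\ forall i, 0 < (q i).2, trivIset setT (fun i => @rat_ball R d (q i).1 (q i).2) &
      forall i, rat_ball (q i).1 (q i).2 `<=` D].

Lemma basic_inP m A : basic_in m A <-> exists2 q, @basic_in_valid m q & A = basic_in_set q.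
Proof.
split=> [[c [r [r0 tB BD ->]]]|[q [r0 tB BD] ->]]; last first.
  by exists (fun i => (q i).1), (fun i => (q i).2).
exists [ffun i => (c i, r i)]; first split.
- by move=> i; rewrite ffunE; exact: r0.
- by move=> i j _ _; rewrite !ffunE; exact: tB.
- by move=> i; rewrite ffunE; exact: BD.
- by rewrite /basic_in_set; apply/seteqP; split => Z [Zm h]; split => // i; have := h i; rewrite ffunE.
Qed.

(** As [m] disjoint balls account for all points of a configuration with [m]
    points, they control all statistics at once. *)
Lemma basic_in_base m (A : set (config D)) (Z : config D) : open A -> A Z ->
  points Z #= `I_m -> exists q, [/\ @basic_in_valid m q, basic_in_set q Z & basic_in_set q `<=` A].
Proof.
move=> oA AZ /card_II_cnt[fZ cZ].
(* The configurations obtained by moving each point of [Z] within its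
   neighbourhood generate a filter that converges to [Z]. *)
pose M (N : 'rV[R]_d -> set 'rV[R]_d) := [set Z' : config D |
  exists v w : 'I_(cnt (points Z `&` setT)) -> 'rV[R]_d,
    [/\ injective v, injective w, range v = points Z `&` setT,
        range w = points Z' `&` setT & forall i, N (v i) (w i)]].
pose G := filter_from [set N | forall y, points Z y -> nbhs y (N y)] M.
have FG : Filter G.
  apply: filter_from_filter; first by exists (fun=> setT) => y _; exact: filterT.
  move=> N N' hN hN'; exists (fun y => N y `&` N' y).
    by move=> y Zy; apply: filterI; [exact: hN|exact: hN'].
  move=> Z' [v [w [vi wi vE wE h]]].
  by split; exists v, w; split => // i; have [] := h i.
have GZ : G --> Z.
  apply: cvg_config => f e e0.
  have fZT : finite_set (points Z `&` setT) by rewrite setIT.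
  have [|N [hN close]] := stat_close (f := f) fZT _ e0; first by move=> x _ /(_ I).
  exists N; first by move=> y Zy; apply: hN.
  move=> Z' [v [w [vi wi vE wE h]]]; by apply: (close Z' v w) => // x _ /(_ I).
have [N hN NA] : G A by apply: GZ; exact: open_nbhs_nbhs.
rewrite -cZ; have [] := @ball_family _ _ (points Z) (fun y => N y `&` D) fZ.
  move=> y Zy; apply: filterI; first exact: hN.
  by apply: open_nbhs_nbhs; split=> //; exact: points_sub Zy.
move=> v [c [r [vi vE r0 tB hB]]].
exists [ffun i => (c i, r i)]; split.
- split => [i|i j _ _|i]; rewrite ?ffunE//=; first exact: tB.
  by move=> x /((hB i).2 x)[].
- split; first exact/cnt_eqP.
  move=> i; rewrite ffunE /=; apply/cnt_eqP; first exact: finite_setIl.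
  by rewrite -vE; apply: (cnt_range_ball (B := fun i => rat_ball (c i) (r i))) => // j; exact: (hB j).1.
- move=> Z' [/card_II_cnt[fZ' cZ'] h]; apply: NA.
  have h' i : cnt (points Z' `&` rat_ball (c i) (r i)) = 1%N.
    by have := h i; rewrite ffunE /= => /card_II_cnt[].
  have [w [wi wE wB]] := ball_match fZ' cZ' tB h'.
  rewrite /M !setIT/= setIT; exists v, w; split => // i; exact: ((hB i).2 _ (wB i)).1.
Qed.

Lemma measurable_points_card m : measurable [set Z : config D | points Z #= `I_m].
Proof.
have := @measurable_cnt_borel R d D D_bounded D_lc setT measurableT.
move=> /(_ measurableT [set m] I); rewrite setTI; congr measurable.
apply/seteqP; split=> Z /=; rewrite setIT; first by move=> h; apply/cnt_eqP => //; exact: config_finite.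
by move=> /card_II_cnt[].
Qed.

Lemma measurable_basic_in_set m q : measurable (@basic_in_set m q).
Proof.
have -> : basic_in_set q = [set Z : config D | points Z #= `I_m] `&`
    \bigcap_(i in [set: 'I_m]) [set Z : config D | points Z `&` rat_ball (q i).1 (q i).2 #= `I_1].
  by apply/seteqP; split => Z [h1 h2]; split => // i; [move=> _; exact: h2|exact: h2].
apply: measurableI; first exact: measurable_points_card.
apply: fin_bigcap_measurable; first exact: finite_finset.
move=> i _; apply: measurable_card => //; first by apply: borel_open; exact: open_eball.
by move=> Y; apply: finite_setIl; exact: config_finite.
Qed.

Lemma measurable_A_in m (A : set (config D)) : A_in m A -> measurable A.
Proof.
move=> [n [E [hE ->]]]; apply: fin_bigcup_measurable => [|i _]; first exact: finite_finset.
by have /basic_inP[q _ ->] := hE i; exact: measurable_basic_in_set.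
Qed.

(** A configuration with [m] points meets all [m] balls if and only if it meets
    slightly smaller closed balls, and missing a compact set is an open
    condition. *)
Lemma basic_in_setC_gdelta m q : @basic_in_valid m q -> exists O_ : nat -> set (config D),
  (forall n, open (O_ n)) /\
  [set Z : config D | points Z #= `I_m] `&` ~` basic_in_set q =
  [set Z : config D | points Z #= `I_m] `&` \bigcap_n O_ n.
Proof.
move=> [r0 tB BD].
pose K n i := [set x : 'rV[R]_d | enorm (x - map_mx ratr (q i).1) <= ratr (q i).2 - n.+1%:R^-1].
have KB n i : K n i `<=` rat_ball (q i).1 (q i).2.
  by move=> x /le_lt_trans; apply; rewrite ltrBlDr ltrDl invr_gt0.
have cK n i : compact (K n i).
  have [M [M0 _]] := @compact_norm_lt R d set0 (@compact0 _).
  apply: (@compact_closed_norm_le _ _ _ (ratr (q i).2 + `|map_mx ratr (q i).1 : 'rV[R]_d|)).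
    apply: (@closed_comp _ _ (fun x : 'rV[R]_d => enorm (x - _)) [set r | r <= _]); last exact: closed_le.
    by move=> x _; exact: continuous_enorm.
  move=> x /KB /ltW /(le_trans (norm_le_enorm _)) h.
  rewrite -(subrK (map_mx ratr (q i).1) x) (le_trans (ler_normD _ _))// lerD2r//.
exists (fun n => \bigcup_i [set Z : config D | (cnt (points Z `&` K n i) <= 0)%N]); split.
  move=> n; apply: bigcup_open => i _; apply: open_cnt_le => //.
  by move=> x /KB /BD.
apply/seteqP; split => Z [Zm h]; split => //.
  move=> n _; apply: contrapT => nh; apply: h; split => //.
  have [fZ cZ] := card_II_cnt Zm.
  have /choice[w hw] i : exists z, (points Z `&` rat_ball (q i).1 (q i).2) z.
    have [z [Zz Kz]] : points Z `&` K n i !=set0.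
      apply/cnt_gt0; first exact: finite_setIl.
      rewrite lt0n -leqn0; apply/negP => le0; apply: nh; by exists i.
    by exists z; split => //; exact: KB Kz.
  have wi : injective w.
    move=> i j wij; apply: (tB i j) => //; exists (w i); split; first exact: (hw i).2.
    by rewrite wij; exact: (hw j).2.
  have wE : range w = points Z.
    apply: cnt_eq_sub => //; last by rewrite cnt_range.
    by move=> _ [i _ <-]; exact: (hw i).1.
  move=> i; apply/cnt_eqP; first exact: finite_setIl.
  rewrite -wE; apply: (cnt_range_ball (B := fun i => rat_ball (q i).1 (q i).2)) => // j.
  exact: (hw j).2.
move=> [_ h2].
have /choice[z hz] i : exists z, (points Z `&` rat_ball (q i).1 (q i).2) z.
  have [fZ cZ] := card_II_cnt (h2 i).
  by apply/cnt_gt0 => //; rewrite cZ.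
have : \forall n \near \oo, forall i, K n i (z i).
  apply: filter_forall => i.
  have e0 : 0 < ratr (q i).2 - enorm (z i - map_mx ratr (q i).1) by rewrite subr_gt0; exact: (hz i).2.
  have := near_infty_natSinv_lt (PosNum e0); apply: filterS => n /= hn.
  by rewrite /K/= lerBrDr -lerBrDl ltW.
move=> [n _ hn].
have [i _ /=] := h n I; rewrite leqn0 => /eqP c0.
have : (0 < cnt (points Z `&` K n i))%N.
  apply/cnt_gt0; first by apply: finite_setIl; exact: config_finite.
  by exists (z i); split; [exact: (hz i).1|apply: (hn n) => /=].
by rewrite c0.
Qed.

Let par m := {ffun 'I_m -> 'rV[rat]_d * rat}.

Definition basic_in_seq m (A : set (config D)) (n : nat) : option (par m) :=
  if (choice.unpickle n : option (par m)) is Some q then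
    if `[< basic_in_valid q /\ basic_in_set q `<=` A >] then Some q else None
  else None.

Lemma basic_in_seqP m A n q : basic_in_seq m A n = Some q ->
  basic_in_valid q /\ basic_in_set q `<=` A.
Proof. by rewrite /basic_in_seq; case: choice.unpickle => // q'; case: asboolP => // h [<-]. Qed.

Lemma basic_in_seq_cover m (A : set (config D)) Z : open A -> A Z -> points Z #= `I_m ->
  exists n, exists2 q, basic_in_seq m A n = Some q & basic_in_set q Z.
Proof.
move=> oA AZ Zm; have [q [qv qZ qA]] := basic_in_base oA AZ Zm.
exists (choice.pickle (q : par m)), q => //.
by rewrite /basic_in_seq choice.pickleK; case: asboolP => //; case.
Qed.

Lemma open_gdelta m (A : set (config D)) : open A -> exists O_ : nat -> set (config D),
  (forall n, open (O_ n)) /\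
  [set Z : config D | points Z #= `I_m] `&` ~` A =
  [set Z : config D | points Z #= `I_m] `&` \bigcap_n O_ n.
Proof.
move=> oA.
have /choice[P hP] n : exists P : nat -> set (config D), (forall k, open (P k)) /\
    [set Z : config D | points Z #= `I_m] `&` \bigcap_k P k =
    [set Z : config D | points Z #= `I_m] `&`
      (if basic_in_seq m A n is Some q then ~` @basic_in_set m q else setT).
  case E : basic_in_seq => [q|].
    by have [/basic_in_setC_gdelta[P [oP PE]] _] := basic_in_seqP E; exists P.
  exists (fun=> setT); split; first by move=> _; exact: openT.
  by congr (_ `&` _); apply/seteqP; split.
exists (fun k => if (choice.unpickle k : option (nat * nat)) is Some (n, i) then P n i else setT).
split.
  by move=> k; case: choice.unpickle => [[n i]|]; [exact: (hP n).1|exact: openT].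
apply/seteqP; split => Z [Zm h]; split => //.
  move=> k _; case: choice.unpickle => [[n i]|]//.
  suff : ([set Z : config D | points Z #= `I_m] `&` \bigcap_k P n k) Z by move=> [_]; exact.
  rewrite (hP n).2; split => //; case E : basic_in_seq => [q|]// qZ.
  by apply: h; have [_] := basic_in_seqP E; exact.
move=> AZ; have [n [q E qZ]] := basic_in_seq_cover oA AZ Zm.
suff : ([set Z : config D | points Z #= `I_m] `&` \bigcap_k P n k) Z.
  by rewrite (hP n).2 E => -[_]; exact.
split => // i _; have := h (choice.pickle (n, i)) I; by rewrite choice.pickleK.
Qed.

(** On configurations with [m] points an open set is an increasing union of
    members of [A_in m]; the measures are continuous from below. *)
Lemma le_measure_open_A_in m (mu1 mu2 : {measure set (config D) -> \bar R}) (A : set (config D)) :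
  mu1 (~` [set Z : config D | points Z #= `I_m]) = 0%E ->
  (forall B, A_in m B -> (mu1 B <= mu2 B)%E) -> open A -> (mu1 A <= mu2 A)%E.
Proof.
move=> mu1G le oA; set G := [set Z | _] in mu1G.
have mG : measurable G := measurable_points_card m.
have mA : measurable A by exact: measurable_open_config.
have -> : mu1 A = mu1 (A `&` G).
  apply/eqP; rewrite eq_le; apply/andP; split; last first.
    by apply: le_measure; rewrite ?inE//; exact: measurableI.
  apply: (@le_trans _ _ (mu1 ((A `&` G) `|` ~` G))).
    apply: le_measure; rewrite ?inE//.
      by apply: measurableU; [exact: measurableI|exact: measurableC].
    by move=> Z AZ; have [|] := pselect (G Z); [left|right].
  apply: (le_trans (measureU2 _ _ _)); [exact: measurableI|exact: measurableC|].
  by rewrite [X in (_ + X)%E](_ : _ = 0%E) ?adde0.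
have [[n0 [q0 E0]]|noq] := pselect (exists n, exists q, basic_in_seq m A n = Some q); last first.
  rewrite (_ : A `&` G = set0) ?measure0//; apply/seteqP; split => // Z [AZ GZ].
  by have [n [q E _]] := basic_in_seq_cover oA AZ GZ; apply: noq; exists n, q.
pose E n := basic_in_set (if basic_in_seq m A n is Some q then q else q0).
have hE n : basic_in m (E n) /\ E n `<=` A.
  rewrite /E; case En : basic_in_seq => [q|].
    by have [qv qA] := basic_in_seqP En; split => //; apply/basic_inP; exists q.
  by have [qv qA] := basic_in_seqP E0; split => //; apply/basic_inP; exists q0.
have mE n : measurable (E n) by exact: measurable_basic_in_set.
have AE : A `&` G = \bigcup_n E n.
  apply/seteqP; split => [Z [AZ GZ]|Z [n _ EZ]].
    by have [n [q En qZ]] := basic_in_seq_cover oA AZ GZ; exists n => //; rewrite /E En.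
  by split; [exact: (hE n).2|case: EZ].
pose U n := \bigcup_(i in [set: 'I_n.+1]) E i.
have mU n : measurable (U n) by apply: fin_bigcup_measurable => [|i _]; [exact: finite_finset|exact: mE].
have UE : \bigcup_n U n = \bigcup_n E n.
  apply/seteqP; split => Z [n _]; first by move=> [i _ EZ]; exists i.
  by move=> EZ; exists n => //; exists ord_max.
rewrite AE -UE.
have cvgU : mu1 \o U @ \oo --> mu1 (\bigcup_n U n).
  apply: nondecreasing_cvg_mu => //; first exact: bigcupT_measurable.
  apply/nondecreasing_seqP => n; apply/subsetPset => Z [i _ EZ].
  by exists (widen_ord (leqnSn _) i).
apply: (cvge_le _ cvgU); apply: nearW => n /=.
apply: (@le_trans _ _ (mu2 (U n))).
  by apply: le; exists n, (fun i : 'I_n.+1 => E i); split=> // i; have [] := hE i.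
by apply: le_measure; rewrite ?inE// => Z [i _]; exact: (hE i).2.
Qed.

(** From test sets to open sets by continuity from below, from open sets to Borel
    sets by outer regularity of the larger measure. *)
Lemma le_measure_A_in m (mu1 mu2 : {measure set (config D) -> \bar R}) :
  (mu2 setT < +oo)%E ->
  mu1 (~` [set Z : config D | points Z #= `I_m]) = 0%E ->
  mu2 (~` [set Z : config D | points Z #= `I_m]) = 0%E ->
  (forall B, A_in m B -> (mu1 B <= mu2 B)%E) ->
  forall A, measurable A -> (mu1 A <= mu2 A)%E.
Proof.
move=> fin2 mu1G mu2G le A mA.
have mo (B : set (config D)) : open B -> measurable B by exact: measurable_open_config.
apply: (@le_measure_regular _ _ _ mu2 [set Z : config D | points Z #= `I_m] (@open (config D))) => //.
- exact: measurable_points_card.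
- by move=> B oB; exact: (le_measure_open_A_in mu1G).
- have mG := measurable_points_card m.
  have oI (B C : set (config D)) : open B -> open C -> open (B `&` C) by exact: openI.
  have oU (B_ : nat -> set (config D)) : (forall n, open (B_ n)) -> open (\bigcup_n B_ n).
    by move=> h; apply: bigcup_open => n _; exact: h.
  have := @regular_sigma _ _ _ mu2 _ (@open (config D)) fin2 mG mu2G mo openT oI oU
    (@open_gdelta m) (@open (config D)).
  apply => // B oB.
  exact: (@regular_opens _ _ _ mu2 _ (@open (config D)) fin2 mG mu2G mo oI (@open_gdelta m)).
Qed.

End Inside.

(** * Test sets outside the domain *)

Section CountMatch.

Lemma cnt_image (T U : choiceType) (f : T -> U) (A : set T) : finite_set A -> injective f ->
  cnt (f @` A) = cnt A.
Proof.
move=> fA fi; apply: card_fset_set; have /(cnt_eqP _ fA) h : cnt A = cnt A by [].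
by apply: card_eq_trans h; apply: inj_card_eq => x y _ _; exact: fi.
Qed.

Lemma cnt_match (T : choiceType) n (v w : 'I_n -> T) (S S' : set T) :
  injective v -> injective w -> (forall i, S (v i) <-> S' (w i)) ->
  cnt (range v `&` S) = cnt (range w `&` S').
Proof.
move=> vi wi h.
have img (u : 'I_n -> T) (A : set T) : range u `&` A = u @` [set i | A (u i)].
  by apply/seteqP; split => [_ [[i _ <-] Ai]|_ [i Ai <-]]; [exists i|split => //; exists i].
have fin (A : set 'I_n) : finite_set A by exact: finite_finset.
rewrite !img !cnt_image//; congr cnt; apply/seteqP; split => i /h //.
Qed.

End CountMatch.

Section Outside.
Context {R : realType} {d : nat} (D : set 'rV[R]_d).
Hypothesis D_open : open D.

Let F_lc : locally_closed (~` D) := closed_locally_closed (open_closedC D_open).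
Local Notation ann r1 r2 := (@annulus R d (ratr r1) (ratr r2)).
Let par := (rat * rat * {n : nat & {ffun 'I_n -> 'rV[rat]_d * rat}})%type.
Local Notation out_n q := (tag q.2).
Definition out_ball (q : par) (i : 'I_(out_n q)) : set 'rV[R]_d :=
  rat_ball (tagged q.2 i).1 (tagged q.2 i).2.

Definition out_set (q : par) : set (config (~` D)) :=
  [set Y | points Y `&` (ann q.1.1 q.1.2 `&` ~` D) #= `I_(out_n q) /\
           forall i, points Y `&` @out_ball q i #= `I_1].

Definition out_valid (q : par) : Prop :=
  [/\ (0 < out_n q)%N /\ 0 < q.1.1 < q.1.2, forall i, 0 < (tagged q.2 i).2,
      trivIset setT (@out_ball q) &
      forall i, @out_ball q i `&` ~` D `<=` ann q.1.1 q.1.2 `&` ~` D].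

Lemma basic_outP A : @basic_out R d D A <-> exists2 q, out_valid q & A = out_set q.
Proof.
split=> [[n [r1 [r2 [c [r [nr r0 tB BD ->]]]]]]|[q [nr r0 tB BD] ->]]; last first.
  by exists (out_n q), q.1.1, q.1.2, (fun i => (tagged q.2 i).1), (fun i => (tagged q.2 i).2).
exists (r1, r2, existT (fun n => {ffun 'I_n -> 'rV[rat]_d * rat}) n [ffun i => (c i, r i)]).
  split => //.
  - by move=> i /=; rewrite ffunE; exact: r0.
  - by move=> i j _ _; rewrite /out_ball /= !ffunE; exact: tB.
  - by move=> i; rewrite /out_ball /= ffunE; exact: BD.
by apply/seteqP; split => Z [Zm h]; split => // i; have := h i; rewrite /out_ball /= ffunE.
Qed.

(** The outer configurations that the test sets resolve: counts in rational balls
    and annuli are locally constant there, and the test sets only see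
    configurations with at least one point. *)
Definition generic (Y : config (~` D)) : Prop := points Y !=set0 /\
  forall y, points Y y -> forall (c : 'rV[rat]_d) (r : rat), enorm (y - map_mx ratr c) != ratr r.

Lemma generic_ball Y y c r : generic Y -> points Y y -> decided (@rat_ball R d c r) y.
Proof. by move=> [_ h] Yy; apply: decided_eball; exact: h. Qed.

Lemma generic_enorm Y y r : generic Y -> points Y y -> enorm y != ratr r.
Proof. by move=> [_ h] Yy; have := h y Yy 0 r; rewrite map_mx0 subr0. Qed.

Lemma generic_ann Y y r1 r2 : generic Y -> points Y y -> decided (ann r1 r2) y.
Proof. by move=> gY Yy; apply: decided_annulus; exact: generic_enorm gY Yy. Qed.

Lemma compact_ann r1 r2 : compact (ann r1 r2).
Proof.
have ce := @enorm_continuous R d.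
apply: (@compact_closed_norm_le _ _ _ (ratr r2)); last first.
  by move=> x /andP[_]; apply: le_trans; exact: norm_le_enorm.
have -> : ann r1 r2 = [set x | ratr r1 <= enorm x] `&` [set x | enorm x <= ratr r2].
  by apply/seteqP; split => x /andP.
apply: closedI.
  by apply: (@closed_comp _ _ (fun x : 'rV[R]_d => enorm x) [set r | ratr r1 <= r]);
    [move=> x _; exact: ce|exact: closed_ge].
by apply: (@closed_comp _ _ (fun x : 'rV[R]_d => enorm x) [set r | r <= ratr r2]);
    [move=> x _; exact: ce|exact: closed_le].
Qed.

Lemma finite_ann (Y : config (~` D)) r1 r2 A : finite_set (points Y `&` (ann r1 r2 `&` A)).
Proof. by rewrite setIA; apply: finite_setIl; apply: points_lf; exact: compact_ann. Qed.

Lemma compact_window r1 r2 : compact (ann r1 r2 `&` ~` D).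
Proof. by apply: compact_setI_closed; [exact: compact_ann|exact: open_closedC]. Qed.

Lemma bounded_ball c r : bounded_set (@rat_ball R d c r).
Proof.
exists (ratr r + `|map_mx ratr c : 'rV[R]_d|); split; first exact: num_real.
move=> M /ltW hM x /ltW /(le_trans (norm_le_enorm _)) h; apply: le_trans hM.
by rewrite -(subrK (map_mx ratr c) x) (le_trans (ler_normD _ _))// lerD2r.
Qed.

Lemma finite_ball (Y : config (~` D)) c r : finite_set (points Y `&` @rat_ball R d c r).
Proof. by apply: finite_bounded; exact: bounded_ball. Qed.

Lemma measurable_out_set q : measurable (out_set q).
Proof.
have -> : out_set q = [set Y : config (~` D) | points Y `&` (ann q.1.1 q.1.2 `&` ~` D) #= `I_(out_n q)] `&`
    \bigcap_(i in [set: 'I_(out_n q)]) [set Y : config (~` D) | points Y `&` @out_ball q i #= `I_1].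
  by apply/seteqP; split => Z [h1 h2]; split => // i; [move=> _; exact: h2|exact: h2].
apply: measurableI.
  apply: measurable_card => //; last by move=> Y; exact: finite_ann.
  by apply: borel_closed; apply: compact_closed; [exact: norm_hausdorff|exact: compact_window].
apply: fin_bigcap_measurable; first exact: finite_finset.
move=> i _; apply: measurable_card => //; first by apply: borel_open; exact: open_eball.
by move=> Y; exact: finite_ball.
Qed.

(** Finitely many counts that are locally constant near a generic configuration
    are fixed by a single test set: its annulus contains all the sets in which
    points are counted, and its balls, one around each point of the annulus,
    are so small that no point can move across a boundary. *)
Lemma out_refine (I : finType) (S : I -> set 'rV[R]_d) Y : generic Y ->
  (forall i y, points Y y -> decided (S i) y) ->
  (forall i, exists r : rat * rat, 0 < r.1 /\ S i `&` ~` D `<=` ann r.1 r.2) ->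
  exists q, [/\ out_valid q, out_set q Y &
    forall Z, out_set q Z -> forall i, cnt (points Z `&` S i) = cnt (points Y `&` S i)].
Proof.
move=> gY dS /choice[r hr]; have [y0 Yy0] := gY.1.
have y00 : 0 < enorm y0.
  have := generic_enorm 0 gY Yy0; rewrite raddf0 => h.
  by rewrite lt_neqAle eq_sym h sqrtr_ge0.
have [a0] := rat_in_itvoo y00; rewrite in_itv/= => /andP[a00 a0y].
have y01 : enorm y0 < enorm y0 + 1 by rewrite ltrDl.
have [b0] := rat_in_itvoo y01; rewrite in_itv/= => /andP[b0y _].
(* The annulus also has to reach [y0], so that it contains at least one ball. *)
pose a := \big[Order.min/a0]_i (r i).1.
pose b := \big[Order.max/b0]_i (r i).2.
have a_gt0 : 0 < a.
  by apply: lt_bigmin => [|i _]; [rewrite ltr0q in a00|exact: (hr i).1].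
have ay : ratr a < enorm y0.
  by apply: le_lt_trans a0y; rewrite ler_rat; exact: bigmin_le_id.
have yb : enorm y0 < ratr b.
  by apply: (lt_le_trans b0y); rewrite ler_rat; exact: bigmax_ge_id.
have SL i : S i `&` ~` D `<=` ann a b.
  move=> x /(hr i).2 /andP[h1 h2]; apply/andP; split.
    by apply: le_trans h1; rewrite ler_rat; exact: bigmin_le.
  by apply: (le_trans h2); rewrite ler_rat; exact: le_bigmax.
have ab : a < b by rewrite -(ltr_rat R) (lt_trans ay).
pose L := ann a b `&` ~` D; pose A := points Y `&` L.
have fA : finite_set A by exact: finite_ann.
pose N (y : 'rV[R]_d) := [set x | ann a b x /\ forall i, S i x <-> S i y].
have hN y : A y -> nbhs y (N y).
  move=> [Yy [aby _]]; apply: filterI.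
    have := decided_near (generic_ann a b gY Yy); apply: filterS => x h; exact: (h.2 aby).
  apply: (@filter_forall _ I (fun i x => S i x <-> S i y) (nbhs y) (nbhs_filter y)) => i.
  exact: decided_near (dS i y Yy).
have [v [c [s [vi vE s0 tB hB]]]] := ball_family fA hN.
pose q : par := (a, b, existT (fun n => {ffun 'I_n -> 'rV[rat]_d * rat}) (cnt A) [ffun i => (c i, s i)]).
have qB i : @out_ball q i = rat_ball (c i) (s i) by rewrite /out_ball /= ffunE.
exists q; split.
- split.
  + split; last by rewrite /= a_gt0.
    apply/cnt_gt0 => //; exists y0; split => //; split; first by apply/andP; rewrite !ltW.
    exact: points_sub Yy0.
  + by move=> i /=; rewrite ffunE; exact: s0.
  + by move=> i j _ _; rewrite !qB; exact: tB.
  + by move=> i x; rewrite qB => -[/((hB i).2 x)[xab _] xD]; split.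
- split; first exact/cnt_eqP.
  move=> i; rewrite qB; apply/cnt_eqP; first exact: finite_ball.
  rewrite (_ : points Y `&` _ = range v `&` rat_ball (c i) (s i)).
    by apply: (cnt_range_ball (B := fun i => rat_ball (c i) (s i))) => // j; exact: (hB j).1.
  rewrite vE; apply/seteqP; split => x; last by move=> [[Yx _]].
  move=> [Yx xB]; split => //; split => //; split; last exact: points_sub Yx.
  exact: ((hB i).2 _ xB).1.
- move=> Z [/card_II_cnt[fZ cZ] hZ] j.
  have cB i : cnt (points Z `&` L `&` rat_ball (c i) (s i)) = 1%N.
    have [_ c1] := card_II_cnt (hZ i); rewrite qB in c1; apply: etrans c1; congr cnt.
    apply/seteqP; split => x; first by move=> [[Zx _]].
    move=> [Zx xB]; split => //; split => //; split; last exact: points_sub Zx.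
    exact: ((hB i).2 _ xB).1.
  have [w [wi wE wB]] := ball_match fZ cZ tB cB.
  have inL (T : config (~` D)) : points T `&` S j = points T `&` L `&` S j.
    apply/seteqP; split => x; last by move=> [[Tx _]].
    move=> [Tx Sx]; split => //; split => //; have nDx := points_sub Tx.
    by split => //; apply: (SL j).
  rewrite (inL Z) (inL Y) -/A -vE -wE; apply: cnt_match => // i.
  exact: ((hB i).2 _ (wB i)).2.
Qed.

(** The counting sets of the test set [q]: its balls, and its annulus at [None]. *)
Definition out_test (q : par) (i : option 'I_(out_n q)) : set 'rV[R]_d :=
  if i is Some j then @out_ball q j else ann q.1.1 q.1.2.

Lemma out_set_test q (Y Z : config (~` D)) :
  (forall i, cnt (points Z `&` @out_test q i) = cnt (points Y `&` @out_test q i)) ->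
  out_set q Y -> out_set q Z.
Proof.
have noD (T : config (~` D)) : points T `&` (ann q.1.1 q.1.2 `&` ~` D) = points T `&` ann q.1.1 q.1.2.
  by apply/seteqP; split => x; [move=> [Tx [h _]]|
    move=> [Tx h]; split => //; split => //; exact: points_sub Tx].
move=> h [h1 h2]; split.
  rewrite noD; apply/cnt_eqP; first by apply: points_lf; exact: compact_ann.
  by rewrite (h None) /=; move: h1; rewrite noD => /card_II_cnt[].
move=> i; apply/cnt_eqP; first exact: finite_ball.
by have := h (Some i) => /= ->; have /card_II_cnt[] := h2 i.
Qed.

Lemma out_test_decided q i Y y : generic Y -> points Y y -> decided (@out_test q i) y.
Proof. by move=> gY Yy; case: i => [i|]; [exact: generic_ball gY Yy|exact: generic_ann gY Yy]. Qed.

Lemma out_test_window q i : out_valid q -> exists r : rat * rat, 0 < r.1 /\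
  @out_test q i `&` ~` D `<=` ann r.1 r.2.
Proof.
move=> [[_ /andP[h _]] _ _ BD]; exists (q.1.1, q.1.2); split => //=.
by case: i => [i|] x; [move=> /BD[]|move=> []].
Qed.

(** Unions of test sets, up to configurations that are not generic. *)
Definition out_opens : set (set (config (~` D))) := [set U | measurable U /\
  forall Y, U Y -> generic Y -> exists q, [/\ out_valid q, out_set q Y &
    forall Z, out_set q Z -> generic Z -> U Z]].

Lemma out_opensT : out_opens setT.
Proof.
split => // Y _ gY; have [||q [qv qY _]] := @out_refine void (fun=> setT) Y gY.
- by [].
- by [].
- by exists q.
Qed.

Lemma out_opens_set q : out_valid q -> out_opens (out_set q).
Proof. by move=> qv; split; [exact: measurable_out_set|move=> Y qY _; exists q]. Qed.

Lemma out_opensI U V : out_opens U -> out_opens V -> out_opens (U `&` V).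
Proof.
move=> [mU oU] [mV oV]; split; first exact: measurableI.
move=> Y [UY VY] gY; have [p [pv pY pU]] := oU Y UY gY; have [q [qv qY qV]] := oV Y VY gY.
pose S (i : option 'I_(out_n p) + option 'I_(out_n q)) :=
  match i with inl j => @out_test p j | inr j => @out_test q j end.
have [||t [tv tY tZ]] := @out_refine _ S Y gY.
- by move=> [i|i] y Yy; exact: out_test_decided gY Yy.
- by move=> [i|i]; exact: out_test_window.
- exists t; split => // Z /tZ h gZ; split.
    by apply: pU => //; apply: out_set_test pY => i; exact: (h (inl i)).
  by apply: qV => //; apply: out_set_test qY => i; exact: (h (inr i)).
Qed.

Lemma out_opens_bigcup (U_ : nat -> set (config (~` D))) :
  (forall n, out_opens (U_ n)) -> out_opens (\bigcup_n U_ n).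
Proof.
move=> oU; split; first by apply: bigcupT_measurable => n; exact: (oU n).1.
move=> Y [n _ UY] gY; have [q [qv qY qU]] := (oU n).2 Y UY gY.
by exists q; split => // Z qZ gZ; exists n => //; exact: qU.
Qed.

Lemma out_opens_setC q : out_valid q -> out_opens (~` out_set q).
Proof.
move=> qv; split; first by apply: measurableC; exact: measurable_out_set.
move=> Y nqY gY; have [||t [tv tY tZ]] := @out_refine _ (@out_test q) Y gY.
- by move=> i y Yy; exact: out_test_decided gY Yy.
- by move=> i; exact: out_test_window.
- exists t; split => // Z /tZ h gZ qZ; apply: nqY.
  by apply: out_set_test qZ => i; rewrite h.
Qed.

Lemma out_opens_cover U : out_opens U -> exists K : set nat,
  [/\ forall k, K k -> exists2 q : par, choice.unpickle k = Some q & out_valid q,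
      forall k (q : par), K k -> choice.unpickle k = Some q -> out_set q `&` generic `<=` U &
      forall Y, U Y -> generic Y -> exists k, exists2 q : par, K k & choice.unpickle k = Some q /\ out_set q Y].
Proof.
move=> [mU oU].
exists [set k | exists q : par, [/\ choice.unpickle k = Some q, out_valid q & out_set q `&` generic `<=` U]].
split.
- by move=> k [q [kq qv _]]; exists q.
- by move=> k q [q' [-> _ h]] [<-].
- move=> Y UY gY; have [q [qv qY qU]] := oU Y UY gY.
  exists (choice.pickle q), q; last by rewrite choice.pickleK.
  by exists q; split; rewrite ?choice.pickleK// => Z [qZ gZ]; exact: qU.
Qed.

Lemma out_opensC U : out_opens U -> exists A_ : nat -> set (config (~` D)),
  (forall n, out_opens (A_ n)) /\ generic `&` ~` U = generic `&` \bigcap_n A_ n.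
Proof.
move=> /out_opens_cover[K [Kv KU Kc]].
exists (fun k => if `[< K k >] then
   (if (choice.unpickle k : option par) is Some q then ~` out_set q else setT) else setT).
split.
  move=> k; case: asboolP => [/Kv[q -> qv]|_]; last exact: out_opensT.
  exact: out_opens_setC.
apply/seteqP; split => Y [gY h]; split => //.
  move=> k _; case: asboolP => // Kk; have [q kq qv] := Kv k Kk; rewrite kq => qY.
  by apply: h; apply: (KU k q).
move=> UY; have [k [q Kk [kq qY]]] := Kc Y UY gY.
by have := h k I; case: asboolP => // _; rewrite kq.
Qed.

Definition rat_sphere (p : 'rV[rat]_d * rat) : set 'rV[R]_d :=
  [set x | enorm (x - map_mx ratr p.1) = ratr p.2].

Lemma compact_rat_sphere p : compact (rat_sphere p).
Proof.
apply: (@compact_closed_norm_le _ _ _ (ratr p.2 + `|map_mx ratr p.1 : 'rV[R]_d|)).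
  apply: (@closed_comp _ _ (fun x : 'rV[R]_d => enorm (x - _)) [set r | r = ratr p.2]); last exact: closed_eq.
  by move=> x _; exact: continuous_enorm.
move=> x xp; have h : `|x - map_mx ratr p.1| <= ratr p.2 by rewrite -xp norm_le_enorm.
by rewrite -(subrK (map_mx ratr p.1) x) (le_trans (ler_normD _ _))// lerD2r.
Qed.

Lemma measurable_generic : measurable generic.
Proof.
have [L [cL LF Lnd KL]] := exhaustion F_lc.
pose N (p : 'rV[rat]_d * rat) := [set Y : config (~` D) | (cnt (points Y `&` (rat_sphere p `&` ~` D)) <= 0)%N].
have mK K : compact K -> K `<=` ~` D ->
    measurable [set Y : config (~` D) | (cnt (points Y `&` K) <= 0)%N].
  move=> cK KD; have := measurable_cnt_compact F_lc cK KD measurableT (Y := [set n | (n <= 0)%N]) I.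
  by rewrite setTI.
have cS p : compact (rat_sphere p `&` ~` D).
  by apply: compact_setI_closed; [exact: compact_rat_sphere|exact: open_closedC].
have -> : generic = ~` (\bigcap_i [set Y : config (~` D) | (cnt (points Y `&` L i) <= 0)%N]) `&`
    \bigcap_k (if (choice.unpickle k : option ('rV[rat]_d * rat)) is Some p then N p else setT).
  apply/seteqP; split => Y.
    move=> [[y Yy] h]; split.
      move=> h0; have [| |i yL] := KL [set y]; first exact: compact_set1.
        by move=> _ ->; exact: points_sub Yy.
      have := h0 i I; rewrite /= leqNgt => /negP; apply; apply/cnt_gt0.
        exact: points_lf.
      by exists y; split => //; exact: yL.
    move=> k _; case: choice.unpickle => [p|]//; rewrite /N /= leqNgt; apply/negP.
    move/cnt_gt0 => []; first exact: points_lf.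
    by move=> z [Yz [zp _]]; have /eqP := h z Yz p.1 p.2.
  move=> [h0 h]; split.
    apply: contrapT => Y0; apply: h0 => i _ /=; rewrite leqNgt; apply/negP.
    move/cnt_gt0 => []; first exact: points_lf.
    by move=> y [Yy _]; apply: Y0; exists y.
  move=> y Yy c r; apply/eqP => yr; have := h (choice.pickle (c, r)) I.
  rewrite choice.pickleK /N /= leqNgt => /negP; apply; apply/cnt_gt0; first exact: points_lf.
  by exists y; split => //; split => //; exact: points_sub Yy.
apply: measurableI.
  by apply: measurableC; apply: bigcapT_measurable => i; exact: mK.
apply: bigcapT_measurable => k; case: choice.unpickle => [p|]//.
by apply: mK.
Qed.

(** Test sets live in annuli and do not see a neighbourhood of the origin, whereas
    a vaguely open set may depend on the points there. *)
Definition away (a : rat) : set (config (~` D)) :=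
  [set Z | forall z, points Z z -> ratr a <= enorm z].

Lemma measurable_away a : measurable (away a).
Proof.
have fin (Y : config (~` D)) := finite_ball Y 0 a.
have := measurable_cnt F_lc (borel_open (@open_eball R d (map_mx ratr 0) (ratr a))) fin
  measurableT (Y := [set 0%N]) I.
rewrite setTI; congr measurable; apply/seteqP; split => Y /=.
  move=> c0 z Yz; rewrite leNgt; apply/negP => za.
  have : (0 < cnt (points Y `&` @rat_ball R d 0 a))%N.
    by apply/cnt_gt0 => //; exists z; split => //; rewrite /rat_ball /eball /= map_mx0 subr0.
  by rewrite /rat_ball c0.
move=> h; apply/eqP; rewrite -leqn0 leqNgt; apply/negP => /cnt_gt0 [//|z [Yz]].
by rewrite /eball /= map_mx0 subr0 ltNge h.
Qed.

Lemma generic_away Y : generic Y -> exists2 a, 0 < a & away a Y.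
Proof.
move=> gY; have fA := finite_ann Y 0 1 setT.
have [v [vi vE]] := cnt_enum fA.
have [n _ hn] : \forall n \near \oo, forall i, n.+1%:R^-1 < enorm (v i).
  apply: filter_forall => i.
  have [Yv _] : (points Y `&` (ann 0 1 `&` setT)) (v i) by rewrite -vE; exists i.
  have v0 : 0 < enorm (v i).
    have := generic_enorm 0 gY Yv; rewrite raddf0 => h.
    by rewrite lt_neqAle eq_sym h sqrtr_ge0.
  exact: near_infty_natSinv_lt (PosNum v0).
exists (n.+1%:R^-1); first by rewrite invr_gt0.
move=> y Yy; have -> : ratr (n.+1%:R^-1) = n.+1%:R^-1 :> R by rewrite fmorphV/= ratr_nat.
rewrite leNgt; apply/negP => yn.
have [i _ iy] : range v y.
  rewrite vE; split => //; split => //; rewrite /annulus /= raddf0 rmorph1 sqrtr_ge0/=.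
  by rewrite ltW// (lt_le_trans yn)// invf_le1// ler1n.
by have := hn n (leqnn _) i; rewrite iy ltNge (ltW yn).
Qed.

Context (mu : {measure set (config (~` D)) -> \bar R}).
Hypotheses (mu_fin : (mu setT < +oo)%E) (mu_generic : mu (~` generic) = 0%E).

Let out_opens_measurable U : out_opens U -> measurable U. Proof. by case. Qed.

Local Notation reg := (regular mu generic out_opens).

Let reg_opens U : out_opens U -> reg U.
Proof.
exact: (regular_opens mu_fin measurable_generic mu_generic out_opens_measurable out_opensI out_opensC).
Qed.

Let reg_bigcup (U_ : nat -> set (config (~` D))) : (forall n, reg (U_ n)) -> reg (\bigcup_n U_ n).
Proof.
exact: (regular_bigcup mu_fin out_opens_measurable out_opensI out_opens_bigcup).
Qed.

Let reg_bigcap (U_ : nat -> set (config (~` D))) : (forall n, reg (U_ n)) -> reg (\bigcap_n U_ n).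
Proof.
exact: (regular_bigcap mu_fin out_opens_measurable out_opensI out_opens_bigcup).
Qed.

Let regI U V : reg U -> reg V -> reg (U `&` V).
Proof.
exact: (regularI mu_fin measurable_generic mu_generic out_opens_measurable
  out_opensT out_opensI out_opens_bigcup out_opensC).
Qed.

Let reg_eq U V : measurable V -> generic `&` U = generic `&` V -> reg U -> reg V.
Proof. exact: (regular_eq measurable_generic mu_generic out_opens_measurable). Qed.

(** No point within [a] of the origin means no point in any of countably many
    annuli, since generic configurations have no point at the origin. *)
Lemma regular_away a : 0 < a -> reg (away a).
Proof.
move=> a0; pose T n := [set Z : config (~` D) | cnt (points Z `&` ann (a / n.+2%:R) a) = 0%N].
have T_open n : out_opens (T n).
  split.
    have bA : <<s @open 'rV[R]_d >> (ann (a / n.+2%:R) a).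
      by apply: borel_closed; apply: compact_closed; [exact: norm_hausdorff|exact: compact_ann].
    have fA (Y : config (~` D)) : finite_set (points Y `&` ann (a / n.+2%:R) a).
      by apply: points_lf; exact: compact_ann.
    have := measurable_cnt F_lc bA fA measurableT (Y := [set 0%N]) I.
    by rewrite setTI.
  move=> Y TY gY; have [||q [qv qY qZ]] := @out_refine unit (fun=> ann (a / n.+2%:R) a) Y gY.
  - by move=> _ y Yy; exact: generic_ann gY Yy.
  - by move=> _; exists (a / n.+2%:R, a); split; [rewrite divr_gt0|exact: subIsetl].
  - by exists q; split => // Z /qZ /(_ tt) h _; rewrite /T /= h.
apply: (@reg_eq (\bigcap_n T n)); first exact: measurable_away.
  apply/seteqP; split => Y [gY h]; split => //.
    move=> y Yy; rewrite leNgt; apply/negP => ya.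
    have y0 : 0 < enorm y.
      have := generic_enorm 0 gY Yy; rewrite raddf0 => yn.
      by rewrite lt_neqAle eq_sym yn sqrtr_ge0.
    have ya0 : 0 < enorm y / ratr a by rewrite divr_gt0// ltr0q.
    have [n _ /(_ n (leqnn _)) /= hn] := near_infty_natSinv_lt (PosNum ya0).
    have := h n I; rewrite /T /= => c0.
    have : (0 < cnt (points Y `&` ann (a / n.+2%:R) a))%N.
      apply/cnt_gt0; first by apply: points_lf; exact: compact_ann.
      exists y; split => //; apply/andP; split; last exact: ltW.
      rewrite fmorph_div/= ratr_nat mulrC -ler_pdivlMr ?ltr0q//.
      by apply: le_trans (ltW hn); rewrite lef_pV2 ?posrE// ler_nat.
    by rewrite c0.
  move=> n _; rewrite /T /=; apply/eqP; rewrite -leqn0 leqNgt; apply/negP => /cnt_gt0[].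
    by apply: points_lf; exact: compact_ann.
  move=> y [Yy /andP[_ ya]]; have := h y Yy => ay.
  by have := generic_enorm a gY Yy; rewrite eq_le ya ay.
by apply: reg_bigcap => n; exact: reg_opens.
Qed.

Let W (p : seq par * seq rat) : set (config (~` D)) :=
  (\bigcap_(q in [set` p.1]) out_set q) `&` (\bigcap_(a in [set` p.2]) away a).

(** Near a generic configuration, a statistic only depends on the points in an
    annulus as long as no point comes closer to the origin: the test sets and
    the sets [away a] together form a base of the vague topology there. *)
Lemma regular_open (A : set (config (~` D))) : open A -> reg A.
Proof.
move=> oA.
have regT : reg setT by apply: reg_opens; exact: out_opensT.
pose ok (p : seq par * seq rat) := [/\ forall q, q \in p.1 -> out_valid q,
   forall a, a \in p.2 -> 0 < a & W p `<=` A].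
pose V k := if (choice.unpickle k : option (seq par * seq rat)) is Some p then
   (if `[< ok p >] then W p else set0) else set0.
have reg0 : reg set0 by rewrite -setCT; exact: regularC.
have regV k : reg (V k).
  rewrite /V; case: choice.unpickle => [p|]//; case: asboolP => // -[h1 h2 _].
  apply: regI.
    rewrite bigcap_seq; elim: (p.1) h1 => [|q s ih] h; first by rewrite big_nil.
    rewrite big_cons; apply: regI; first by apply: reg_opens; apply: out_opens_set; apply: h; exact: mem_head.
    by apply: ih => q' q's; apply: h; rewrite inE q's orbT.
  rewrite bigcap_seq; elim: (p.2) h2 => [|q s ih] h; first by rewrite big_nil.
  rewrite big_cons; apply: regI; first by apply: regular_away; apply: h; exact: mem_head.
  by apply: ih => q' q's; apply: h; rewrite inE q's orbT.
apply: (@reg_eq (\bigcup_k V k)); [exact: measurable_open_config| |exact: reg_bigcup].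
apply/seteqP; split => Y [gY AY]; split => //.
  by case: AY => k _; rewrite /V; case: choice.unpickle => [p|]//; case: asboolP => // -[_ _ WA] /WA.
pose G := filter_from [set p : seq par * seq rat | [/\ forall q, q \in p.1 -> out_valid q,
   forall a, a \in p.2 -> 0 < a & W p Y]] W.
suff GY : G --> Y.
  have [p [pv pa pY] pA] : G A by apply: GY; exact: open_nbhs_nbhs.
  exists (choice.pickle p) => //; rewrite /V choice.pickleK; case: asboolP => // h.
  by exfalso; apply: h.
have FG : Filter G.
  apply: filter_from_filter; first by exists ([::], [::]).
  move=> p p' [v1 a1 Y1] [v2 a2 Y2]; exists (p.1 ++ p'.1, p.2 ++ p'.2).
    split => /=.
    - by move=> q; rewrite mem_cat => /orP[/v1|/v2].
    - by move=> q; rewrite mem_cat => /orP[/a1|/a2].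
    - split => q /=; rewrite mem_cat => /orP[] h.
      + exact: Y1.1. + exact: Y2.1. + exact: Y1.2. + exact: Y2.2.
  by move=> Z [/= Z1 Z2]; split; split => q /= h;
    (apply: Z1 || apply: Z2); rewrite /= mem_cat h ?orbT.
apply: cvg_config => f e e0.
have [_ [K [cK KF f0]]] := svalP f.
have [M [M0 KM]] := compact_norm_lt cK.
have [a a0 aY] := generic_away gY.
have [y0 Yy0] := gY.1.
have [b] := @rat_in_itvoo R ((d.+1)%:R * M + enorm y0) ((d.+1)%:R * M + enorm y0 + 1) (ltr_pwDr ltr01 (lexx _)).
rewrite in_itv /= => /andP[bM _].
have dM0 : 0 <= d.+1%:R * M by rewrite mulr_ge0// ltW.
have y0b : enorm y0 < ratr b by apply: le_lt_trans bM; rewrite lerDr.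
have y0n : 0 <= enorm y0 by exact: sqrtr_ge0.
(* The annulus [S] reaches beyond the support of [f] and contains [y0]. *)
pose S := ann a b `&` ~` D.
have fS : finite_set (points Y `&` S) by exact: finite_ann.
have f0' (Z : config (~` D)) : away a Z -> forall x, points Z x -> ~ S x -> sval f x = 0.
  move=> aZ x Zx nS; apply: f0; first exact: points_sub Zx.
  move=> Kx; apply: nS; split; last exact: points_sub Zx.
  apply/andP; split; first exact: aZ.
  apply: le_trans (ltW bM); rewrite (le_trans (enorm_le_norm _))//.
  by rewrite (@le_trans _ _ (d.+1%:R * M)) ?ler_wpM2l ?lerDl// ltW// KM.
have hN y : (points Y `&` S) y -> nbhs y (ann a b).
  move=> [Yy [yab _]]; have := decided_near (generic_ann a b gY Yy).
  by apply: filterS => x h; exact: (h.2 yab).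
have [c [s [s0 tB cY BN cZ]]] := local_approx fS (f0' Y aY) e0 hN.
pose q : par := (a, b,
  existT (fun n => {ffun 'I_n -> 'rV[rat]_d * rat}) (cnt (points Y `&` S)) [ffun i => (c i, s i)]).
have qB i : @out_ball q i = rat_ball (c i) (s i) by rewrite /out_ball /= ffunE.
have BS i : rat_ball (c i) (s i) `&` ~` D `<=` S.
  by move=> x [xB xD]; have [y _ h] := BN i; split => //; exact: h.
have cntB (Z : config (~` D)) i :
    points Z `&` S `&` rat_ball (c i) (s i) = points Z `&` rat_ball (c i) (s i).
  apply/seteqP; split => x; first by move=> [[Zx _]].
  move=> [Zx xB]; split => //; split => //; apply: (BS i); split => //; exact: points_sub Zx.
exists ([:: q], [:: a]).
  split => /=.
  - move=> _ /[!inE] /eqP ->; split.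
    + split; last by rewrite /= a0 -(ltr_rat R) (le_lt_trans (aY _ Yy0)).
      apply/cnt_gt0 => //; exists y0; split => //; split; last exact: points_sub Yy0.
      by apply/andP; split; [exact: aY|exact: ltW].
    + by move=> i /=; rewrite ffunE; exact: s0.
    + by move=> i j _ _; rewrite !qB; exact: tB.
    + by move=> i; rewrite qB; exact: BS.
  - by move=> _ /[!inE] /eqP ->.
  - split => _ /= /[!inE] /eqP -> //; split; first exact/cnt_eqP.
    by move=> i; rewrite qB; apply/cnt_eqP; [exact: finite_ball|rewrite -cntB].
move=> Z [/(_ q) /= qZ /(_ a) /= aZ].
have /card_II_cnt[fZ cZS] : points Z `&` S #= `I_(cnt (points Y `&` S)).
  by have [] := qZ _; rewrite ?inE.
apply: cZ => //; first by apply: f0'; apply: aZ; rewrite inE.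
move=> i; rewrite cntB; have [_ /(_ i)] := qZ (mem_head _ _); rewrite qB.
by move=> /card_II_cnt[].
Qed.

(** No configuration outside [D] has a point in a ball contained in [D]. *)
Lemma basic_out_set0 : D !=set0 -> @basic_out R d D set0.
Proof.
move=> [x Dx]; have [c [r [r0 _ cD]]] := rat_ball_nbhs (open_nbhs_nbhs (conj D_open Dx)).
exists 1%N, 1, 2, (fun=> c), (fun=> r); split => //.
- by move=> i j _ _ _; rewrite (ord1 i) (ord1 j).
- by move=> i y [/cD].
apply/seteqP; split => // Y [_ /(_ ord0)/card_II_cnt[fY cY]].
have : (0 < cnt (points Y `&` rat_ball c r))%N by rewrite cY.
by move/cnt_gt0 => [//|y [/points_sub Dy /cD]].
Qed.

(** Outer regularity replaces [U] by a countable union of test sets, and a finite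
    part of the union has almost the same measure. *)
Lemma out_approx U e : D !=set0 -> measurable U -> 0 < e ->
  exists B, [/\ @B_out R d D B, (mu (U `\` B) <= e%:E)%E & (mu (B `\` U) <= e%:E)%E].
Proof.
move=> D0 mU e0.
have [_ /(_ e e0)[A [oA UA Ae]] _] : reg U.
  have regO : @open (config (~` D)) `<=` reg by move=> B oB; exact: regular_open.
  exact: (@regular_sigma _ _ _ mu generic out_opens mu_fin measurable_generic mu_generic
    out_opens_measurable out_opensT out_opensI out_opens_bigcup out_opensC (@open (config (~` D))) regO U mU).
have mA : measurable A by case: oA.
have [K [Kv KA Kc]] := out_opens_cover oA.
pose E k := if `[< K k >] then
   (if (choice.unpickle k : option par) is Some q then out_set q else set0) else set0.
have E_basic k : @basic_out R d D (E k).
  rewrite /E; case: asboolP => [/Kv[q -> qv]|_]; last exact: basic_out_set0.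
  by apply/basic_outP; exists q.
have mE k : measurable (E k).
  by have /basic_outP[q _ ->] := E_basic k; exact: measurable_out_set.
have EA k : E k `&` generic `<=` A.
  rewrite /E; case: asboolP => [Kk|_]; last by rewrite set0I.
  by have [q kq qv] := Kv k Kk; rewrite kq; exact: KA kq.
have AE : A `&` generic `<=` \bigcup_k E k.
  move=> Y [AY gY]; have [k [q Kk [kq qY]]] := Kc Y AY gY; exists k => //.
  by rewrite /E; case: asboolP => // _; rewrite kq.
pose B n := \bigcup_(i in [set: 'I_n.+1]) E i.
have mB n : measurable (B n).
  by apply: fin_bigcup_measurable => [|i _]; [exact: finite_finset|exact: mE].
have mG := measurable_generic.
have cvgB : mu (A `\` B n) @[n --> \oo] --> 0%E.
  have -> : 0%E = mu (\bigcap_n (A `\` B n)) :> \bar R.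
    apply/esym/eqP; rewrite eq_le measure_ge0 andbT -mu_generic; apply: le_measure; rewrite ?inE.
    - by apply: bigcapT_measurable => n; exact: measurableD.
    - exact: measurableC.
    - move=> Y h gY; have [AY _] := h 0%N I.
      have [k _ Ek] := AE Y (conj AY gY); have [_] := h k I; apply.
      by exists ord_max.
  apply: nonincreasing_cvg_mu.
  - by apply: le_lt_trans mu_fin; apply: le_measure; rewrite ?inE//; exact: measurableD.
  - by move=> n; exact: measurableD.
  - by apply: bigcapT_measurable => n; exact: measurableD.
  - apply/nonincreasing_seqP => n; apply/subsetPset; apply: setDS => Y [i _ Ei].
    by exists (widen_ord (leqnSn _) i).
have [n _ /(_ n (leqnn _)) hn] := cvge0_near cvgB e0.
exists (B n); split.
- by exists n, (fun i : 'I_n.+1 => E i); split => // i; exact: E_basic.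
- apply: le_trans hn; apply: (@le_trans _ _ (mu ((A `\` B n) `|` ~` generic))).
    apply: le_measure; rewrite ?inE; [exact: measurableD| |].
      by apply: measurableU; [exact: measurableD|exact: measurableC].
    move=> Y [UY nB]; have [gY|] := pselect (generic Y); last by right.
    by left; split => //; exact: UA.
  apply: (le_trans (measureU2 _ _ _)); [exact: measurableD|exact: measurableC|].
  by rewrite [X in (_ + X)%E](_ : _ = 0%E) ?adde0.
- apply: le_trans Ae; apply: (@le_trans _ _ (mu ((A `\` U) `|` ~` generic))).
    apply: le_measure; rewrite ?inE; [exact: measurableD| |].
      by apply: measurableU; [exact: measurableD|exact: measurableC].
    move=> Y [[i _ Ei] nU]; have [gY|] := pselect (generic Y); last by right.
    by left; split => //; apply: (EA i).
  apply: (le_trans (measureU2 _ _ _)); [exact: measurableD|exact: measurableC|].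
  by rewrite [X in (_ + X)%E](_ : _ = 0%E) ?adde0.
Qed.

End Outside.

(** * Perturbation of events *)

Section Approximation.
Context {dO : measure_display} {Omega : measurableType dO} {R : realType}.
Context (P : probability Omega R).
Implicit Types (E F A : set Omega) (f : Omega -> \bar R).

(** The probabilities are dominated by those of the decreasing unions of all later
    events, whose intersection is null. *)
Lemma measure_near0 (G : nat -> set Omega) e : (forall k, measurable (G k)) ->
  {ae P, forall w, \forall k \near \oo, ~ G k w} -> 0 < e ->
  \forall k \near \oo, (P (G k) <= e%:E)%E.
Proof.
move=> mG [N [mN N0 GN]] e0.
pose H n := \bigcup_(k in [set k | (n <= k)%N]) G k.
have mH n : measurable (H n) by apply: bigcup_measurable => k _; exact: mG.
have mI : measurable (\bigcap_n H n) by exact: bigcapT_measurable.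
have cvgH : (P \o H) n @[n --> \oo] --> 0%E.
  have -> : 0%E = P (\bigcap_n H n).
    apply/esym/(subset_measure0 mI mN) => // w hw; apply: GN => -[n _ nG].
    by have [k /nG] := hw n I.
  apply: nonincreasing_cvg_mu => //.
    by apply: le_lt_trans (probability_le1 P (mH _)) _; exact: ltry.
  apply/nonincreasing_seqP => n; apply/subsetPset => w [k /= nk Gk]; exists k => //=.
  exact: ltnW.
apply: filterS (cvge0_near cvgH e0) => k; apply: le_trans.
by apply: le_measure; rewrite ?inE// => w Gw; exists k => /=.
Qed.

Lemma measure_le_setD E F : measurable E -> measurable F -> (P E <= P F + P (E `\` F))%E.
Proof.
move=> mE mF; have mD : measurable (E `\` F) by exact: measurableD.
apply: le_trans (measureU2 P mF mD); apply: le_measure; rewrite ?inE//.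
  exact: measurableU.
by move=> w Ew; have [Fw|nF] := pselect (F w); [left|right].
Qed.

Lemma integral_le_setD f E F : measurable E -> measurable F -> measurable_fun setT f ->
  (forall w, 0 <= f w <= 1)%E ->
  (\int[P]_(w in E) f w <= \int[P]_(w in F) f w + P (E `\` F))%E.
Proof.
move=> mE mF mf f01; have mD : measurable (E `\` F) by exact: measurableD.
have f0 w : (0 <= f w)%E by have /andP[] := f01 w.
apply: (@le_trans _ _ (\int[P]_(w in F `|` (E `\` F)) f w)%E).
  apply: ge0_subset_integral => //; first exact: measurableU.
    exact: measurable_funTS.
  by move=> w Ew; have [Fw|nF] := pselect (F w); [left|right].
rewrite ge0_integral_setU//; last 2 first.
- exact: measurable_funTS.
- by apply/disj_setPS => w [Fw []].
apply: leeD2l; rewrite -[leRHS]mul1e -integral_cst//; apply: ge0_le_integral => //.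
  exact: measurable_funTS.
by move=> w _; have /andP[] := f01 w.
Qed.

Lemma measure_le_setI E E' F F' (e : R) : measurable E -> measurable E' ->
  measurable F -> measurable F' -> (P (E `\` E') <= e%:E)%E -> (P (F `\` F') <= e%:E)%E ->
  (P (E `&` F) <= P (E' `&` F') + (e%:E + e%:E))%E.
Proof.
move=> mE mE' mF mF' lE lF.
apply: le_trans (measure_le_setD (measurableI _ _ mE mF) (measurableI _ _ mE' mF')) _.
apply: leeD2l; apply: le_trans (leeD lE lF).
have mD1 := measurableD mE mE'; have mD2 := measurableD mF mF'.
apply: le_trans (measureU2 P mD1 mD2); apply: le_measure; rewrite ?inE.
- by apply: measurableD; exact: measurableI.
- exact: measurableU.
- move=> w [[Ew Fw] n]; have [E'w|] := pselect (E' w); last by left.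
  by right; split => // F'w; exact: n.
Qed.

(** Exchanging [E'] for [E], or [A'] for [A], costs at most the probability of
    their difference, in the integral because [f] is bounded by [1]. *)
Lemma sandwich_limit f A E (c C : R) : measurable A -> measurable E ->
  measurable_fun setT f -> (forall w, 0 <= f w <= 1)%E -> 0 < c <= C ->
  (forall e : R, 0 < e -> exists A' E' (t : R),
    [/\ measurable A', measurable E',
        [/\ (P (A `\` A') <= e%:E)%E, (P (A' `\` A) <= e%:E)%E,
            (P (E `\` E') <= e%:E)%E & (P (E' `\` E) <= e%:E)%E],
        `|t| <= e &
        (c%:E * (\int[P]_(w in E') f w + t%:E) <= P (A' `&` E') /\
         P (A' `&` E') <= C%:E * (\int[P]_(w in E') f w + t%:E))%E]) ->
  (c%:E * \int[P]_(w in E) f w <= P (A `&` E) /\ P (A `&` E) <= C%:E * \int[P]_(w in E) f w)%E.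
Proof.
move=> mA mE mf f01 /andP[c0 cC] h.
have C0 : 0 < C by exact: lt_le_trans cC.
have intE F : measurable F -> exists r : R, (\int[P]_(w in F) f w)%E = r%:E.
  move=> mF; exists (fine (\int[P]_(w in F) f w)); rewrite fineK// ge0_fin_numE.
    apply: (@le_lt_trans _ _ (\int[P]_(w in F) (cst 1%E w))%E); last first.
      by rewrite integral_cst// mul1e (le_lt_trans (probability_le1 P mF))// ltry.
    apply: ge0_le_integral => //; [by move=> w _; have /andP[] := f01 w| |].
      exact: measurable_funTS.
    by move=> w _; have /andP[] := f01 w.
  by apply: integral_ge0 => w _; have /andP[] := f01 w.
have PE F : measurable F -> exists r : R, P F = r%:E.
  by move=> mF; exists (fine (P F)); rewrite fineK// fin_num_measure.
have [r rE] := intE E mE; have [p pE] := PE _ (measurableI _ _ mA mE).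
have key (e : R) : 0 < e -> c * r <= p + (2 + 2 * c) * e /\ p <= C * r + (2 + 2 * C) * e.
  move=> e0; have [A' [E' [t [mA' mE' [A1 A2 E1 E2] te hb]]]] := h e e0.
  have [r' r'E] := intE E' mE'; have [p' p'E] := PE _ (measurableI _ _ mA' mE').
  have r1 : r <= r' + e.
    rewrite -lee_fin EFinD -rE -r'E; apply: le_trans (integral_le_setD mE mE' mf f01) _.
    exact: leeD2l.
  have r2 : r' <= r + e.
    rewrite -lee_fin EFinD -rE -r'E; apply: le_trans (integral_le_setD mE' mE mf f01) _.
    exact: leeD2l.
  have p1 : p <= p' + (e + e) by rewrite -lee_fin EFinD -pE -p'E EFinD; exact: measure_le_setI.
  have p2 : p' <= p + (e + e) by rewrite -lee_fin EFinD -pE -p'E EFinD; exact: measure_le_setI.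
  move: hb; rewrite r'E p'E -EFinD -!EFinM !lee_fin => -[b1 b2].
  move: te; rewrite ler_norml => /andP[t1 t2].
  have c1 : c * r <= c * (r' + t + 2 * e) by apply: ler_wpM2l; [exact: ltW|lra].
  have C1 : C * (r' + t) <= C * (r + 2 * e) by apply: ler_wpM2l; [exact: ltW|lra].
  split; lra.
rewrite rE pE -!EFinM !lee_fin; split; apply/ler_addgt0Pr => e e0.
  have h0 : 0 < 2 + 2 * c by lra.
  have [+ _] := key (e / (2 + 2 * c)) (divr_gt0 e0 h0).
  by rewrite mulrC [(2 + 2 * c) * _]mulrC divfK ?gt_eqF// mulrC.
have h0 : 0 < 2 + 2 * C by lra.
have [_] := key (e / (2 + 2 * C)) (divr_gt0 e0 h0).
by rewrite [(2 + 2 * C) * _]mulrC divfK ?gt_eqF.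
Qed.

End Approximation.

(** The set where [g] exceeds [f] by [1 / n.+1] has to be null, because the integral
    of [f] over it is finite. *)
Lemma ae_le_integral d (T : measurableType d) (R : realType) (mu : {measure set T -> \bar R})
    (S : set T) (f g : T -> \bar R) :
  measurable S -> measurable_fun setT f -> measurable_fun setT g ->
  (forall x, 0 <= f x)%E -> (forall x, 0 <= g x)%E ->
  (forall U, measurable U -> U `<=` S ->
    (\int[mu]_(x in U) f x < +oo)%E /\ (\int[mu]_(x in U) g x <= \int[mu]_(x in U) f x)%E) ->
  {ae mu, forall x, S x -> (g x <= f x)%E}.
Proof.
move=> mS mf mg f0 g0 h.
pose V n := S `&` [set x | (f x + n.+1%:R^-1%:E <= g x)%E].
have mV n : measurable (V n).
  apply: measurable_lee => //; last exact: measurable_funTS.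
  by apply: emeasurable_funD; [exact: measurable_funTS|exact: measurable_cst].
have V0 n : mu (V n) = 0%E.
  have [fin le] := h (V n) (mV n) (@subIsetl _ _ _).
  have : (\int[mu]_(x in V n) (f x + n.+1%:R^-1%:E) <= \int[mu]_(x in V n) f x)%E.
    apply: le_trans le; apply: ge0_le_integral => //.
    - by move=> x _; rewrite adde_ge0// lee_fin.
    - by apply: emeasurable_funD; [exact: measurable_funTS|exact: measurable_cst].
    - exact: measurable_funTS.
    - by move=> x [].
  have n0 : (0 <= n.+1%:R^-1%:E :> \bar R)%E by rewrite lee_fin.
  rewrite ge0_integralD//; last exact: measurable_funTS.
  rewrite integral_cst// -[leRHS]adde0 leeD2lE; last first.
    by rewrite ge0_fin_numE//; apply: integral_ge0.
  rewrite pmule_rle0 ?lte_fin ?invr_gt0// => le0.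
  by apply/eqP; rewrite eq_le le0 measure_ge0.
have nV : mu.-negligible (\bigcup_n V n).
  by apply: (@negligible_bigcup _ _ _ mu V) => n; exists (V n); split.
apply: negligibleS nV => x /= /not_implyP[Sx]; move/negP; rewrite -ltNge => fg.
have : exists r : R, f x = r%:E.
  by exists (fine (f x)); rewrite fineK// ge0_fin_numE// (lt_le_trans fg)// leey.
move=> [r fr]; rewrite fr in fg.
case gx : (g x) (g0 x) fg => [s| |]// _; last first.
  by exists 0%N => //; split => //=; rewrite fr gx -EFinD leey.
rewrite lte_fin -subr_gt0 => rs.
have [n _ /(_ n (leqnn _)) /= hn] := near_infty_natSinv_lt (PosNum rs).
by exists n => //; split => //=; rewrite fr gx -EFinD lee_fin -lerBrDl ltW.
Qed.

(** * Almost sure continuity of the test sets *)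

Section Typical.
Context {R : realType} {d : nat} (D : set 'rV[R]_d).
Hypothesis D_bounded : bounded_set D.
Local Notation Conf := (config [set: 'rV[R]_d]).

(** The limit configurations at which membership in all the test sets inside
    and outside [D] is locally constant. *)
Definition typical (Z : Conf) : Prop := forall y, points Z y ->
  decided D y /\ forall (c : 'rV[rat]_d) (r : rat), enorm (y - map_mx ratr c) != ratr r.

Lemma typical_generic Z : typical Z -> points (restr (~` D) Z) !=set0 -> generic (restr (~` D) Z).
Proof. by move=> tZ Z0; split => // y [Zy _]; exact: (tZ y Zy).2. Qed.

Lemma decided_interior_closure (S : set 'rV[R]_d) y :
  ~ (closure S `\` interior S) y -> decided S y.
Proof.
move=> h; have [Sy|nSy] := pselect (interior S y); first by left.
right; have ncy : ~ closure S y by move=> cS; apply: h.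
have : open (~` closure S) by apply: closed_openC; exact: closed_closure.
by move=> oc; have := open_nbhs_nbhs (conj oc ncy); apply: filterS => z;
  apply: contra_not; exact: subset_closure.
Qed.

Lemma near_card (Zn : nat -> Conf) (Z : Conf) S : Zn n @[n --> \oo] --> Z -> bounded_set S ->
  (forall y, points Z y -> decided S y) ->
  \forall n \near \oo, forall m, (Zn n `&` S #= `I_m) <-> (Z `&` S #= `I_m).
Proof.
move=> cZ bS dS; apply: filterS (cnt_cvg cZ bS dS) => n h m.
have fin (Y : Conf) : finite_set (points Y `&` S) by exact: finite_bounded.
by rewrite !(cnt_eqP _ (fin _)) h.
Qed.

Lemma near_unions T (G : set (set T)) (Zn : nat -> T) (Z : T) :
  (forall A, G A -> \forall n \near \oo, A (Zn n) <-> A Z) ->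
  forall A, finite_unions G A -> \forall n \near \oo, A (Zn n) <-> A Z.
Proof.
move=> hG _ [N [E [GE ->]]].
have h : \forall n \near \oo, forall i, E i (Zn n) <-> E i Z.
  by apply: (@filter_forall _ _ (fun i n => E i (Zn n) <-> E i Z)) => i; exact: hG.
by apply: filterS h => n h; split => -[i _ /h Ei]; exists i.
Qed.

Context (Zn : nat -> Conf) (Z : Conf) (Z_cvg : Zn n @[n --> \oo] --> Z) (Z_typical : typical Z).

(** Membership in a test set depends on finitely many counts in bounded sets, and
    a typical limit has no point on their boundaries. *)
Lemma near_in m A : @A_in R d D m A ->
  \forall n \near \oo, A (restr D (Zn n)) <-> A (restr D Z).
Proof.
apply: (near_unions (Zn := fun n => restr D (Zn n))) => {}A [c [r [_ _ _ ->]]].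
have dD y : points Z y -> decided D y by move=> Zy; exact: (Z_typical Zy).1.
have h1 := near_card Z_cvg D_bounded dD.
have h2 : \forall n \near \oo, forall i, forall m,
    (Zn n `&` (D `&` rat_ball (c i) (r i)) #= `I_m) <-> (Z `&` (D `&` rat_ball (c i) (r i)) #= `I_m).
  apply: (@filter_forall _ _ (fun i n => forall m,
    (Zn n `&` (D `&` rat_ball (c i) (r i)) #= `I_m) <-> (Z `&` (D `&` rat_ball (c i) (r i)) #= `I_m))) => i.
  apply: near_card => //; first by apply: bounded_subset D_bounded; exact: subIsetl.
  move=> y Zy; apply: decidedI; [exact: dD|].
  by apply: decided_eball; exact: (Z_typical Zy).2.
apply: filterS2 h1 h2 => n h1 h2 /=.
by split => -[/h1 c1 c2]; split => // i; have := c2 i; rewrite -!setIA => /h2.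
Qed.

Lemma near_out B : @B_out R d D B ->
  \forall n \near \oo, B (restr (~` D) (Zn n)) <-> B (restr (~` D) Z).
Proof.
apply: (near_unions (Zn := fun n => restr (~` D) (Zn n))) => {}B [m [r1 [r2 [c [r [_ _ _ _ ->]]]]]].
have dD y : points Z y -> decided (~` D) y by move=> Zy; apply: decidedC; exact: (Z_typical Zy).1.
have dS y q : points Z y -> enorm y != ratr q.
  by move=> Zy; have := (Z_typical Zy).2 0 q; rewrite map_mx0 subr0.
have h1 : \forall n \near \oo, forall m,
   (Zn n `&` (~` D `&` (annulus (ratr r1) (ratr r2) `&` ~` D)) #= `I_m) <->
   (Z `&` (~` D `&` (annulus (ratr r1) (ratr r2) `&` ~` D)) #= `I_m).
  apply: near_card => //.
    apply: (bounded_subset _ (compact_bounded (@compact_ann R d r1 r2))).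
    by move=> x [_ []].
  move=> y Zy; apply: decidedI; [exact: dD|apply: decidedI; [|exact: dD]].
  by apply: decided_annulus; exact: dS.
have h2 : \forall n \near \oo, forall i, forall m,
    (Zn n `&` (~` D `&` rat_ball (c i) (r i)) #= `I_m) <-> (Z `&` (~` D `&` rat_ball (c i) (r i)) #= `I_m).
  apply: (@filter_forall _ _ (fun i n => forall m,
    (Zn n `&` (~` D `&` rat_ball (c i) (r i)) #= `I_m) <-> (Z `&` (~` D `&` rat_ball (c i) (r i)) #= `I_m))) => i.
  apply: near_card => //; first by apply: bounded_subset (bounded_ball (c i) (r i)); exact: subIsetr.
  move=> y Zy; apply: decidedI; [exact: dD|].
  by apply: decided_eball; exact: (Z_typical Zy).2.
apply: filterS2 h1 h2 => n h1 h2 /=.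
by split => -[c1 c2]; split;
  [|move=> i; have := c2 i; rewrite -!setIA => /h2| |move=> i; have := c2 i; rewrite -!setIA => /h2];
  move: c1; rewrite -!setIA => /h1.
Qed.

End Typical.

Section AlmostSure.
Context {R : realType} {d : nat} {dO : measure_display} {Omega : measurableType dO}.
Context (P : probability Omega R) (X : Omega -> config [set: 'rV[R]_d]).
Hypotheses (mX : measurable_fun setT X) (X_ac : intensity_ac P X).

(** The expected number of points in [K] is zero. *)
Lemma ae_avoid K : compact K -> lebesgue_outer K = 0%E ->
  {ae P, forall w, points (X w) `&` K = set0}.
Proof.
move=> cK K0; have fin w : finite_set (points (X w) `&` K) by exact: points_lf.
have bK : <<s @open 'rV[R]_d >> K.
  by apply: borel_closed; apply: compact_closed => //; exact: norm_hausdorff.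
have mc : measurable_fun setT (fun w => (cnt (points (X w) `&` K))%:R%:E : \bar R).
  have mn : measurable_fun setT (fun n : nat => n%:R%:E : \bar R) by [].
  have lT : locally_closed [set: 'rV[R]_d] by apply: open_locally_closed; exact: openT.
  exact: (measurableT_comp mn (measurableT_comp (measurable_cnt_compact lT cK (@subsetT _ _)) mX)).
have /(ae_eq_integral_abs P measurableT mc) h :
    (\int[P]_w `|(cnt (points (X w) `&` K))%:R%:E|)%E = 0%E.
  rewrite -[RHS](X_ac bK K0); apply: eq_integral => w _.
  by rewrite /counting asboolT// gee0_abs// lee_fin.
apply: filterS h => w /(_ I) [] /eqP; rewrite pnatr_eq0 => /eqP c0.
apply/eqP; apply: contrapT => /negP/set0P /(cnt_gt0 (fin w)).
by rewrite c0.
Qed.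

Lemma ae_typical D : (0 < d)%N -> bounded_set D -> null_boundary D ->
  {ae P, forall w, typical D (X w)}.
Proof.
move=> d0 bD nD.
have cB : compact (closure D `\` interior D).
  apply: compact_setI_closed; first exact: compact_closure.
  by apply: open_closedC; exact: open_interior.
have h1 := ae_avoid cB nD.
have h2 : {ae P, forall w, forall k, if (choice.unpickle k : option ('rV[rat]_d * rat)) is Some p
    then points (X w) `&` rat_sphere p = set0 else True}.
  apply: ae_foralln => k; case: choice.unpickle => [p|]; last exact: aeW.
  by apply: ae_avoid; [exact: compact_rat_sphere|exact: sphere_null].
apply: filterS2 h1 h2 => w h1 h2 y Xy; split.
  apply: decided_interior_closure => By.
  by have : (points (X w) `&` (closure D `\` interior D)) y by []; rewrite h1.
move=> c r; apply/eqP => yr; have := h2 (choice.pickle (c, r)); rewrite choice.pickleK => h.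
by have : (points (X w) `&` rat_sphere (c, r)) y by []; rewrite h.
Qed.

End AlmostSure.

(** * From test sets to kernels *)

Section KernelBounds.
Context {R : realType} {d : nat} (D : set 'rV[R]_d).
Hypotheses (D_bounded : bounded_set D) (D_open : open D).
Let D_lc : locally_closed D := open_locally_closed D_open.
Context (Phi Psi : 'rV[R]_d -> \bar R) (Phi_pot : potential Phi) (Psi_pot : potential Psi).
Context (Q kappa : R.-pker (config (~` D)) ~> (config D)).
Local Notation W Y A := (gibbs_weight Phi Psi (Q Y) A).
Local Notation nu A Y := (gibbs_kernel Phi Psi Q A Y).

Let W_ge0 Y A : (0 <= W Y A)%E.
Proof. by apply: integral_ge0 => *; exact: expeR_ge0. Qed.

Let W_le Y A : measurable A -> (W Y A <= W Y setT)%E.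
Proof.
move=> mA; have [M ME] := gibbs_weight_measure D_bounded D_lc Phi_pot Psi_pot (Q Y).
by rewrite -!ME; apply: le_measure; rewrite ?inE.
Qed.

(** The conventions for division by zero and by infinity keep the kernel in the
    unit interval even where its normalization fails. *)
Lemma gibbs_kernel_bounded A Y : measurable A -> (0 <= nu A Y <= 1)%E.
Proof.
move=> mA; rewrite /gibbs_kernel mule_ge0 ?inve_ge0//=.
have le := W_le Y mA; have A0 := W_ge0 Y A.
case WT : (W Y setT) le (W_ge0 Y setT) => [r| |]// le; last by rewrite invey mule0.
rewrite lee_fin le_eqVlt => /orP[/eqP r0|r0].
  have -> : W Y A = 0%E by apply/eqP; rewrite eq_le A0 andbT; move: le; rewrite -r0.
  by rewrite mul0e.
by rewrite inver gt_eqF// lee_pdivrMr// mul1e.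
Qed.

Lemma measurable_gibbs_kernel A : measurable A -> measurable_fun setT (fun Y => nu A Y).
Proof.
move=> mA; apply: emeasurable_funM.
  exact: measurable_gibbs_weight.
apply: measurable_inve_ge0 => //; exact: measurable_gibbs_weight.
Qed.

Lemma gibbs_kernel_fin A Y : (0 < W Y setT < +oo)%E ->
  nu A Y = ((fine (W Y setT))^-1%:E * W Y A)%E.
Proof.
move=> /andP[T0 Ty]; rewrite /gibbs_kernel muleC; congr (_ * _)%E.
have Wf : (fine (W Y setT))%:E = W Y setT by rewrite fineK// ge0_fin_numE.
rewrite -{1}Wf inver gt_eqF//.
by rewrite -lte_fin Wf.
Qed.

(** Both measures live on configurations with [m] points, so that
    [le_measure_A_in] applies to [kappa Y] and to multiples of the Gibbs weight. *)
Lemma kernel_bounds_extend m Y (c C : R) : 0 < c <= C -> (0 < W Y setT < +oo)%E ->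
  Q Y (~` [set Z | points Z #= `I_m]) = 0%E -> kappa Y (~` [set Z | points Z #= `I_m]) = 0%E ->
  (forall A, A_in m A -> (c%:E * nu A Y <= kappa Y A /\ kappa Y A <= C%:E * nu A Y)%E) ->
  forall A, measurable A ->
    ((c / fine (W Y setT))%:E * W Y A <= kappa Y A /\
     kappa Y A <= (C / fine (W Y setT))%:E * W Y A)%E.
Proof.
move=> /andP[c0 cC] WT Q0 kappa0 h A mA; have C0 : 0 < C by exact: lt_le_trans cC.
have w0 : 0 < fine (W Y setT) by rewrite fine_gt0.
have [M ME] := gibbs_weight_measure D_bounded D_lc Phi_pot Psi_pot (Q Y).
have W0 : W Y (~` [set Z | points Z #= `I_m]) = 0%E.
  apply: gibbs_weight_null => //.
  by apply: measurableC; exact: measurable_points_card.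
have kT : (kappa Y setT < +oo)%E by rewrite prob_kernel ltry.
pose s (x : R) (x0 : 0 < x) := NngNum (ltW (divr_gt0 x0 w0)).
have sE x (x0 : 0 < x) B : mscale (s x x0) M B = ((x / fine (W Y setT))%:E * W Y B)%E.
  by rewrite /mscale /= ME.
rewrite -!(sE _ _ A); split.
  apply: (@le_measure_A_in _ _ _ D_bounded D_open m (mscale (s c c0) M) (kappa Y)) => //.
    by rewrite [LHS]sE W0 mule0.
  by move=> B BA; rewrite [leLHS]sE EFinM -muleA -gibbs_kernel_fin//; exact: (h B BA).1.
apply: (@le_measure_A_in _ _ _ D_bounded D_open m (kappa Y) (mscale (s C C0) M)) => //.
- rewrite [ltLHS]sE lte_mul_pinfty//; last by have /andP[] := WT.
  by rewrite lee_fin ltW// divr_gt0.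
- by rewrite [LHS]sE W0 mule0.
- by move=> B BA; rewrite [leRHS]sE EFinM -muleA -gibbs_kernel_fin//; exact: (h B BA).2.
Qed.

Context (L : {measure set (config (~` D)) -> \bar R}) (L_fin : (L setT < +oo)%E).

Let par m := {ffun 'I_m -> 'rV[rat]_d * rat}.

(** For each of the countably many test sets the integrated bounds hold over all
    subsets of [V], hence pointwise off a null set. *)
Lemma ae_kernel_bounds m V (c C : R) : measurable V -> 0 < c <= C ->
  (forall A U, A_in m A -> measurable U -> U `<=` V ->
    (c%:E * \int[L]_(Y in U) nu A Y <= \int[L]_(Y in U) kappa Y A /\
     \int[L]_(Y in U) kappa Y A <= C%:E * \int[L]_(Y in U) nu A Y)%E) ->
  {ae L, forall Y, V Y -> forall A, A_in m A ->
    (c%:E * nu A Y <= kappa Y A /\ kappa Y A <= C%:E * nu A Y)%E}.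
Proof.
move=> mV /andP[c0 cC] h; have C0 : 0 < C by exact: lt_le_trans cC.
have finI (f : config (~` D) -> \bar R) U : measurable U -> measurable_fun setT f ->
    (forall Y, 0 <= f Y <= 1)%E -> (\int[L]_(Y in U) f Y < +oo)%E.
  move=> mU mf f01; apply: (@le_lt_trans _ _ (\int[L]_(Y in U) (cst 1%E Y))%E).
    apply: ge0_le_integral => //; [by move=> Y _; have /andP[] := f01 Y| |].
      exact: measurable_funTS.
    by move=> Y _; have /andP[] := f01 Y.
  rewrite integral_cst// mul1e; apply: le_lt_trans L_fin.
  by apply: le_measure; rewrite ?inE.
have one A : A_in m A -> {ae L, forall Y, V Y ->
    (c%:E * nu A Y <= kappa Y A /\ kappa Y A <= C%:E * nu A Y)%E}.
  move=> AA; have mA := measurable_A_in D_bounded D_open AA.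
  have mk := measurable_kernel kappa A mA; have mnu := measurable_gibbs_kernel mA.
  have nu0 Y : (0 <= nu A Y)%E by have /andP[] := gibbs_kernel_bounded Y mA.
  have k01 Y : (0 <= kappa Y A <= 1)%E.
    by rewrite measure_ge0/= -(prob_kernel (s := kappa) Y); apply: le_measure; rewrite ?inE.
  have scale (x : R) U : 0 < x -> measurable U ->
      (\int[L]_(Y in U) (x%:E * nu A Y) = x%:E * \int[L]_(Y in U) nu A Y)%E.
    by move=> x0 mU; rewrite ge0_integralZl//; [exact: measurable_funTS|rewrite lee_fin ltW].
  have mx (x : R) : measurable_fun setT (fun Y => x%:E * nu A Y)%E.
    exact: measurable_funeM.
  have nn (x : R) Y : 0 < x -> (0 <= x%:E * nu A Y)%E.
    by move=> x0; rewrite mule_ge0// lee_fin ltW.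
  have h1 : {ae L, forall Y, V Y -> (c%:E * nu A Y <= kappa Y A)%E}.
    apply: ae_le_integral => //; [by move=> Y; exact: nn|].
    move=> U mU UV; split; first exact: finI.
    by rewrite scale//; exact: (h A U AA mU UV).1.
  have h2 : {ae L, forall Y, V Y -> (kappa Y A <= C%:E * nu A Y)%E}.
    apply: ae_le_integral => //; [by move=> Y; exact: nn|].
    move=> U mU UV; split; last by rewrite scale//; exact: (h A U AA mU UV).2.
    rewrite scale//; have := finI _ U mU mnu (fun Y => gibbs_kernel_bounded Y mA).
    have : (0 <= \int[L]_(Y in U) nu A Y)%E by exact: integral_ge0.
    by case: (\int[L]_(Y in U) nu A Y)%E => // r _ _; rewrite -EFinM ltry.
  by apply: filterS2 h1 h2 => Y h1 h2 VY; split; [exact: h1|exact: h2].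
pose E (s : seq (par m)) := \bigcup_(q in [set` s]) @basic_in_set R d D m q.
pose dec (k : nat) : option (seq (par m)) := choice.unpickle k.
have decK (s : seq (par m)) : dec (choice.pickle s) = Some s by exact: choice.pickleK.
have : {ae L, forall Y, forall k, V Y -> forall s, dec k = Some s -> A_in m (E s) ->
    (c%:E * nu (E s) Y <= kappa Y (E s) /\ kappa Y (E s) <= C%:E * nu (E s) Y)%E}.
  apply: ae_foralln => k; case: (dec k) => [s|]; last exact: aeW.
  have [As|nA] := pselect (A_in m (E s)); last by apply: aeW => Y _ _ [<-].
  by apply: filterS (one _ As) => Y hY /hY h' _ [<-].
apply: filterS => Y hY VY A AA; have [n [F [FA AE]]] := AA.
have /choice[q qF] : forall i, exists q, F i = @basic_in_set R d D m q.
  by move=> i; have /basic_inP[q _ ->] := FA i; exists q.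
pose s : seq (par m) := map q (enum 'I_n.+1).
have EA : A = E s.
  rewrite AE /E; apply/seteqP; split => Z.
    by move=> [i _]; rewrite qF => Fi; exists (q i) => //=; rewrite map_f// mem_enum.
  by move=> [_ /mapP[i _ ->] Fi]; exists i => //; rewrite qF.
by rewrite EA; apply: hY (decK s) _; rewrite -?EA.
Qed.

End KernelBounds.

(** * Passage to the limit along the approximating sequence *)

Lemma law_measure d1 d2 (T1 : measurableType d1) (T2 : measurableType d2) (R : realType)
    (P : probability T1 R) (Y : T1 -> T2) : measurable_fun setT Y ->
  exists L : {measure set T2 -> \bar R}, (L : set T2 -> \bar R) = pushforward P Y.
Proof.
move=> mY; pose Ym : {mfun T1 >-> T2} := HB.pack Y (isMeasurableFun.Build _ _ _ _ Y mY).
by exists (distribution P Ym).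
Qed.

Section Transfer.
Context {R : realType} {d : nat} {dO : measure_display} {Omega : measurableType dO}.
Context (P : probability Omega R) (D : set 'rV[R]_d).
Hypotheses (D_bounded : bounded_set D) (D_open : open D).
Context (X : nat -> Omega -> config [set: 'rV[R]_d]) (Xoo : Omega -> config [set: 'rV[R]_d]).
Hypotheses (mX : forall n, measurable_fun setT (X n)) (mXoo : measurable_fun setT Xoo).
Hypothesis X_cvg : {ae P, forall w, X n w @[n --> \oo] --> Xoo w}.
Hypothesis Xoo_typical : {ae P, forall w, typical D (Xoo w)}.
Hypothesis Xoo_out : {ae P, forall w, points (Xoo w) `&` D !=set0 -> points (Xoo w) `&` ~` D !=set0}.
Local Notation inside Y := (fun w => restr D (Y w)).
Local Notation outside Y := (fun w => restr (~` D) (Y w)).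

Let D_lc : locally_closed D := open_locally_closed D_open.
Let C_lc : locally_closed (~` D) := closed_locally_closed (open_closedC D_open).

Lemma measurable_inside (Y : Omega -> config [set: 'rV[R]_d]) A :
  measurable_fun setT Y -> measurable A -> measurable (inside Y @^-1` A).
Proof.
move=> mY mA; have := measurableT_comp (measurable_restr D_lc) mY measurableT mA.
by rewrite setTI.
Qed.

Lemma measurable_outside (Y : Omega -> config [set: 'rV[R]_d]) U :
  measurable_fun setT Y -> measurable U -> measurable (outside Y @^-1` U).
Proof.
move=> mY mU; have := measurableT_comp (measurable_restr C_lc) mY measurableT mU.
by rewrite setTI.
Qed.

Lemma measurable_B_out B : B_out B -> measurable (B : set (config (~` D))).
Proof.
move=> [n [E [hE ->]]]; apply: fin_bigcup_measurable; first exact: finite_finset.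
by move=> i _; have /basic_outP[q _ ->] := hE i; exact: measurable_out_set.
Qed.

Lemma B_out_nonempty B Y : B_out B -> B Y -> points (Y : config (~` D)) !=set0.
Proof.
move=> [n [E [hE ->]]] [i _]; have /basic_outP[q [[n0 _] _ _ _] ->] := hE i.
move=> [/card_II_cnt[fY cY] _].
have : (0 < cnt (points Y `&` (annulus (ratr q.1.1) (ratr q.1.2) `&` ~` D)))%N by rewrite cY.
by move/(cnt_gt0 fY) => [y [Yy _]]; exists y.
Qed.

Lemma near_symdiff (E_ : nat -> set Omega) (E : set Omega) e :
  (forall k, measurable (E_ k)) -> measurable E ->
  {ae P, forall w, \forall k \near \oo, E_ k w <-> E w} -> 0 < e ->
  \forall k \near \oo, (P (E `\` E_ k) <= e%:E)%E /\ (P (E_ k `\` E) <= e%:E)%E.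
Proof.
move=> mE_ mE h e0.
have h1 : \forall k \near \oo, (P (E `\` E_ k) <= e%:E)%E.
  apply: measure_near0 => //; first by move=> k; exact: measurableD.
  by apply: filterS h => w; apply: filterS => k EE [/EE].
have h2 : \forall k \near \oo, (P (E_ k `\` E) <= e%:E)%E.
  apply: measure_near0 => //; first by move=> k; exact: measurableD.
  by apply: filterS h => w; apply: filterS => k EE [/EE].
by apply: filterS2 h1 h2.
Qed.

Let measure_setU3 (A B C : set Omega) (e : R) : measurable A -> measurable B -> measurable C ->
  (P A <= (e / 3)%:E)%E -> (P B <= (e / 3)%:E)%E -> (P C <= (e / 3)%:E)%E ->
  (P (A `|` B `|` C) <= e%:E)%E.
Proof.
move=> mA mB mC hA hB hC; apply: le_trans (measureU2 P (measurableU _ _ mA mB) mC) _.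
have -> : e = e / 3 + e / 3 + e / 3 by lra.
rewrite !EFinD; apply: leeD => //; apply: le_trans (measureU2 P mA mB) _; exact: leeD.
Qed.

Context (L : {measure set (config (~` D)) -> \bar R}).
Hypothesis LE : forall U, L U = P (outside Xoo @^-1` U).
Context (m : nat) (O_ : set Omega) (V : set (config (~` D))).
Hypotheses (m_gt0 : (0 < m)%N) (mV : measurable V) (OV : O_ = outside Xoo @^-1` V).
Hypothesis Om : O_ `<=` [set w | points (restr D (Xoo w)) #= `I_m].
Context (n_ : nat -> nat) (On : nat -> set Omega) (theta : nat -> R) (c C : R).
Hypotheses (n_oo : n_ @ \oo --> \oo) (theta0 : theta @ \oo --> (0 : R)).
Hypotheses (mOn : forall k, measurable (On k))
  (O_On : O_ `<=` \bigcup_i \bigcap_(k in [set k | (i <= k)%N]) On k) (c0 : 0 < c <= C).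
Context (nu : set (config D) -> config (~` D) -> \bar R).
Hypotheses (mnu : forall A, measurable A -> measurable_fun setT (nu A))
  (nu01 : forall A Y, measurable A -> (0 <= nu A Y <= 1)%E).
Hypothesis approx : forall A B k, A_in m A -> B_out B ->
  let G := (\int[P]_(w in outside (X (n_ k)) @^-1` B `&` On k) nu A (outside Xoo w) + (theta k)%:E)%E in
  let p := P (inside (X (n_ k)) @^-1` A `&` outside (X (n_ k)) @^-1` B `&` On k) in
  (c%:E * G <= p /\ p <= C%:E * G)%E.

Let mu_fun : measurable_fun setT (outside Xoo) := measurableT_comp (measurable_restr C_lc) mXoo.
(** The law of the outer configuration, restricted to the generic ones as
    [out_approx] demands; [outside_le] shows that nothing is lost. *)
Let mu : {measure set (config (~` D)) -> \bar R} := mrestr L (measurable_generic D_open).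

Let muE (U : set (config (~` D))) : mu U = P (outside Xoo @^-1` (U `&` @generic R d D)).
Proof. exact: LE. Qed.

Let mu_fin : (mu setT < +oo)%E.
Proof.
rewrite muE; apply: (le_lt_trans (probability_le1 P _)); last exact: ltry.
by apply: measurable_outside => //; apply: measurableI => //; exact: measurable_generic.
Qed.

Let mu_generic : mu (~` @generic R d D) = 0%E.
Proof. by rewrite muE setICl preimage_set0 measure0. Qed.

Let outside_le E : measurable E ->
  {ae P, forall w, E (outside Xoo w) -> points (outside Xoo w) !=set0} ->
  (P (outside Xoo @^-1` E) <= mu E)%E.
Proof.
move=> mE hE; have mG := measurable_generic D_open.
have mO U := @measurable_outside Xoo U mXoo.
rewrite muE.
apply: (le_trans (measure_le_setD P (mO _ mE) (mO _ (measurableI _ _ mE mG)))).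
rewrite [X in (_ + X)%E](_ : _ = 0%E) ?adde0//.
apply: measure_negligible; first by apply: measurableD; apply: mO => //; exact: measurableI.
have h : {ae P, forall w, E (outside Xoo w) -> generic (outside Xoo w)}.
  by apply: filterS2 Xoo_typical hE => w tw Ew /Ew; exact: typical_generic.
by apply: negligibleS h => w [Ew nG] h; apply: nG; split => //; exact: h.
Qed.

(** The event that the outer configuration lies in [U] is approximated by the event
    that [X (n_ k)] lies outside [D] in a test set close to [U] and that [On k]
    occurs: the test set carves [U] out, and on [U] the events [On k]
    eventually occur because [U] is contained in [V]. *)
Lemma event_bounds A U : A_in m A -> measurable U -> U `<=` V -> D !=set0 ->
  (c%:E * \int[P]_(w in outside Xoo @^-1` U) nu A (outside Xoo w) <=
     P (inside Xoo @^-1` A `&` outside Xoo @^-1` U) /\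
   P (inside Xoo @^-1` A `&` outside Xoo @^-1` U) <=
     C%:E * \int[P]_(w in outside Xoo @^-1` U) nu A (outside Xoo w))%E.
Proof.
move=> AA mU UV D0; have mA := measurable_A_in D_bounded D_open AA.
have mO W := @measurable_outside Xoo W mXoo.
apply: sandwich_limit => //.
- exact: measurable_inside.
- exact: mO.
- exact: (measurableT_comp (mnu mA) mu_fun).
- by move=> w; exact: nu01.
(* A third of the error for the choice of [B], for the convergence of its events
   along the sequence, and for the failure of [On k] on [O_]. *)
move=> e e0; have e30 : 0 < e / 3 by rewrite divr_gt0.
have [B [BB UB BU]] := out_approx D_open mu_fin mu_generic D0 mU e30.
have mB := measurable_B_out BB.
have mXk k := @measurable_outside (X k) B (mX k) mB.
have cvgk : {ae P, forall w, X (n_ k) w @[k --> \oo] --> Xoo w}.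
  by apply: filterS X_cvg => w h; exact: (cvg_comp _ _ n_oo h).
have hA := near_symdiff (E_ := fun k => inside (X (n_ k)) @^-1` A) (E := inside Xoo @^-1` A) _ _ _ e0.
have {}hA : \forall k \near \oo, (P (inside Xoo @^-1` A `\` inside (X (n_ k)) @^-1` A) <= e%:E)%E /\
    (P (inside (X (n_ k)) @^-1` A `\` inside Xoo @^-1` A) <= e%:E)%E.
  apply: hA => [k| |]; [exact: measurable_inside|exact: measurable_inside|].
  apply: filterS2 cvgk Xoo_typical => w cw tw.
  exact: (near_in D_bounded cw tw AA).
have hB : \forall k \near \oo, (P (outside Xoo @^-1` B `\` outside (X (n_ k)) @^-1` B) <= (e / 3)%:E)%E /\
    (P (outside (X (n_ k)) @^-1` B `\` outside Xoo @^-1` B) <= (e / 3)%:E)%E.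
  apply: (near_symdiff (E_ := fun k => outside (X (n_ k)) @^-1` B)) => //; first exact: mO.
  apply: filterS2 cvgk Xoo_typical => w cw tw.
  exact: (near_out cw tw BB).
have mO_ : measurable O_ by rewrite OV; exact: mO.
have hO : \forall k \near \oo, (P (O_ `\` On k) <= (e / 3)%:E)%E.
  apply: measure_near0 => //; first by move=> k; exact: measurableD.
  apply: aeW => w; have [/O_On[i _ h]|nO] := pselect (O_ w).
    by exists i => // k /= ik [_ nOk]; apply: nOk; exact: h.
  by apply: filterE => k [].
have ht : \forall k \near \oo, `|theta k| <= e.
  move/cvgrPdist_le : theta0 => /(_ e e0); apply: filterS => k.
  by rewrite sub0r normrN.
have [k [[[A1 A2] [B1 B2]] [lO t1]]] := filter_ex (filterI (filterI hA hB) (filterI hO ht)).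
exists (inside (X (n_ k)) @^-1` A), (outside (X (n_ k)) @^-1` B `&` On k), (theta k).
have mUB : measurable (U `\` B) by exact: measurableD.
have mBU : measurable (B `\` U) by exact: measurableD.
have PUB : (P (outside Xoo @^-1` (U `\` B)) <= (e / 3)%:E)%E.
  apply: le_trans UB; apply: outside_le => //.
  apply: filterS Xoo_out => w h [Uw _].
  have Ow : O_ w by rewrite OV; exact: UV.
  have /card_II_cnt[fY cY] := Om Ow; apply: h.
  by apply/(cnt_gt0 fY); rewrite cY.
have PBU : (P (outside Xoo @^-1` (B `\` U)) <= (e / 3)%:E)%E.
  apply: le_trans BU; apply: outside_le => //.
  by apply: aeW => w [Bw _]; exact: B_out_nonempty BB Bw.
split => //.
- exact: measurable_inside.
- exact: measurableI.
- split => //.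
    apply: le_trans (measure_setU3 (mO _ mUB) (measurableD (mO _ mB) (mXk (n_ k)))
      (measurableD mO_ (mOn k)) PUB B1 lO).
    apply: le_measure; rewrite ?inE.
    + by apply: measurableD; [exact: mO|exact: measurableI].
    + by do 2?apply: measurableU; [exact: mO|apply: measurableD => //; exact: mO|exact: measurableD].
    move=> w [Uw nE]; have [Bw|nB] := pselect (B (outside Xoo w)); last by left; left.
    have [Bk|nBk] := pselect (B (outside (X (n_ k)) w)); last by left; right.
    by right; split; [rewrite OV; exact: UV|move=> Ok; apply: nE].
  have P0 : (P set0 <= (e / 3)%:E)%E by rewrite measure0 lee_fin ltW.
  apply: le_trans (measure_setU3 (mO _ mBU) (measurableD (mXk (n_ k)) (mO _ mB)) measurable0 PBU B2 P0).
  apply: le_measure; rewrite ?inE.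
  + by apply: measurableD; [exact: measurableI|exact: mO].
  + by do 2?apply: measurableU => //; [exact: mO|apply: measurableD => //; exact: mO].
  move=> w [[Bk _] nU]; left; have [Bw|nB] := pselect (B (outside Xoo w)); last by right.
  by left.
- by have := approx k AA BB; rewrite /= -setIA.
Qed.

End Transfer.

(** * The generalized Gibbs property *)

Lemma measurable_first d (T : measurableType d) (V : nat -> set T) : (forall k, measurable (V k)) ->
  exists idx : T -> nat, measurable_fun setT idx /\ forall x, (exists k, V k x) -> V (idx x) x.
Proof.
move=> mV.
have first x : exists i : nat, ((exists k, V k x) -> V i x /\ forall k, V k x -> (i <= k)%N) /\
    (~ (exists k, V k x) -> i = 0%N).
  have [[k Vk]|nV] := pselect (exists k, V k x); last by exists 0%N.
  have ex : exists k, `[< V k x >] by exists k; exact/asboolP.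
  case: (ex_minnP ex) => i /asboolP Vi le; exists i; split => [_|[]]; last by exists k.
  by split => // l Vl; apply: le; exact/asboolP.
have /choice[idx hidx] := first.
exists idx; split; last by move=> x /(hidx x).1[].
apply: measurable_fun_nat_le => n.
have -> : [set x | (idx x <= n)%N] = (\bigcup_(k in [set k | (k <= n)%N]) V k) `|` ~` (\bigcup_k V k).
  apply/seteqP; split => x /=.
    move=> le; have [ex|nex] := pselect (exists k, V k x).
      by left; exists (idx x) => //; exact: ((hidx x).1 ex).1.
    by right => -[k _ Vk]; apply: nex; exists k.
  move=> [[k /= kn Vk]|nV].
    by apply: leq_trans kn; apply: ((hidx x).1 _).2 => //; exists k.
  by rewrite (hidx x).2// => -[k Vk]; apply: nV; exists k.
apply: measurableU; first by apply: bigcup_measurable => k _.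
by apply: measurableC; exact: bigcupT_measurable.
Qed.

Lemma measure_full d (T : measurableType d) (R : realType) (mu : {measure set T -> \bar R}) A :
  measurable A -> mu (~` A) = 0%E -> mu A = mu setT.
Proof. by move=> mA A0; rewrite -(setUv A) measureU0//; exact: measurableC. Qed.

Section SurfaceLaw.
Context {R : realType} {d : nat} (D : set 'rV[R]_d).

Lemma hausdorff0_le n k : (hausdorff k (set0 : set 'M[R]_(n, d)) <= 0)%E.
Proof.
apply: ge_ereal_sup => _ [e e0 <-]; apply: ereal_inf_lbound.
exists (fun=> set0).
  split; last by [].
  move=> _; apply: (@le_trans _ _ -oo%E); last exact: leNye.
  by apply: ge_ereal_sup => _ [x []].
by rewrite eseries0// => i _ _; rewrite /diam_pow asboolT.
Qed.

(** No vector of [n] points lists a configuration whose number of points is not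
    [n], so the surface measure involved is that of the empty set. *)
Lemma conditioned_poisson_card n k (S : set 'M[R]_(n, d)) (mu : {measure set (config D) -> \bar R}) :
  bounded_set D -> open D -> conditioned_poisson k S mu ->
  mu (~` [set Z : config D | points Z #= `I_n]) = 0%E.
Proof.
move=> bD oD [/andP[a0 ay] muE]; apply/eqP; rewrite eq_le measure_ge0 andbT.
rewrite muE; last by apply: measurableC; exact: measurable_points_card.
rewrite (_ : S `&` _ = set0).
  by apply: mule_le0_ge0; [exact: hausdorff0_le|rewrite inve_ge0 ltW].
apply/seteqP; split => // v [_ [Z nZ [vi vZ]]]; apply: nZ => /=.
by rewrite -vZ; apply/cnt_eqP; [exact: finite_range|exact: cnt_range].
Qed.

End SurfaceLaw.

Section Assembly.
Context {R : realType} {d : nat} {dO : measure_display} {Omega : measurableType dO}.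
Context (P : probability Omega R) (D : set 'rV[R]_d).
Hypotheses (D_bounded : bounded_set D) (D_open : open D).
Context (X : nat -> Omega -> config [set: 'rV[R]_d]) (Xoo : Omega -> config [set: 'rV[R]_d]).
Hypotheses (mX : forall n, measurable_fun setT (X n)) (mXoo : measurable_fun setT Xoo).
Hypothesis X_cvg : {ae P, forall w, X n w @[n --> \oo] --> Xoo w}.
Hypothesis Xoo_typical : {ae P, forall w, typical D (Xoo w)}.
Hypothesis Xoo_out : {ae P, forall w, points (Xoo w) `&` D !=set0 -> points (Xoo w) `&` ~` D !=set0}.
Local Notation inside := (fun w => restr D (Xoo w)).
Local Notation outside := (fun w => restr (~` D) (Xoo w)).
Context (N : config (~` D) -> nat) (mN : measurable_fun setT N).
Hypothesis N_card : {ae P, forall w, points (inside w) #= `I_(N (outside w))}.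
Context (Q kappa : R.-pker (config (~` D)) ~> (config D)).
Hypothesis kappa_cond : cond_distribution P inside outside kappa.
Context (L : {measure set (config (~` D)) -> \bar R}).
Hypothesis LE : (L : set (config (~` D)) -> \bar R) = pushforward P outside.
Context (Phi Psi : 'rV[R]_d -> \bar R) (Phi_pot : potential Phi) (Psi_pot : potential Psi).
Hypothesis Q_card : {ae L, forall Y, Q Y (~` [set Z | points Z #= `I_(N Y)]) = 0%E}.
Hypothesis Z_normalizes : {ae L, forall Y, (0 < gibbs_weight Phi Psi (Q Y) setT < +oo)%E}.

Local Notation W Y A := (gibbs_weight Phi Psi (Q Y) A).
Local Notation nu A Y := (gibbs_kernel Phi Psi Q A Y).
Local Notation card_in m := [set Z : config D | points Z #= `I_m].

Let D_lc : locally_closed D := open_locally_closed D_open.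
Let C_lc : locally_closed (~` D) := closed_locally_closed (open_closedC D_open).
Let mO U : measurable U -> measurable (outside @^-1` U) := measurable_outside D_open mXoo.
Let mI A : measurable A -> measurable (inside @^-1` A) := measurable_inside D_open mXoo.
Let LU U : L U = P (outside @^-1` U). Proof. by rewrite LE. Qed.
Let m_out : measurable_fun setT outside := measurableT_comp (measurable_restr C_lc) mXoo.
Let L_fin : (L setT < +oo)%E.
Proof. by rewrite LU preimage_setT probability_setT ltry. Qed.

Let integral_law f U : measurable U -> measurable_fun setT f -> (forall Y, 0 <= f Y)%E ->
  (\int[L]_(Y in U) f Y = \int[P]_(w in outside @^-1` U) f (outside w))%E.
Proof.
move=> mU mf f0; rewrite LE ge0_integral_pushforward//; exact: measurable_funTS.
Qed.

Let kappa_law A U : measurable A -> measurable U ->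
  (\int[L]_(Y in U) kappa Y A = P (inside @^-1` A `&` outside @^-1` U))%E.
Proof. by move=> mA mU; rewrite kappa_cond// integral_law//; exact: measurable_kernel. Qed.

Let mNm m : measurable [set Y | N Y = m].
Proof. by have := mN measurableT (Y := [set m]) I; rewrite setTI. Qed.

Let ae_outside (U : set (config (~` D))) : measurable U ->
  {ae P, forall w, ~ U (outside w)} -> {ae L, forall Y, ~ U Y}.
Proof.
move=> mU h; have L0 : L U = 0%E.
  rewrite LU; apply: measure_negligible; first exact: mO.
  by apply: negligibleS h => w /= Uw; exact.
by exists U; split => // Y /= /contrapT.
Qed.

(** Rigidity determines the number of points inside from the outer configuration. *)
Lemma kappa_card : {ae L, forall Y, kappa Y (~` card_in (N Y)) = 0%E}.
Proof.
have mC m : measurable (~` card_in m) by apply: measurableC; exact: measurable_points_card.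
have h m : {ae L, forall Y, N Y = m -> (kappa Y (~` card_in m) <= 0)%E}.
  apply: (@ae_le_integral _ _ _ L [set Y | N Y = m] (cst 0%E)) => //.
    exact: measurable_kernel.
  move=> U mU UN; rewrite integral0; split => //.
  rewrite kappa_law// measure_negligible//; first by apply: measurableI; [exact: mI|exact: mO].
  apply: negligibleS N_card => w [nw /UN Uw] /= cw; apply: nw; rewrite /= -Uw; exact: cw.
have := ae_foralln h; apply: filterS => Y hY; apply/eqP.
by rewrite eq_le measure_ge0 andbT; exact: hY.
Qed.

Let bounds_on m (V : set (config (~` D))) (c C : R) := [/\ measurable V, 0 < c <= C &
  {ae L, forall Y, V Y -> N Y = m /\ forall A, A_in m A ->
    (c%:E * nu A Y <= kappa Y A /\ kappa Y A <= C%:E * nu A Y)%E}].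

(** With no point inside, both the conditional law and the normalized Gibbs weight
    are the point mass at the empty configuration. *)
Let bounds_empty : bounds_on 0 [set Y | N Y = 0%N] 1 1.
Proof.
split => //; first by rewrite ltr01 lexx.
have Af (A : set (config D)) : A_in 0 A -> A = card_in 0.
  have b0 B : basic_in 0 B -> B = card_in 0.
    by move=> [c [r [_ _ _ ->]]]; apply/seteqP; split => Z; [case|split => // -[]].
  move=> [n [E [hE ->]]]; apply/seteqP; split => Z.
    by move=> [i _]; rewrite (b0 _ (hE i)).
  by move=> Z0; exists ord0 => //; rewrite (b0 _ (hE ord0)).
apply: filterS3 kappa_card Q_card Z_normalizes => Y k0 Q0 WT /= NY; split => // A /Af ->; rewrite NY in k0 Q0.
have mC : measurable (card_in 0) by exact: measurable_points_card.
have -> : kappa Y (card_in 0) = 1%E by rewrite measure_full// prob_kernel.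
have -> : nu (card_in 0) Y = 1%E.
  have [M ME] := gibbs_weight_measure D_bounded D_lc Phi_pot Psi_pot (Q Y).
  have M0 : M (~` card_in 0) = 0%E by rewrite ME gibbs_weight_null//; exact: measurableC.
  have /andP[W0 Wy] := WT; rewrite /gibbs_kernel -!ME measure_full// divee//.
    by rewrite ge0_fin_numE// ME.
  by rewrite gt_eqF// ME.
by rewrite mule1.
Qed.

Let bounds_set0 m : bounds_on m set0 1 1.
Proof. by split => //; [rewrite ltr01 lexx|exact: aeW]. Qed.

Hypothesis approx : approximate_gibbs P X Xoo (gibbs_kernel Phi Psi Q).

(** On the event of [m] points inside, the constants come from the exhausting
    events; almost every outer configuration falls into one of them. *)
Let cover m : exists (V : nat -> set (config (~` D))) (c C : nat -> R),
  (forall j, bounds_on m (V j) (c j) (C j)) /\ {ae L, forall Y, N Y = m -> exists j, V j Y}.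
Proof.
have mcard n : measurable (inside @^-1` card_in n) by apply: mI; exact: measurable_points_card.
have [->|m0] := posnP m.
  exists (fun=> [set Y | N Y = 0%N]), (fun=> 1), (fun=> 1); split; first by move=> _; exact: bounds_empty.
  by apply: aeW => Y NY; exists 0%N.
have [P0|P0] := leP (P (inside @^-1` card_in m)) 0%E.
  exists (fun=> set0), (fun=> 1), (fun=> 1); split; first by move=> _; exact: bounds_set0.
  have {}P0 : P (inside @^-1` card_in m) = 0%E by apply/eqP; rewrite eq_le P0 measure_ge0.
  have h : {ae P, forall w, ~ (N (outside w) = m)}.
    have h1 : {ae P, forall w, ~ (inside @^-1` card_in m) w}.
      by apply: (@negligibleS _ _ _ _ (inside @^-1` card_in m)) => [w /= /contrapT//|]; exact/negligibleP.
    by apply: filterS2 N_card h1 => w Nw h1 NwE; apply: h1; rewrite /= -NwE.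
  by apply: filterS (ae_outside (mNm m) h) => Y nY /nY.
have [E_ [E_event [[mE_ _ E_in E_lim] E_approx]]] := approx m0 P0.
have D0 : D !=set0.
  apply: contrapT => D0; suff E : inside @^-1` card_in m = set0 by move: P0; rewrite E measure0 ltxx.
  apply/seteqP; split => // w /card_II_cnt[fw cw]; apply: D0.
  have : (0 < cnt (points (restr D (Xoo w))))%N by rewrite cw.
  by move=> /(cnt_gt0 fw)[x [_ Dx]]; exists x.
have /choice[V OV] : forall j, exists V, measurable V /\ E_ j = outside @^-1` V.
  by move=> j; have [V mV OV] := E_event j; exists V.
have mV j := (OV j).1.
have /choice[cC hcC] : forall j, exists cC : R * R, bounds_on m (V j) cC.1 cC.2.
  move=> j; have [n_ [On [theta [c [C [_ [n_oo [theta0 [On_event [_ [E_On [c0 ap]]]]]]]]]]]] := E_approx j.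
  have mOn k : measurable (On k).
    by have [U mU ->] := On_event k; exact: measurable_outside.
  exists (c, C); split => //=.
  have NV : {ae L, forall Y, ~ (V j `&` ~` [set Y | N Y = m]) Y}.
    apply: ae_outside; first by apply: measurableI => //; exact: measurableC.
    apply: filterS N_card => w Nw [Vw nN]; apply: nN.
    have : E_ j w by rewrite (OV j).2.
    by move=> /E_in /card_II_cnt[_ <-]; have /card_II_cnt[_ ->] := Nw.
  have bd : {ae L, forall Y, V j Y -> forall A, A_in m A ->
      (c%:E * nu A Y <= kappa Y A /\ kappa Y A <= C%:E * nu A Y)%E}.
    apply: (@ae_kernel_bounds _ _ _ D_bounded D_open) => // A U AA mU UV.
    have mA := measurable_A_in D_bounded D_open AA.
    have mnu := @measurable_gibbs_kernel _ _ _ D_bounded D_open _ _ Phi_pot Psi_pot Q.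
    have nu01 := @gibbs_kernel_bounded _ _ _ D_bounded D_open _ _ Phi_pot Psi_pot Q.
    rewrite kappa_law// integral_law//; [|exact: mnu|by move=> Y; have /andP[] := nu01 A Y mA].
    by apply: (@event_bounds _ _ _ _ P D D_bounded D_open X Xoo mX mXoo X_cvg Xoo_typical Xoo_out
      L LU m (E_ j) (V j) m0 (mV j) (OV j).2 (E_in j) n_ On theta c C n_oo theta0 mOn E_On c0) => //; exact: ap.
  apply: filterS2 NV bd => Y NV bd VY; split; last exact: bd.
  by apply: contrapT => nN; apply: NV.
exists V, (fun j => (cC j).1), (fun j => (cC j).2); split => //.
pose U := [set Y | N Y = m] `\` \bigcup_j V j.
have mU : measurable U by apply: measurableD => //; exact: bigcupT_measurable.
have h : {ae L, forall Y, ~ U Y}.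
  exists U; split => //; last by move=> Y /= /contrapT.
  rewrite LU; apply/eqP; rewrite eq_le measure_ge0 andbT.
  have le j : (P (outside @^-1` U) <= P (inside @^-1` card_in m `\` E_ j))%E.
    have mDj : measurable (inside @^-1` card_in m `\` E_ j) by exact: measurableD.
    have mUo : measurable (outside @^-1` U) by exact: mO.
    apply: le_trans (measure_le_setD P mUo mDj) _.
    rewrite [X in (_ + X)%E](_ : _ = 0%E) ?adde0//; apply: measure_negligible; first exact: measurableD.
    apply: negligibleS N_card => w [[/= Nw nV] nD] cw; apply: nD; split; first by rewrite /= -Nw.
    by rewrite (OV j).2 => Vw; apply: nV; exists j.
  apply/lee_addgt0Pr => e e0; rewrite add0e.
  have [j _ /(_ j (leqnn _)) hj] := cvge0_near E_lim e0.
  exact: le_trans (le j) hj.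
by apply: filterS h => Y nU NY; apply: contrapT => nV; apply: nU; split => // -[j _ Vj]; apply: nV; exists j.
Qed.

(** Countably many regions with their constants cover almost every outer
    configuration; the bounding functions take the constants of the first region
    that applies, divided by the normalization of the Gibbs kernel. *)
Lemma gibbs_of_approximate : exists m M : config (~` D) -> R,
  [/\ measurable_fun setT m, measurable_fun setT M, forall Y, 0 < m Y, forall Y, 0 < M Y &
    {ae L, forall Y, forall A, measurable A ->
      ((m Y)%:E * W Y A <= kappa Y A /\ kappa Y A <= (M Y)%:E * W Y A)%E}].
Proof.
have /choice[V /choice[c /choice[C h]]] := cover.
pose p k : nat * nat := odflt (0%N, 0%N) (choice.unpickle k).
have pK m j : p (choice.pickle (m, j)) = (m, j) by rewrite /p choice.pickleK.
pose V' k := V (p k).1 (p k).2; pose c' k := c (p k).1 (p k).2; pose C' k := C (p k).1 (p k).2.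
have bV k : bounds_on (p k).1 (V' k) (c' k) (C' k) by exact: (h (p k).1).1.
have [idx [midx idxV]] := measurable_first (fun k => let: And3 mV _ _ := bV k in mV).
have c0 k : 0 < c' k by have [_ /andP[]] := bV k.
have C0 k : 0 < C' k by have [_ /andP[c1 c2] _] := bV k; exact: lt_le_trans c2.
pose z Y := fine (W Y setT)^-1.
have mz : measurable_fun setT z.
  apply: (measurableT_comp (fine_measurable measurableT)).
  apply: measurable_inve_ge0; first by move=> Y; apply: integral_ge0 => *; exact: expeR_ge0.
  exact: measurable_gibbs_weight.
pose b (a : nat -> R) Y := if 0 < z Y then a (idx Y) * z Y else 1.
have mb a : measurable_fun setT (b a).
  apply: measurable_fun_ifT => //.
    by apply: measurable_fun_ltr.
  apply: measurable_funM => //.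
  have ma : measurable_fun setT a by [].
  exact: (measurableT_comp ma midx).
have b0 a : (forall k, 0 < a k) -> forall Y, 0 < b a Y.
  by move=> a0 Y; rewrite /b; case: ifP => // z0; exact: mulr_gt0.
exists (b c'), (b C'); split => //; [exact: b0|exact: b0|].
have hc : {ae L, forall Y, exists k, V' k Y}.
  have := ae_foralln (fun m => (h m).2); apply: filterS => Y hY.
  by have [j Vj] := hY _ erefl; exists (choice.pickle (N Y, j)); rewrite /V' pK.
have hb : {ae L, forall Y, forall k, V' k Y -> N Y = (p k).1 /\ forall A, A_in (p k).1 A ->
    ((c' k)%:E * nu A Y <= kappa Y A /\ kappa Y A <= (C' k)%:E * nu A Y)%E}.
  by apply: ae_foralln => k; have [_ _] := bV k.
have hz : {ae L, forall Y, Q Y (~` card_in (N Y)) = 0%E /\ (0 < W Y setT < +oo)%E}.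
  by apply: filterS2 Q_card Z_normalizes.
have hcb : {ae L, forall Y, V' (idx Y) Y /\ forall k, V' k Y ->
    N Y = (p k).1 /\ forall A, A_in (p k).1 A ->
    ((c' k)%:E * nu A Y <= kappa Y A /\ kappa Y A <= (C' k)%:E * nu A Y)%E}.
  by apply: filterS2 hc hb => Y ex bd; split => //; exact: idxV.
apply: filterS3 hcb kappa_card hz => Y [VY bd] k0 [Q0 WT] A mA.
have [NY bdY] := bd _ VY; rewrite NY in k0 Q0.
have [/andP[W0 Wy]] := WT; have Wf : (fine (W Y setT))%:E = W Y setT by rewrite fineK// ge0_fin_numE// ltW.
have fW : 0 < fine (W Y setT) by rewrite fine_gt0.
have zE : z Y = (fine (W Y setT))^-1 by rewrite /z -Wf inver gt_eqF.
rewrite /b zE invr_gt0 fW.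
have [_ cC _] := bV (idx Y).
exact: (kernel_bounds_extend D_bounded D_open Phi_pot Psi_pot cC WT Q0 k0 bdY mA).
Qed.

End Assembly.

Theorem corollary2p2 (R : realType) (d : nat) (d_gt0 : (0 < d)%N)
  (dO : measure_display) (Omega : measurableType dO) (P : probability Omega R)
  (X : nat -> {RV P >-> config [set: 'rV[R]_d]})
  (Xoo : {RV P >-> config [set: 'rV[R]_d]})
  (X_ac : forall n, (0 < n)%N -> intensity_ac P (X n))
  (Xoo_ac : intensity_ac P Xoo)
  (X_cvg : {ae P, forall w, X n w @[n --> \oo] --> Xoo w})
  (Xoo_rigid : number_rigid P Xoo)
  (D : set 'rV[R]_d) (D_bounded : bounded_set D) (D_open : open D)
  (D_boundary : null_boundary D)
  (Xoo_out : {ae P, forall w, Xoo w `&` D !=set0 -> Xoo w `&` ~` D !=set0})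
  (N : config (~` D) -> nat) (N_rigid : rigidity_function P Xoo N)
  (kappa : R.-pker (config (~` D)) ~> (config D))
  (kappa_cond : cond_distribution P
     (fun w => restr D (Xoo w)) (fun w => restr (~` D) (Xoo w)) kappa)
  (k : config (~` D) -> nat)
  (Sigma : forall Y : config (~` D), set 'M[R]_(N Y, d))
  (Sigma_smooth : ae_law P (fun w => restr (~` D) (Xoo w))
     (fun Y => smooth_submanifold (k Y) (Sigma Y) /\ symmetric_set (Sigma Y)))
  (Sigma_lies : ae_law P (fun w => restr (~` D) (Xoo w))
     (fun Y => {ae kappa Y, forall Z, lies_on (Sigma Y) Z}))
  (Phi Psi : 'rV[R]_d -> \bar R)
  (Phi_pot : potential Phi) (Psi_pot : potential Psi)
  (Q : R.-pker (config (~` D)) ~> (config D))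
  (Q_poisson : ae_law P (fun w => restr (~` D) (Xoo w))
     (fun Y => conditioned_poisson (k Y) (Sigma Y) (Q Y)))
  (Z_normalizes : ae_law P (fun w => restr (~` D) (Xoo w))
     (fun Y => (0 < gibbs_weight Phi Psi (Q Y) setT < +oo)%E)) :
  approximate_gibbs P X Xoo (gibbs_kernel Phi Psi Q) ->
  generalized_gibbs P (fun w => restr (~` D) (Xoo w)) Phi Psi Q kappa.
Proof.
move=> approx.
have mXn n : measurable_fun setT (X n) by exact: measurable_funPT.
have mXoo : measurable_fun setT Xoo by exact: measurable_funPT.
have C_lc : locally_closed (~` D) by apply: closed_locally_closed; exact: open_closedC.
have [L LE] := law_measure P (measurableT_comp (measurable_restr C_lc) mXoo).
have [mN N_card] := N_rigid.
have Xoo_typical := ae_typical mXoo Xoo_ac d_gt0 D_bounded D_boundary.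
rewrite /ae_law -LE in Q_poisson Z_normalizes.
have Q_law : {ae L, forall Y, conditioned_poisson (k Y) (Sigma Y) (Q Y)} := Q_poisson.
have Q_card : {ae L, forall Y, Q Y (~` [set Z | points Z #= `I_(N Y)]) = 0%E}.
  by apply: filterS Q_law => Y; exact: conditioned_poisson_card.
have [m [M [mm mM m0 M0 h]]] := gibbs_of_approximate D_bounded D_open mXn mXoo X_cvg
  Xoo_typical Xoo_out mN N_card kappa_cond LE Phi_pot Psi_pot Q_card Z_normalizes approx.
by exists m, M; split => //; rewrite /ae_law -LE.
Qed.
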